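(* Let $l\ge 3$, let $a_1<\dots<a_{2l}$ be real, and let $(S,\tau)$ be the minitwistor space associated to the ALE hyperkähler metric on the minimal resolution of the A$_{2l-1}$-singularity determined by $a_1,\dots,a_{2l}$. Under an isomorphism, compatible with real structures and with the conic bundle structures over $\mathbb{CP}_1$, of $S$ with the minimal resolution of a minitwistor space $\mathscr T$ associated to a real hyperelliptic curve of genus $l-1$, the minitwistor lines in $S$ and the pullbacks of minitwistor lines in $\mathscr T$ under the minimal resolution belong to the same linear system.
   Context: **The surface $(S,\tau)$ and its minitwistor lines.** Let $Z$ be the hypersurface $xy=(z-a_1u)\cdots(z-a_{2l}u)$ in the total space of $\mathcal O(2l)\oplus\mathcal O(2l)\oplus\mathcal O(2)$ over $\mathbb{CP}_1$, where $u$ is an affine coordinate on $\mathbb{CP}_1$, $x,y\in\mathcal O(2l)$, $z\in\mathcal O(2)$. A resolution of $Z$ is the twistor space of an ALE hyperkähler metric on the minimal resolution of $\mathbb C^2/\Gamma$, $\Gamma\simeq\mathbb Z_{2l}\subset{\rm SU}(2)$. $Z$ has the real structure $(x,y,z,u)\mapsto(\bar y/\bar u^{2l},\bar x/\bar u^{2l},-\bar z/\bar u^2,-1/\bar u)$ and the $\mathbb C^*$-action $(x,y,z,u)\mapsto(s^lx,s^ly,sz,su)$. The fiber over $u=1$ is the affine surface $xy=(z-a_1)\cdots(z-a_{2l})$, and $S$ is its compactification obtained by regarding $z$ as an affine coordinate on $\mathbb{CP}_1$ and $(x,y)$ as affine fiber coordinates on the $\mathbb{CP}_2$-bundle $\mathbb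 P(\mathcal O(l)\oplus\mathcal O(l)\oplus\mathcal O)$ over $\mathbb{CP}_1$. $S$ is a smooth conic bundle over $\mathbb{CP}_1$, with real structure $\tau(x,y,z)=((-1)^l\bar y,(-1)^l\bar x,\bar z)$. The minitwistor lines in $S$ are the images (closures) of twistor lines of the twistor space under the quotient map by the $\mathbb C^*$-action, $(x,y,z,u)\mapsto(u^{-l}x,u^{-l}y,u^{-1}z)$. **The surface $(\mathscr T,\sigma)$ and its minitwistor lines.** For $g>1$ and real numbers $\lambda_1<\lambda_1'<\dots<\lambda_{g+1}<\lambda'_{g+1}$, put $f(z)=-\prod_{i=1}^{g+1}(z-\lambda_i)(z-\lambda_i')$. The minitwistor space associated to the real hyperelliptic curve $\Sigma:w^2=f(z)$ is the surface $\mathscr T\subset\mathbb{CP}_{g+3}$ of points $[X_0:\dots:X_{g+1}:W:Y]$ with $(X_0,\dots,X_{g+1})$ in the affine cone over the rational normal curve $\Lambda=\{[1:z:\dots:z^{g+1}]\}\subset\mathbb{CP}_{g+1}$ and $Y^2=q(X)-W^2$, where $q$ is a quadratic form with $q(1,z,\dots,z^{g+1})=f(z)$ (affinely $y^2=f(z)-w^2$), with real structure $\sigma(z,w,y)=(\bar z,\bar w,\bar y)$. The minitwistor lines in $\mathscr T$ are certain hyperplane sections of $\mathscr T\subset\mathbb{CP}_{g+3}$: the regular ones are irreducible rational hyperplane sections with exactly $g$ nodes, disjoint from the two singular points of $\mathscr T$; the irregular ones are the hyperplane sections consisting of $g$ reducible fibers and one smooth fiber of the (rational) conic bundle $\mathscr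 T\dashrightarrow\Lambda$ given by $z$.
   Formalization: Twistor lines on which z/u is constant are excluded from the minitwistor lines in S: their images are points or lie in fibres of the conic bundle, so they are not in the linear system of the other minitwistor lines and the literal claim fails for them. *)

(* Defs.v *)
From HB Require Import structures.
From mathcomp Require Import all_boot all_order all_algebra.
From mathcomp Require Import classical_sets reals complex mpoly.
Set Implicit Arguments. Unset Strict Implicit. Unset Printing Implicit Defensive.
Import Order.TTheory GRing.Theory Num.Theory.
Local Open Scope classical_set_scope.
Local Open Scope ring_scope.

(* Varieties in homogeneous coordinates.  A variety is a set of coordinate   *)
(* vectors together with the relation "same point" (rescaling by a torus).   *)
(* Its Zariski topology and its regular functions are those of the quotient. *)

Record variety (K : fieldType) := Variety {
  ambient : nat;
  pts : set 'rV[K]_ambient;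
  same : 'rV[K]_ambient -> 'rV[K]_ambient -> Prop }.

Definition coords (K : fieldType) (V : variety K) : Type := 'rV[K]_(ambient V).

Definition proj (K : fieldType) (n : nat) (A : set 'rV[K]_n) : variety K :=
  @Variety K n [set v | v != 0 /\ A v]
    (fun v w => exists2 c : K, c != 0 & w = c *: v).

Definition P1 (K : fieldType) : variety K := @proj K 2 setT.

Definition restrict (K : fieldType) (V : variety K) (U : set (coords V)) :
    variety K :=
  @Variety K (ambient V) (@pts K V `&` U) (@same K V).

(* Q holds on a Zariski neighbourhood of p in V *)
Definition locally (K : fieldType) (V : variety K) (p : coords V)
    (Q : coords V -> Prop) : Prop :=
  exists2 H : {mpoly K[ambient V]}, H.@[p 0] != 0 &
    forall q : coords V, pts q -> H.@[q 0] != 0 -> Q q.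

Definition zclosed (K : fieldType) (V : variety K) (A : set (coords V)) : Prop :=
  (forall p q : coords V, pts p -> pts q -> same p q -> A p -> A q) /\
  (forall p : coords V, pts p -> ~ A p -> locally p (fun q => ~ A q)).

Definition zclosure (K : fieldType) (V : variety K) (A : set (coords V)) :
    set (coords V) :=
  [set p | pts p /\ forall B : set (coords V), zclosed B -> A `<=` B -> B p].

(* for subsets A of V *)
Definition irreducible (K : fieldType) (V : variety K) (A : set (coords V)) :
    Prop :=
  A !=set0 /\
  forall B B' : set (coords V), zclosed B -> zclosed B' ->
    A `<=` B `|` B' -> A `<=` B \/ A `<=` B'.

(* Germs at p are represented by total functions that are well defined on    *)
(* points of V and are a quotient of polynomials near p.                     *)
Definition regular_at (K : fieldType) (V : variety K) (p : coords V)
    (h : coords V -> K) : Prop :=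
  (forall q q' : coords V, pts q -> pts q' -> same q q' -> h q = h q') /\
  exists G H : {mpoly K[ambient V]}, H.@[p 0] != 0 /\
    forall q : coords V, pts q -> H.@[q 0] != 0 -> h q = G.@[q 0] / H.@[q 0].

(* u_0, ..., u_(d-1) generate the maximal ideal of the local ring at p *)
Definition generate_maximal_ideal (K : fieldType) (V : variety K) (d : nat)
    (p : coords V) (u : 'I_d -> coords V -> K) : Prop :=
  (forall i, regular_at p (u i) /\ u i p = 0) /\
  forall h, regular_at p h -> h p = 0 ->
    exists2 k : 'I_d -> coords V -> K, (forall i, regular_at p (k i)) &
      locally p (fun q => h q = \sum_i k i q * u i q).

(* For V of dimension d, the local ring at p is a regular local ring. *)
Definition nonsingular_at (K : fieldType) (V : variety K) (d : nat)
    (p : coords V) : Prop :=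
  exists u : 'I_d -> coords V -> K, generate_maximal_ideal p u.

Definition morphism (K : fieldType) (V V' : variety K)
    (f : coords V -> coords V') : Prop :=
  [/\ forall p, pts p -> pts (f p),
      forall p q, pts p -> pts q -> same p q -> same (f p) (f q) &
      forall p, pts p -> exists G : 'I_(ambient V') -> {mpoly K[ambient V]},
        locally p (fun q => same (f q) (\row_j (G j).@[q 0]))].

Definition isomorphism (K : fieldType) (V V' : variety K)
    (f : coords V -> coords V') : Prop :=
  morphism f /\
  exists g : coords V' -> coords V,
    [/\ morphism g, forall p, pts p -> same (g (f p)) p &
        forall q, pts q -> same (f (g q)) q].

Definition projective_variety (K : fieldType) (n : nat) (B : set 'rV[K]_n) :
    Prop :=
  (exists2 I : set {mpoly K[n]},
     forall F, I F -> exists d : nat, F \is d.-homog &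
     B = [set v : 'rV[K]_n | forall F, I F -> F.@[v 0] = 0]) /\
  @irreducible K (proj B) (@pts K (proj B)).

Definition resolution (K : fieldType) (V : variety K) (n : nat)
    (B : set 'rV[K]_n) (mu : coords (proj B) -> coords V) : Prop :=
  [/\ projective_variety B,
      forall p : coords (proj B), pts p -> nonsingular_at 2 p,
      morphism mu &
      @isomorphism K (@restrict K (proj B) [set p | nonsingular_at 2 (mu p)])
        (@restrict K V [set p | nonsingular_at 2 p]) mu].

(* every resolution of the surface V factors through mu *)
Definition minimal_resolution (K : fieldType) (V : variety K) (n : nat)
    (B : set 'rV[K]_n) (mu : coords (proj B) -> coords V) : Prop :=
  resolution mu /\
  forall (n' : nat) (B' : set 'rV[K]_n')
    (mu' : coords (proj B') -> coords V), resolution mu' ->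
    exists2 h : coords (proj B') -> coords (proj B), morphism h &
      forall p : coords (proj B'), pts p -> same (mu (h p)) (mu' p).

(* image of a generically injective morphism from the projective line *)
Definition rational_curve (K : fieldType) (V : variety K)
    (A : set (coords V)) : Prop :=
  exists f : coords (P1 K) -> coords V,
    [/\ morphism f,
        A = [set p | pts p /\ exists2 e, @pts K (P1 K) e & same (f e) p] &
        exists2 e0, @pts K (P1 K) e0 &
          locally e0 (fun e => forall e' : coords (P1 K),
            pts e' -> same (f e) (f e') -> same e e')].

(* The curve h = 0 on the surface V has an ordinary double point at p:       *)
(* h = u_0 u_1 modulo the cube of the maximal ideal (u_0, u_1).              *)
Definition node_at (K : fieldType) (V : variety K) (p : coords V)
    (h : coords V -> K) : Prop :=
  exists u : 'I_2 -> coords V -> K, generate_maximal_ideal p u /\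
    exists2 k : 'I_4 -> coords V -> K, (forall i, regular_at p (k i)) &
      locally p (fun q => h q = u 0 q * u 1 q +
                 \sum_(i < 4) k i q * u 0 q ^+ i * u 1 q ^+ (3 - i)).

(* An effective divisor given by its local equations: D p h means that h is  *)
(* a local equation of D at p.                                               *)
Definition effdiv (K : fieldType) (V : variety K) : Type :=
  coords V -> (coords V -> K) -> Prop.

Definition ideal_at (K : fieldType) (V : variety K) (C : set (coords V))
    (p : coords V) (h : coords V -> K) : Prop :=
  regular_at p h /\ locally p (fun q => C q -> h q = 0).

(* the reduced curve C: its ideal at p is generated by the local equation *)
Definition curve_divisor (K : fieldType) (V : variety K) (C : set (coords V)) :
    effdiv V :=
  fun p h => ideal_at C p h /\
    forall h', ideal_at C p h' -> exists2 k, regular_at p k &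
      locally p (fun q => h' q = k q * h q).

Definition linear_form (K : fieldType) (n : nat) (c v : 'rV[K]_n) : K :=
  \sum_i c 0 i * v 0 i.

Definition hyperplane_section (K : fieldType) (V : variety K)
    (c : 'rV[K]_(ambient V)) : set (coords V) :=
  [set p | pts p /\ linear_form c p = 0].

(* pullback of the hyperplane section c = 0 of V' by f : V -> V' *)
Definition pullback_divisor (K : fieldType) (V V' : variety K)
    (f : coords V -> coords V') (c : 'rV[K]_(ambient V')) : effdiv V :=
  fun p h => exists2 c0 : 'rV[K]_(ambient V'), linear_form c0 (f p) != 0 &
    h = fun q => linear_form c (f q) / linear_form c0 (f q).

(* D - D' is the divisor of a nonzero rational function G / H on V *)
Definition linearly_equivalent (K : fieldType) (V : variety K)
    (D D' : effdiv V) : Prop :=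
  exists G H : {mpoly K[ambient V]},
    [/\ exists2 p : coords V, pts p & G.@[p 0] != 0,
        exists2 p : coords V, pts p & H.@[p 0] != 0,
        forall p q : coords V, pts p -> pts q -> same p q ->
          G.@[p 0] * H.@[q 0] = G.@[q 0] * H.@[p 0] &
        forall p : coords V, pts p -> exists h h' e : coords V -> K,
          [/\ D p h, D' p h', regular_at p e, e p != 0 &
              locally p (fun q =>
                G.@[q 0] * h' q = e q * H.@[q 0] * h q)]].

Definition coord (K : fieldType) (n : nat) (v : 'rV[K]_n.+1) (k : nat) : K :=
  v 0 (inord k).

Definition conj_row (R : realType) (n : nat) (v : 'rV[R[i]]_n) : 'rV[R[i]]_n :=
  \row_j (v 0 j)^*.

Definition row5 (K : fieldType) (z0 z1 x y t : K) : 'rV[K]_5 :=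
  \row_(j < 5) [:: z0; z1; x; y; t]`_j.

(* (z0, z1; x, y, t) are the homogeneous coordinates of the bundle           *)
(* P(O(l) + O(l) + O) over the projective line with affine coordinate        *)
(* z = z1 / z0; the affine fibre coordinates are x / t and y / t on z0 = 1.  *)
Definition surfaceS (R : realType) (l : nat) (a : 'I_(2 * l) -> R) :
    variety R[i] :=
  @Variety R[i] 5
    [set v | [/\ (coord v 0 != 0) || (coord v 1 != 0),
        [|| coord v 2 != 0, coord v 3 != 0 | coord v 4 != 0] &
        coord v 2 * coord v 3 = coord v 4 ^+ 2 *
          \prod_i (coord v 1 - (a i)%:C%C * coord v 0)]]
    (fun v w => exists b c : R[i], [/\ b != 0, c != 0 &
       w = row5 (b * coord v 0) (b * coord v 1) (c * b ^+ l * coord v 2)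
                (c * b ^+ l * coord v 3) (c * coord v 4)]).

Definition tau (R : realType) (l : nat) (v : 'rV[R[i]]_5) : 'rV[R[i]]_5 :=
  row5 (coord v 0)^* (coord v 1)^* ((-1) ^+ l * (coord v 3)^*)
       ((-1) ^+ l * (coord v 2)^*) (coord v 4)^*.

Definition conicS (K : fieldType) (v : 'rV[K]_5) : 'rV[K]_2 :=
  \row_(j < 2) coord v j.

(* Twistor lines, as sections u |-> (x u, y u, z u, u) of Z.  Reality gives  *)
(* z = A u^2 + b u - A^* with b real, so that for A != 0 each factor         *)
(* z - a_i u has two roots g, one with A g > 0 and one with A g < 0.  Among  *)
(* the real sections of Z, the twistor lines are those where x vanishes at   *)
(* the positive root of every factor (and y at the negative one), together   *)
(* with their limits for A = 0 (Hitchin, Polygons and gravitons).  The       *)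
(* opposite choice, which corresponds to the other resolution of Z obtained  *)
(* by exchanging x and y, gives the same curves in S: substitute             *)
(* u |-> - A^* / (A u).                                                      *)
Definition twistor_line (R : realType) (l : nat) (a : 'I_(2 * l) -> R)
    (x y z : {poly R[i]}) : Prop :=
  [/\ [/\ (size x <= (2 * l).+1)%N, (size y <= (2 * l).+1)%N &
          (size z <= 3)%N],
      x * y = \prod_i (z - (a i)%:C%C *: 'X),
      forall u : R[i], u != 0 ->
        [/\ x.[- (u^*)^-1] = (y.[u])^* / u^* ^+ (2 * l),
            y.[- (u^*)^-1] = (x.[u])^* / u^* ^+ (2 * l) &
            z.[- (u^*)^-1] = - (z.[u])^* / u^* ^+ 2] &
      if z`_2 == 0
      then exists c : R[i], x = c *: 'X^#|[pred i | (a i)%:C%C < z`_1]|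
      else forall g : R[i], root x g -> 0 < z`_2 * g].

(* image under the quotient map by the action of the multiplicative group *)
Definition quotient_image (R : realType) (l : nat) (a : 'I_(2 * l) -> R)
    (x y z : {poly R[i]}) : set (coords (surfaceS a)) :=
  [set v | @pts _ (surfaceS a) v /\ exists2 u : R[i], u != 0 &
     @same _ (surfaceS a)
       (row5 1 (z.[u] / u) (x.[u] / u ^+ l) (y.[u] / u ^+ l) 1) v].

(* The twistor lines with z`_2 = 0, on which z / u is constant, are left     *)
(* out: their images are points, or multiply covered fibres of S -> P1.      *)
Definition minitwistor_lineS (R : realType) (l : nat) (a : 'I_(2 * l) -> R)
    (C : set (coords (surfaceS a))) : Prop :=
  exists x y z : {poly R[i]},
    [/\ twistor_line a x y z, z`_2 != 0 &
        C = zclosure (@quotient_image R l a x y z)].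

Definition interlaced (R : realType) (g : nat) (lam lam' : 'I_g.+1 -> R) :
    Prop :=
  (forall i, lam i < lam' i) /\
  (forall i j : 'I_g.+1, (i < j)%N -> lam' i < lam j).

Definition hyperelliptic_form (R : realType) (g : nat)
    (lam lam' : 'I_g.+1 -> R) (q : {mpoly R[i][g.+2]}) : Prop :=
  q \is 2.-homog /\
  forall z : R[i], q.@[fun i : 'I_g.+2 => z ^+ i] =
    - \prod_(i < g.+1) ((z - (lam i)%:C%C) * (z - (lam' i)%:C%C)).

(* coordinates (X_0, ..., X_(g+1), W, Y); X is c times the point of the      *)
(* rational normal curve with parameter e = [1 : z]                          *)
Definition over_line (K : fieldType) (g : nat) (v : 'rV[K]_g.+4)
    (e : 'rV[K]_2) (c : K) : Prop :=
  forall i : 'I_g.+2,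
    coord v i = c * (coord e 0 ^+ (g.+1 - i) * coord e 1 ^+ i).

Definition surfaceT (R : realType) (g : nat) (q : {mpoly R[i][g.+2]}) :
    variety R[i] :=
  proj [set v : 'rV[R[i]]_g.+4 |
    (exists e c, over_line v e c) /\
    coord v g.+3 ^+ 2 =
      q.@[fun i : 'I_g.+2 => coord v i] - coord v g.+2 ^+ 2].

(* e is the image of v under the rational map from T to the rational normal  *)
(* curve, which is defined where X != 0                                      *)
Definition conicT (K : fieldType) (g : nat) (v : 'rV[K]_g.+4)
    (e : 'rV[K]_2) : Prop :=
  (exists i : 'I_g.+2, coord v i != 0) /\ exists c, over_line v e c.

Definition fibreT (R : realType) (g : nat) (q : {mpoly R[i][g.+2]})
    (e : 'rV[R[i]]_2) : set (coords (surfaceT q)) :=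
  zclosure [set v : coords (surfaceT q) | pts v /\ conicT v e].

Definition smooth_curve (K : fieldType) (V : variety K) (A : set (coords V)) :
    Prop :=
  forall p : coords (restrict A), pts p -> nonsingular_at 1 p.

Definition regular_minitwistor (R : realType) (g : nat)
    (q : {mpoly R[i][g.+2]}) (c : 'rV[R[i]]_g.+4) : Prop :=
  let node (p : coords (surfaceT q)) := pts p /\
    exists2 c0 : 'rV[R[i]]_g.+4, linear_form c0 p != 0 &
      node_at p (fun v : coords (surfaceT q) =>
                   linear_form c v / linear_form c0 v) in
  [/\ irreducible (@hyperplane_section _ (surfaceT q) c),
      rational_curve (@hyperplane_section _ (surfaceT q) c),
      exists s : 'I_g -> coords (surfaceT q),
        [/\ forall i, node (s i),
            forall i j, same (s i) (s j) -> i = j &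
            forall p, node p -> exists i, same (s i) p] &
      forall p : coords (surfaceT q), pts p -> ~ nonsingular_at 2 p ->
        linear_form c p != 0].

Definition irregular_minitwistor (R : realType) (g : nat)
    (q : {mpoly R[i][g.+2]}) (c : 'rV[R[i]]_g.+4) : Prop :=
  exists (d : 'I_g -> coords (P1 R[i])) (e : coords (P1 R[i])),
    [/\ (forall i, pts (d i)) /\ (forall i j, same (d i) (d j) -> i = j),
        pts e,
        forall i, ~ irreducible (@fibreT R g q (d i)),
        irreducible (@fibreT R g q e) /\ smooth_curve (@fibreT R g q e) &
        @hyperplane_section _ (surfaceT q) c =
          [set p | (exists i, @fibreT R g q (d i) p) \/ @fibreT R g q e p]].

Definition minitwistor_hyperplane (R : realType) (g : nat)
    (q : {mpoly R[i][g.+2]}) (c : 'rV[R[i]]_g.+4) : Prop :=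
  c != 0 /\ (regular_minitwistor q c \/ irregular_minitwistor q c).

(* f is the composite of an isomorphism from S to the minimal resolution of  *)
(* T with the resolution map.  The real structure on the resolution is the   *)
(* lift of that of T, so it is enough to compare real structures in T.       *)

Definition real_compatible (R : realType) (l : nat) (a : 'I_(2 * l) -> R)
    (g : nat) (q : {mpoly R[i][g.+2]})
    (f : coords (surfaceS a) -> coords (surfaceT q)) : Prop :=
  forall p : coords (surfaceS a), pts p ->
    @same _ (surfaceT q) (f (tau l p)) (conj_row (f p)).

(* f covers an automorphism of the projective line *)
Definition conic_compatible (R : realType) (l : nat) (a : 'I_(2 * l) -> R)
    (g : nat) (q : {mpoly R[i][g.+2]})
    (f : coords (surfaceS a) -> coords (surfaceT q)) : Prop :=
  exists2 m : coords (P1 R[i]) -> coords (P1 R[i]), isomorphism m &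
    forall (p : coords (surfaceS a)) (e : coords (P1 R[i])),
      pts p -> pts e -> conicT (f p) e -> @same _ (P1 R[i]) (m (conicS p)) e.

(* Main.v *)
Require Import Defs.
From mathcomp Require Import all_boot all_order all_algebra.
From mathcomp Require Import boolp classical_sets reals complex mpoly.
From mathcomp Require Import ring zify.

(** On [S], consider the hyperplane bundle of the CP2-bundle
    P(O(l) + O(l) + O) over the projective line. Its sections are the
    polynomials in [z0, z1; x, y, t] that have weight [l] for the rescaling of
    the base and weight 1 for that of the fibre ([section_form]); for example
    [x], [y] and [t] times a form of degree [l] in [z0, z1]. The quotient of
    two nonzero sections is a rational function, so their zero divisors are
    linearly equivalent ([section_divisors_equivalent]). The theorem holds
    because the minitwistor lines of both kinds are zero divisors of sections
    of this one bundle.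

    For a minitwistor line in [S] ([section_divisor_line]), let
    [u -> (x(u), y(u), z(u))] be a twistor line with
    [z = A u^2 + b u - A^*], where [A != 0]. The function [z / u], which is
    the base coordinate on [S], is invariant under the involution
    [u -> ka / u] with [ka = - A^* / A]. By reality, the roots of [y] are
    obtained from those of [x] by [g -> - 1 / g^*], and since [A g] is real
    at the roots of [x], this map agrees there with the involution. The
    involution therefore exchanges [x / u^l] and [y / u^l] up to constants
    ([twistor_equation]), and for a suitable constant [k] the sum
    [x + k y] is invariant, that is, a polynomial [p] of degree at most [l]
    in [z / u]. So the curve lies on the zero locus of the section
    [x + k y - t p(z)]. This section generates the ideal of the curve: once
    [x] has been eliminated, the equation of [S] is a monic quadratic
    polynomial in [y], whose two roots over a base point are the values of
    [y / u^l] at the two points of the twistor line that lie over it, and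
    division by this quadratic leaves no remainder for a polynomial that
    vanishes on the curve ([slice_division], [line_generates]).

    For a hyperplane section of [T], the composite [f] of the isomorphism
    with the resolution is determined almost completely
    ([morphism_classification]). With [xi = Y + i W] and [eta = Y - i W], the
    equation of [T] becomes [xi eta = c^2 h(z)], where [c] is the scale of the
    point of the cone over the rational normal curve, while [S] is
    [x y = t^2 F(z)] with [F = prod (z - a_i)]. The map [f] covers an
    automorphism of the projective line, and it is bijective over the smooth
    locus of [T]. In the fibre coordinate [s = t / x] of [S] and the
    coordinate [xi / c] of [T], it is a Moebius map on the general fibre,
    because an injective rational function of one variable has degree one.
    Its matrix can be taken with polynomial entries in [z] without common
    zeros ([moebius_form]). Bijectivity makes this matrix invertible over the
    smooth fibres of [S], and over the reducible fibres, at [z = a_i], it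
    prescribes the vanishing of some entries ([smooth_fibre],
    [reducible_fibre]); at infinity, where the fibre is smooth, it bounds the
    degrees of the entries ([matrix_at_infinity]). Counting zeros against
    degrees, only diagonal matrices with constant entries and antidiagonal
    matrices with entries [c F(z)] and [d] remain ([monomial_matrix]). Hence
    [f] maps [(z0, z1; x, y, t)] to the point with [c = c1 t] and
    [(xi, eta) = (c2 x, c3 y)] or [(c2 y, c3 x)], over the image of
    [z0 : z1]. The homogeneous coordinates of [T] thus pull back to sections
    of the hyperplane bundle of [S], and so does every linear form
    ([section_divisor_pullback]). *)

Set Implicit Arguments.
Unset Strict Implicit.
Unset Printing Implicit Defensive.
Import Order.TTheory GRing.Theory Num.Theory.
Local Open Scope ring_scope.
Local Notation coord := Defs.coord.

(** * Polynomial functions and local rings *)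

Section RegularFunctions.

Variable K : fieldType.

(** Induction over the operations that build polynomials; the closure
    properties of polynomial functions, of regular functions and of
    polynomials in two variables under composition are instances. *)
Lemma mpoly_closure n (X : Type) (P : (X -> K) -> Prop) (r : 'I_n -> X -> K) :
    (forall f g, f =1 g -> P f -> P g) -> (forall c, P (fun=> c)) ->
    (forall f g, P f -> P g -> P (fun x => f x + g x)) ->
    (forall f g, P f -> P g -> P (fun x => f x * g x)) ->
    (forall j, P (r j)) ->
  forall G : {mpoly K[n]}, P (fun x => G.@[fun j => r j x]).
Proof.
move=> Pext Pc PD PM Pr; elim/mpolyind => [|c m p _ _ IHp].
  by apply: Pext (Pc 0) => x; rewrite meval0.
apply: (Pext (fun x => c * \prod_i r i x ^+ m i + p.@[fun j => r j x])).
  by move=> x; rewrite mevalD mevalZ mevalX.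
apply: (PD _ _ _ IHp); apply: (PM) => //.
have PX f e : P f -> P (fun x => f x ^+ e).
  move=> Pf; elim: e => [|e IHe]; first exact: Pext (Pc 1).
  by apply: Pext (PM _ _ Pf IHe) => x; rewrite exprS.
elim: (index_enum _) => [|i s IHs].
  by apply: Pext (Pc 1) => x; rewrite big_nil.
by apply: Pext (PM _ _ (PX _ (m i) (Pr i)) IHs) => x; rewrite big_cons.
Qed.

Definition polyfun n (f : 'rV[K]_n -> K) : Prop :=
  exists G : {mpoly K[n]}, forall q, f q = G.@[q 0].

Lemma polyfun_ext n (f g : 'rV[K]_n -> K) : f =1 g -> polyfun f -> polyfun g.
Proof. by move=> fg [G fG]; exists G => q; rewrite -fg. Qed.

Lemma polyfun_meval n (G : {mpoly K[n]}) : polyfun (fun q => G.@[q 0]).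
Proof. by exists G. Qed.

Lemma polyfun_const n c : polyfun (fun _ : 'rV[K]_n => c).
Proof. by exists c%:MP => q; rewrite mevalC. Qed.

Lemma polyfun_coord n j : polyfun (fun q : 'rV[K]_n => q 0 j).
Proof. by exists 'X_j => q; rewrite mevalXU. Qed.

Lemma polyfunD n (f g : 'rV[K]_n -> K) :
  polyfun f -> polyfun g -> polyfun (fun q => f q + g q).
Proof. by move=> [F fF] [G gG]; exists (F + G) => q; rewrite mevalD fF gG. Qed.

Lemma polyfunM n (f g : 'rV[K]_n -> K) :
  polyfun f -> polyfun g -> polyfun (fun q => f q * g q).
Proof. by move=> [F fF] [G gG]; exists (F * G) => q; rewrite mevalM fF gG. Qed.

Lemma polyfunB n (f g : 'rV[K]_n -> K) :
  polyfun f -> polyfun g -> polyfun (fun q => f q - g q).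
Proof. by move=> [F fF] [G gG]; exists (F - G) => q; rewrite mevalB fF gG. Qed.

Lemma polyfunX n (f : 'rV[K]_n -> K) e :
  polyfun f -> polyfun (fun q => f q ^+ e).
Proof.
move=> fP; elim: e => [|e IHe]; first exact: polyfun_const.
by apply: polyfun_ext (polyfunM fP IHe) => q; rewrite exprS.
Qed.

Lemma polyfun_sum n (I : Type) (s : seq I) (f : I -> 'rV[K]_n -> K) :
  (forall i, polyfun (f i)) -> polyfun (fun q => \sum_(i <- s) f i q).
Proof.
move=> fP; elim: s => [|i s IHs].
  by apply: polyfun_ext (polyfun_const n 0) => q; rewrite big_nil.
by apply: polyfun_ext (polyfunD (fP i) IHs) => q; rewrite big_cons.
Qed.

Section Variety.
Variable V : variety K.
Implicit Types (p q : coords V) (f g h : coords V -> K).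

Lemma locallyI p (Q Q' : coords V -> Prop) :
  locally p Q -> locally p Q' -> locally p (fun q => Q q /\ Q' q).
Proof.
move=> [H Hp HQ] [H' H'p HQ']; exists (H * H'); first by rewrite mevalM mulf_neq0.
move=> q Vq; rewrite mevalM mulf_eq0 negb_or => /andP[Hq H'q].
by split; [apply: HQ | apply: HQ'].
Qed.

Lemma locallyS p (Q Q' : coords V -> Prop) :
  (forall q, pts q -> Q q -> Q' q) -> locally p Q -> locally p Q'.
Proof. by move=> QQ' [H Hp HQ]; exists H => // q Vq /(HQ q Vq)/(QQ' q Vq). Qed.

Lemma locallyT p (Q : coords V -> Prop) :
  (forall q, pts q -> Q q) -> locally p Q.
Proof. by move=> QT; exists 1 => [|q Vq _]; [rewrite meval1 oner_neq0|exact: QT]. Qed.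

Lemma locally_neq0 p f : polyfun f -> f p != 0 -> locally p (fun q => f q != 0).
Proof. by move=> [F fF] fp0; exists F => [|q _]; rewrite -fF. Qed.

Lemma locally_pt p (Q : coords V -> Prop) : pts p -> locally p Q -> Q p.
Proof. by move=> Vp [H Hp]; apply. Qed.

Lemma regular_atE p h : regular_at p h <->
  (forall q q', pts q -> pts q' -> same q q' -> h q = h q') /\
  exists f g, [/\ polyfun f, polyfun g, g p != 0 &
    locally p (fun q => g q != 0 /\ h q = f q / g q)].
Proof.
split=> [[hs [G [H [Hp hE]]]]|[hs [f [g [[F fF] [G gG] gp0 [H Hp hE]]]]]]; split=> //.
  exists (fun q => G.@[q 0]), (fun q => H.@[q 0]); split=> //; try exact: polyfun_meval.
  by exists H => // q Vq Hq; split=> //; apply: hE.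
exists (F * H), (G * H); rewrite mevalM mulf_neq0 -?gG //; split=> // q Vq.
rewrite !mevalM mulf_eq0 negb_or => /andP[Gq Hq].
by have [_ ->] := hE q Vq Hq; rewrite -mulf_div divff // mulr1 fF gG.
Qed.

Lemma regular_const p c : regular_at p (fun=> c).
Proof.
apply/regular_atE; split=> //; exists (fun=> c), (fun=> 1).
split; rewrite ?oner_neq0 //; try exact: polyfun_const.
by apply: locallyT => q _; rewrite divr1.
Qed.

Lemma regularD p f g :
  regular_at p f -> regular_at p g -> regular_at p (fun q => f q + g q).
Proof.
move=> /regular_atE[fs [a [b [aP bP bp0 fE]]]] /regular_atE[gs [c [d [cP dP dp0 gE]]]].
apply/regular_atE; split=> [q q' Vq Vq' qq'|]; first by rewrite (fs q q') ?(gs q q').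
exists (fun q => a q * d q + c q * b q), (fun q => b q * d q).
split; [by apply: polyfunD; exact: polyfunM|exact: polyfunM|by rewrite mulf_neq0|].
apply: locallyS (locallyI fE gE) => q _ [[bq ->] [dq ->]].
by rewrite mulf_neq0 // addf_div.
Qed.

Lemma regularM p f g :
  regular_at p f -> regular_at p g -> regular_at p (fun q => f q * g q).
Proof.
move=> /regular_atE[fs [a [b [aP bP bp0 fE]]]] /regular_atE[gs [c [d [cP dP dp0 gE]]]].
apply/regular_atE; split=> [q q' Vq Vq' qq'|]; first by rewrite (fs q q') ?(gs q q').
exists (fun q => a q * c q), (fun q => b q * d q).
split; [exact: polyfunM|exact: polyfunM|by rewrite mulf_neq0|].
apply: locallyS (locallyI fE gE) => q _ [[bq ->] [dq ->]].
by rewrite mulf_neq0 // mulf_div.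
Qed.

Lemma regular_locally_neq0 p f : pts p ->
  regular_at p f -> f p != 0 -> locally p (fun q => f q != 0).
Proof.
move=> Vp /regular_atE[_ [a [b [aP bP bp0 fE]]]] fp0.
have ap0 : a p != 0.
  by have [_ fpE] := locally_pt Vp fE; move: fp0; rewrite fpE; apply: contra_neq => ->; rewrite mul0r.
apply: locallyS (locallyI (locally_neq0 aP ap0) fE) => q _ [aq [bq ->]].
by rewrite mulf_neq0 // invr_neq0.
Qed.

Lemma regularV p f : pts p ->
  regular_at p f -> f p != 0 -> regular_at p (fun q => (f q)^-1).
Proof.
move=> Vp /regular_atE[fs [a [b [aP bP bp0 fE]]]] fp0.
have ap0 : a p != 0.
  by have [_ fpE] := locally_pt Vp fE; move: fp0; rewrite fpE; apply: contra_neq => ->; rewrite mul0r.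
apply/regular_atE; split=> [q q' Vq Vq' qq'|]; first by rewrite (fs q q').
exists b, a; split=> //.
by apply: locallyS (locallyI (locally_neq0 aP ap0) fE) => q _ [aq [bq ->]]; rewrite invf_div.
Qed.

Lemma regular_ext p f g : f =1 g -> regular_at p f -> regular_at p g.
Proof. by move=> /funext ->. Qed.

Lemma regularN p f : regular_at p f -> regular_at p (fun q => - f q).
Proof.
move=> fr; apply: regular_ext (regularM (regular_const p (-1)) fr) => q.
by rewrite mulN1r.
Qed.

Lemma regularB p f g :
  regular_at p f -> regular_at p g -> regular_at p (fun q => f q - g q).
Proof. by move=> fr gr; apply: regularD => //; apply: regularN. Qed.

Lemma regularX p f e : regular_at p f -> regular_at p (fun q => f q ^+ e).
Proof.
move=> fr; elim: e => [|e IHe]; first exact: regular_const.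
by apply: regular_ext (regularM fr IHe) => q; rewrite exprS.
Qed.

Lemma regular_sum p (I : Type) (s : seq I) (f : I -> coords V -> K) :
  (forall i, regular_at p (f i)) -> regular_at p (fun q => \sum_(i <- s) f i q).
Proof.
move=> fr; elim: s => [|i s IHs].
  by apply: regular_ext (regular_const p 0) => q; rewrite big_nil.
by apply: regular_ext (regularD (fr i) IHs) => q; rewrite big_cons.
Qed.

Lemma regular_meval n p (G : {mpoly K[n]}) (r : 'I_n -> coords V -> K) :
  (forall j, regular_at p (r j)) -> regular_at p (fun q => G.@[fun j => r j q]).
Proof.
move=> rr; apply: (mpoly_closure (P := regular_at p)) => //.
- by move=> f g; exact: regular_ext.
- exact: regular_const.
- by move=> f g; exact: regularD.
- by move=> f g; exact: regularM.
Qed.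

Lemma regular_horner p (F : {poly K}) f :
  regular_at p f -> regular_at p (fun q => F.[f q]).
Proof.
move=> fr; elim/poly_ind: F => [|F c IHF].
  by apply: regular_ext (regular_const p 0) => q; rewrite horner0.
apply: regular_ext (regularD (regularM IHF fr) (regular_const p c)) => q.
by rewrite hornerMXaddC.
Qed.

(** The quotient of two polynomials of the same weight takes the same value on
    all representatives of a point. *)
Lemma regular_ratio p f g : polyfun f -> polyfun g -> g p != 0 ->
    (forall q q', pts q -> pts q' -> same q q' ->
       exists2 c : K, c != 0 & f q' = c * f q /\ g q' = c * g q) ->
  regular_at p (fun q => f q / g q).
Proof.
move=> fP gP gp0 fg; apply/regular_atE; split=> [q q' Vq Vq' qq'|].
  by have [c c0 [-> ->]] := fg q q' Vq Vq' qq'; rewrite -mulf_div divff // mul1r.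
by exists f, g; split=> //; apply: locallyS (locally_neq0 gP gp0).
Qed.

Section Ideal.
Variables (d : nat) (p : coords V) (u : 'I_d -> coords V -> K).

Definition in_ideal h : Prop :=
  exists2 k : 'I_d -> coords V -> K, (forall i, regular_at p (k i)) &
    locally p (fun q => h q = \sum_i k i q * u i q).

Lemma in_ideal_local h h' :
  locally p (fun q => h q = h' q) -> in_ideal h -> in_ideal h'.
Proof.
move=> hh' [k kr hE]; exists k => //.
by apply: locallyS (locallyI hh' hE) => q _ [<- ->].
Qed.

Lemma in_ideal_ext h h' : h =1 h' -> in_ideal h -> in_ideal h'.
Proof. by move=> hh'; apply: in_ideal_local; apply: locallyT => q _; apply: hh'. Qed.

Lemma in_ideal0 : in_ideal (fun=> 0).
Proof.
exists (fun _ _ => 0) => [i|]; first exact: regular_const.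
by apply: locallyT => q _; rewrite big1 // => i _; rewrite mul0r.
Qed.

Lemma in_idealD h h' : in_ideal h -> in_ideal h' -> in_ideal (fun q => h q + h' q).
Proof.
move=> [k kr hE] [k' k'r h'E]; exists (fun i q => k i q + k' i q) => [i|].
  exact: regularD.
apply: locallyS (locallyI hE h'E) => q _ [-> ->]; rewrite -big_split.
by apply: eq_bigr => i _; rewrite mulrDl.
Qed.

Lemma in_idealM f h : regular_at p f -> in_ideal h -> in_ideal (fun q => f q * h q).
Proof.
move=> fr [k kr hE]; exists (fun i q => f q * k i q) => [i|]; first exact: regularM.
apply: locallyS hE => q _ ->; rewrite mulr_sumr.
by apply: eq_bigr => i _; rewrite mulrA.
Qed.

Lemma in_ideal_gen i : in_ideal (u i).
Proof.
exists (fun j q => (j == i)%:R) => [j|]; first exact: regular_const.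
apply: locallyT => q _; rewrite (bigD1 i) //= eqxx mul1r big1 ?addr0 // => j /negPf ->.
by rewrite mul0r.
Qed.

(** By induction on the polynomial: for a product, [f g - f' g'] is
    [f (g - g') + g' (f - f')]. *)
Lemma in_ideal_meval n (r r' : 'I_n -> coords V -> K) (G : {mpoly K[n]}) :
    (forall j, regular_at p (r j)) -> (forall j, regular_at p (r' j)) ->
    (forall j, in_ideal (fun q => r j q - r' j q)) ->
  in_ideal (fun q => G.@[fun j => r j q] - G.@[fun j => r' j q]).
Proof.
move=> rr rr' rI.
pose P (f : coords V * bool -> K) := [/\ regular_at p (fun q => f (q, true)),
  regular_at p (fun q => f (q, false)) & in_ideal (fun q => f (q, true) - f (q, false))].
suff [] : P (fun x => G.@[fun j => (if x.2 then r j x.1 else r' j x.1)]) by [].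
apply: (mpoly_closure (P := P)) => //.
- by move=> f g /funext ->.
- move=> c; split; try exact: regular_const.
  by apply: in_ideal_ext in_ideal0 => q; rewrite subrr.
- move=> f g [f1 f2 fI] [g1 g2 gI]; split; try exact: regularD.
  by apply: in_ideal_ext (in_idealD fI gI) => q; rewrite opprD addrACA.
- move=> f g [f1 f2 fI] [g1 g2 gI]; split; try exact: regularM.
  apply: in_ideal_ext (in_idealD (in_idealM f1 gI) (in_idealM g2 fI)) => q.
  by ring.
- by move=> j; split; [exact: rr|exact: rr'|exact: rI].
Qed.

End Ideal.

(** A criterion for local parameters on a variety in homogeneous coordinates,
    where [r] is a normalisation of the representative near [p]. A regular
    function is a quotient of polynomials in the [r j], so its value at a
    nearby point is congruent to its value at [p] modulo the ideal of the
    [u i] as soon as the [r j] are. *)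
Lemma coords_generate_maximal_ideal d p (u : 'I_d -> coords V -> K)
    (r : 'I_(ambient V) -> coords V -> K) :
    pts p -> (forall i, regular_at p (u i) /\ u i p = 0) ->
    (forall j, regular_at p (r j)) -> (forall j, r j p = p 0 j) ->
    locally p (fun q => same q (\row_j r j q) /\ @pts K V (\row_j r j q)) ->
    (forall j, in_ideal p u (fun q => r j q - p 0 j)) ->
  generate_maximal_ideal p u.
Proof.
move=> Vp ur rr rp rs rI; split=> // h [hs [G [H [Hp hE]]]] hp0.
have Gp0 : G.@[p 0] = 0.
  have := hE p Vp Hp; rewrite hp0 => /esym/eqP.
  by rewrite mulf_eq0 invr_eq0 (negPf Hp) orbF => /eqP.
have Hr : regular_at p (fun q => H.@[fun j => r j q]) by exact: regular_meval.
have Hrp : H.@[fun j => r j p] != 0 by rewrite (meval_eq _ rp).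
have I1 := in_idealM (regularV Vp Hr Hrp)
  (in_ideal_meval G rr (fun j => regular_const p (p 0 j)) rI).
apply: in_ideal_local I1.
apply: locallyS (locallyI rs (regular_locally_neq0 Vp Hr Hrp)) => q Vq [[qr Vr] Hq].
have E F : F.@[(\row_j r j q : coords V) 0] = F.@[fun j => r j q].
  by apply: meval_eq => j; rewrite mxE.
rewrite (hs _ _ Vq Vr qr) (hE _ Vr) ?E //.
by rewrite (_ : G.@[fun j => p 0 j] = 0) ?subr0 1?mulrC // -[RHS]Gp0.
Qed.

End Variety.

End RegularFunctions.

(** * Polynomials in two variables and generic points *)

Section GenericPoints.

Variable K : numClosedFieldType.
Implicit Types (P Q : K -> Prop) (p q : {poly K}).

Definition cofin P : Prop := exists s : seq K, forall x, x \notin s -> P x.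

Lemma cofinT P : (forall x, P x) -> cofin P.
Proof. by move=> PT; exists [::] => x _; apply: PT. Qed.

Lemma cofinI P Q : cofin P -> cofin Q -> cofin (fun x => P x /\ Q x).
Proof.
move=> [s sP] [s' sQ]; exists (s ++ s') => x.
by rewrite mem_cat negb_or => /andP[/sP ? /sQ ?].
Qed.

Lemma cofinS P Q : (forall x, P x -> Q x) -> cofin P -> cofin Q.
Proof. by move=> PQ [s sP]; exists s => x /sP/PQ. Qed.

Lemma cofin_all (T : eqType) (s : seq T) (P : T -> K -> Prop) :
  (forall t, t \in s -> cofin (P t)) -> cofin (fun x => forall t, t \in s -> P t x).
Proof.
elim: s => [|t s IHs] sP; first by apply: cofinT.
have sP' t' : t' \in s -> cofin (P t') by move=> t's; apply: sP; rewrite inE t's orbT.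
have := cofinI (sP t (mem_head t s)) (IHs sP').
by apply: cofinS => x [Ptx Psx] t'; rewrite inE => /predU1P[->|/Psx].
Qed.

Lemma cofin_neq c : cofin (fun x => x <> c).
Proof. by exists [:: c] => x; rewrite inE => /eqP. Qed.

Lemma cofin_horner_neq0 p : p != 0 -> cofin (fun x => p.[x] != 0).
Proof.
have [r ->] := closed_field_poly_normal p => p0; exists r => x xr.
have lc0 : lead_coef p != 0.
  by apply: contra_neq p0 => ->; rewrite scale0r.
by rewrite hornerZ mulf_neq0 // -rootE root_prod_XsubC.
Qed.

Lemma lin_neq0 (u v : K) : (u != 0) || (v != 0) -> u%:P + v *: 'X != 0.
Proof.
move=> uv; apply: contraTneq uv => p0; rewrite negb_or !negbK.
have := congr1 (fun p : {poly K} => p`_0) p0; have := congr1 (fun p : {poly K} => p`_1) p0.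
by rewrite !coefD !coefZ !coefC !coefX /= mulr0 mulr1 add0r addr0 => -> ->; rewrite eqxx.
Qed.

Lemma cofin_lin (u v : K) : (u != 0) || (v != 0) -> cofin (fun s => u + v * s != 0).
Proof.
move=> /lin_neq0/cofin_horner_neq0; apply: cofinS => s.
by rewrite !(hornerD, hornerZ, hornerX, hornerC).
Qed.

Lemma root_factor p c : p.[c] = 0 -> exists r, p = ('X - c%:P) * r.
Proof. by move=> /eqP/factor_theorem[r ->]; exists r; rewrite mulrC. Qed.

Lemma cofin_ex P : cofin P -> exists x, P x.
Proof.
move=> [s sP]; pose p := \prod_(c <- s) ('X - c%:P) : {poly K}.
have : size (p * 'X + 1) != 1%N.
  by rewrite -polyC1 size_MXaddC oner_eq0 andbF size_prod_XsubC.
move=> /closed_rootP[x]; rewrite rootE !hornerE => xp.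
exists x; apply: sP; apply/negP; rewrite -root_prod_XsubC rootE => /eqP px0.
by move: xp; rewrite px0 mul0r add0r oner_eq0.
Qed.

Lemma cofin_poly0 p : cofin (fun x => p.[x] = 0) -> p = 0.
Proof.
move=> p0; apply/eqP/negPn/negP => /cofin_horner_neq0/(cofinI p0)/cofin_ex[x [->]].
by rewrite eqxx.
Qed.

Lemma cofin_comp (w : K -> K) P :
  (forall c, cofin (fun x => w x <> c)) -> cofin P -> cofin (fun x => P (w x)).
Proof.
move=> wfin [s sP]; apply: cofinS (cofin_all (fun c (_ : c \in s) => wfin c)) => x xs.
by apply: sP; apply/negP => /xs.
Qed.

Lemma cofin_div c P : c != 0 -> cofin P -> cofin (fun x => P (c / x)).
Proof.
move=> c0; apply: cofin_comp => b; apply: cofinS (cofin_neq (c / b)) => x + xb.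
by apply; rewrite -xb invf_div mulrCA divff // mulr1.
Qed.

(** Weaker than validity on a dense open set of the plane, yet enough to
    identify polynomials in two variables. *)
Definition generic (P : K -> K -> Prop) : Prop := cofin (fun z => cofin (P z)).

Lemma genericI (P Q : K -> K -> Prop) :
  generic P -> generic Q -> generic (fun z x => P z x /\ Q z x).
Proof. by move=> gP gQ; apply: cofinS (cofinI gP gQ) => z [Pz Qz]; apply: cofinI. Qed.

Lemma genericS (P Q : K -> K -> Prop) :
  (forall z x, P z x -> Q z x) -> generic P -> generic Q.
Proof. by move=> PQ; apply: cofinS => z; apply: cofinS => x; apply: PQ. Qed.

Lemma generic_ex (P : K -> K -> Prop) : generic P -> exists z x, P z x.
Proof. by move=> /cofin_ex[z /cofin_ex[x]]; exists z, x. Qed.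

Lemma generic1 P : cofin P -> generic (fun z _ => P z).
Proof. by apply: cofinS => z Pz; apply: cofinT. Qed.

Lemma generic2 P : cofin P -> generic (fun _ x => P x).
Proof. by move=> cP; apply: cofinT. Qed.

Definition poly2 (f : K -> K -> K) : Prop :=
  exists F : {poly {poly K}}, forall z x, f z x = F.[x%:P].[z].

Implicit Types f g : K -> K -> K.

Lemma poly2_ext f g : (forall z x, f z x = g z x) -> poly2 f -> poly2 g.
Proof. by move=> fg [F fF]; exists F => z x; rewrite -fg. Qed.

Lemma poly2_const c : poly2 (fun _ _ => c).
Proof. by exists c%:P%:P => z x; rewrite !hornerC. Qed.

Lemma poly2_fst p : poly2 (fun z _ => p.[z]).
Proof. by exists p%:P => z x; rewrite hornerC. Qed.

Lemma poly2_snd : poly2 (fun _ x => x).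
Proof. by exists 'X => z x; rewrite hornerX hornerC. Qed.

Lemma poly2D f g : poly2 f -> poly2 g -> poly2 (fun z x => f z x + g z x).
Proof. by move=> [F fF] [G gG]; exists (F + G) => z x; rewrite !hornerD fF gG. Qed.

Lemma poly2M f g : poly2 f -> poly2 g -> poly2 (fun z x => f z x * g z x).
Proof. by move=> [F fF] [G gG]; exists (F * G) => z x; rewrite !hornerM fF gG. Qed.

Lemma poly2B f g : poly2 f -> poly2 g -> poly2 (fun z x => f z x - g z x).
Proof. by move=> [F fF] [G gG]; exists (F - G) => z x; rewrite !hornerE fF gG. Qed.

Lemma poly2X f e : poly2 f -> poly2 (fun z x => f z x ^+ e).
Proof. by move=> [F fF]; exists (F ^+ e) => z x; rewrite !horner_exp fF. Qed.

Lemma poly2_meval n (G : {mpoly K[n]}) (r : 'I_n -> K -> K -> K) :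
  (forall j, poly2 (r j)) -> poly2 (fun z x => G.@[fun j => r j z x]).
Proof.
move=> rP.
apply: (mpoly_closure (P := fun h : K * K -> K => poly2 (fun z x => h (z, x)))
          (r := fun j x => r j x.1 x.2)) => //.
- by move=> f g fg; apply: poly2_ext => z x.
- by move=> c; apply: poly2_const.
- by move=> f g; apply: poly2D.
- by move=> f g; apply: poly2M.
Qed.

Lemma horner2E (F : {poly {poly K}}) z x :
  F.[x%:P].[z] = (map_poly (horner_eval z) F).[x].
Proof.
have := horner_map (horner_eval z) F x%:P; rewrite /= [horner_eval z x%:P]hornerC.
by rewrite /horner_eval => ->.
Qed.

Lemma poly2_neq0 f z0 x0 : poly2 f -> f z0 x0 != 0 -> generic (fun z x => f z x != 0).
Proof.
move=> [F fF] f0; have lF0 : lead_coef F != 0.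
  by rewrite lead_coef_eq0; apply: contra_neq f0 => F0; rewrite fF F0 !hornerC.
apply: cofinS (cofin_horner_neq0 lF0) => z Fz.
have Fz0 : map_poly (horner_eval z) F != 0.
  apply: contra_neq Fz => /(congr1 (fun G : {poly K} => G`_(size F).-1)).
  by rewrite coef0 coef_map.
by apply: cofinS (cofin_horner_neq0 Fz0) => x; rewrite fF horner2E.
Qed.

Lemma poly2_eq0 f : poly2 f -> generic (fun z x => f z x = 0) -> forall z x, f z x = 0.
Proof.
move=> fP f0 z x; apply/eqP/negPn/negP => /(poly2_neq0 fP)/(genericI f0)/generic_ex.
by move=> [z' [x' [->]]]; rewrite eqxx.
Qed.

(** A morphism to a projective variety and a polynomial expression for it
    agree wherever both make sense, once they agree at general points:
    proportionality is the vanishing of the 2 x 2 minors, which are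
    polynomials. *)
Lemma morphism_extend (V : variety K) n (B : set 'rV[K]_n)
    (f : coords V -> coords (proj B)) (chi : K -> K -> coords V)
    (Phi : K -> K -> 'rV[K]_n) z0 x0 :
    morphism f -> (forall j, poly2 (fun z x => chi z x 0 j)) ->
    (forall j, poly2 (fun z x => Phi z x 0 j)) ->
    generic (fun z x => pts (chi z x) /\ @same _ (proj B) (f (chi z x)) (Phi z x)) ->
    pts (chi z0 x0) -> Phi z0 x0 != 0 ->
  @same _ (proj B) (f (chi z0 x0)) (Phi z0 x0).
Proof.
move=> [fV _ floc] chiP PhiP gen V0 Phi0.
have [G [H H0 GE]] := floc _ V0.
pose g j z x := (G j).@[chi z x 0].
have gP j : poly2 (g j) by exact: poly2_meval.
have HP : poly2 (fun z x => H.@[chi z x 0]) by exact: poly2_meval.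
have minor i j : forall z x, g i z x * Phi z x 0 j - g j z x * Phi z x 0 i = 0.
  apply: poly2_eq0; first by apply: poly2B; apply: poly2M.
  apply: genericS (genericI gen (poly2_neq0 HP H0)) => z x [[Vzx [c c0 ->]] Hzx].
  have [d d0 /rowP gE] := GE _ Vzx Hzx.
  by have := gE i; have := gE j; rewrite !mxE /g => -> ->; ring.
have [d d0 /rowP gE] := GE _ V0 H0.
have [f0 _] := fV _ V0.
have /rV0Pn[i fi0] := f0.
have gi0 : g i z0 x0 != 0 by have := gE i; rewrite !mxE /g => ->; rewrite mulf_neq0.
have PhiE : Phi z0 x0 = (Phi z0 x0 0 i / g i z0 x0 * d) *: f (chi z0 x0).
  apply/rowP => j; have /eqP := minor i j z0 x0; rewrite subr_eq0 => /eqP mE.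
  have := gE j; rewrite !mxE -/(g j z0 x0) -mulrA => <-.
  by apply: (mulfI gi0); rewrite mE; field.
exists (Phi z0 x0 0 i / g i z0 x0 * d) => //.
by apply: contra_neq Phi0 => c0; rewrite PhiE c0 scale0r.
Qed.

Lemma deriv_eq0 p : p^`() = 0 -> (size p <= 1)%N.
Proof.
move=> p'0; apply/leq_sizeP => -[//|j] _.
have /(congr1 (fun r : {poly K} => r`_j)) := p'0; rewrite coef_deriv coef0 => /eqP.
by rewrite mulrn_eq0 => /eqP.
Qed.

Lemma coprimep_scale_eq p q (a b : K) : coprimep p q -> (a != 0) || (b != 0) ->
  a *: q = b *: p -> (size p <= 1)%N /\ (size q <= 1)%N.
Proof.
wlog a0 : p q a b / a != 0 => [IH cpq ab0 abE|cpq _ abE].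
  have [a0|a0] := eqVneq a 0; last exact: (IH p q a b).
  move: ab0; rewrite a0 eqxx /= => b0; rewrite coprimep_sym in cpq.
  by case: (IH q p b a b0 cpq) => //; rewrite b0.
have qE : q = (b / a) *: p by rewrite mulrC -scalerA -abE scalerA mulVf // scale1r.
have /Bezout_eq1_coprimepP[u uE] := cpq.
have : p %| 1 by rewrite -uE qE -scalerAr scalerAl dvdp_addl ?dvdp_mull.
rewrite dvdp1 => /eqP sp; rewrite sp; split=> //.
by rewrite qE (leq_trans (size_scale_leq _ _)) ?sp.
Qed.

(** A rational function of one variable that is injective off a finite set has
    degree at most one: otherwise, for general [c], the fibre through [c] has
    a second point, which can only be [c] itself with multiplicity two, so the
    derivative vanishes identically. *)
Lemma injective_ratio_size p q : coprimep p q ->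
    (exists s : seq K, forall x x', x \notin s -> x' \notin s ->
       p.[x] * q.[x'] = p.[x'] * q.[x] -> x = x') ->
  (size p <= 2)%N /\ (size q <= 2)%N.
Proof.
move=> cpq [s inj]; apply/andP; rewrite -geq_max; apply/negPn/negP; rewrite -ltnNge.
set m := maxn _ _ => m3.
have Nlin (a b : K) : (a != 0) || (b != 0) -> a *: q - b *: p != 0.
  move=> ab0; apply/negP; rewrite subr_eq0 => /eqP/(coprimep_scale_eq cpq ab0)[sp sq].
  by move: m3; rewrite /m ltnNge geq_max (leq_trans sp) ?(leq_trans sq).
(* The zeros of [N c] are the points of the fibre through [c]. *)
pose N c := q.[c] *: p - p.[c] *: q.
have top : (p`_m.-1 != 0) || (q`_m.-1 != 0).
  have nz (r : {poly K}) : (2 < size r)%N -> r`_(size r).-1 != 0.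
    move=> sr; rewrite -[_`__]/(lead_coef r) lead_coef_eq0.
    by apply: contraTneq sr => ->; rewrite size_poly0.
  by move: m3; rewrite /m maxnC /maxn; case: ifP => _ /nz->; rewrite ?orbT.
have g1 : cofin (fun c => 2 < size (N c))%N.
  apply: cofinS (cofin_horner_neq0 (Nlin _ _ top)) => c Nc0.
  have m2 : (2 <= m.-1)%N by rewrite -ltnS prednK // (leq_trans _ m3).
  apply: leq_ltn_trans m2 _; rewrite ltnNge; apply: contra_neqN Nc0 => /leq_sizeP/(_ _ (leqnn _)).
  by rewrite coefB !coefZ hornerD hornerN !hornerZ [p.[c] * _]mulrC [q.[c] * _]mulrC.
have g2 : cofin (fun c => c \notin s) by exists s.
have g3 : cofin (fun c => forall b, b \in s -> (N c).[b] != 0).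
  apply: cofin_all => b _; have pq0 : (p.[b] != 0) || (q.[b] != 0).
    rewrite orbC -implyNb negbK; apply/implyP => qb0.
    by apply: (coprimep_root (p := q)); rewrite // coprimep_sym.
  apply: cofinS (cofin_horner_neq0 (Nlin _ _ pq0)) => c.
  by rewrite /N !hornerE [p.[c] * _]mulrC [q.[c] * _]mulrC.
(* The Wronskian, whose value at [c] is the derivative of [N c] at [c]. *)
have W0 : q * p^`() - p * q^`() != 0.
  have W (r r' : {poly K}) : coprimep r r' -> r' * r^`() = r * r'^`() -> (size r <= 1)%N.
    move=> crr' rr'; apply: deriv_eq0; have [->|r0] := eqVneq r 0; first exact: deriv0.
    apply/eqP/negPn/negP => r'0.
    have : r %| r^`() by rewrite -(Gauss_dvdpr _ crr') rr' dvdp_mulr.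
    by move=> /(dvdp_leq r'0); rewrite leqNgt lt_size_deriv.
  apply/negP; rewrite subr_eq0 => /eqP Weq.
  have sp := W _ _ cpq Weq.
  have sq : (size q <= 1)%N by apply: (W q p); rewrite // coprimep_sym.
  by move: m3; rewrite /m ltnNge geq_max (leq_trans sp) ?(leq_trans sq).
have [c [[[N2 cs] Ns] Wc]] :=
  cofin_ex (cofinI (cofinI (cofinI g1 g2) g3) (cofin_horner_neq0 W0)).
have /factor_theorem[M NE] : root (N c) c by rewrite rootE /N !hornerE mulrC subrr.
have M1 : size M != 1%N.
  by apply: contraTneq N2 => M1; rewrite NE size_Mmonic ?monicXsubC ?size_XsubC ?M1 // -size_poly_eq0 M1.
have /closed_rootP[b /rootP Mb] := M1.
have Nb : (N c).[b] = 0 by rewrite NE hornerM Mb mul0r.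
have bs : b \notin s by apply/negP => /Ns; rewrite Nb eqxx.
have bc : b = c.
  by apply: inj => //; apply/eqP; rewrite -subr_eq0 -Nb /N !hornerE mulrC.
move: Wc; rewrite !hornerE => /eqP; apply.
have := congr1 (fun r : {poly K} => r^`().[c]) NE.
by rewrite /N derivM derivB !derivZ derivXsubC !hornerE -bc Mb subrr !mulr0 addr0.
Qed.

End GenericPoints.

(** * The hyperelliptic surface T *)

Section HyperellipticSurface.

Variables (K : numClosedFieldType) (g : nat).

Definition simple_root (h : {poly K}) (z : K) : Prop :=
  h.[z] = 0 -> exists2 k : {poly K}, h = ('X - z%:P) * k & k.[z] != 0.

(** The binary form with value [f(z)], the branch polynomial of the
    hyperelliptic curve, at [(1, z)]. *)
Definition branch_form (J : finType) (r : J -> K) (e0 e1 : K) : K :=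
  - \prod_j (e1 - r j * e0).

Lemma meval_homog n d (c : K) (v : 'I_n -> K) (q : {mpoly K[n]}) :
  q \is d.-homog -> q.@[fun i => c * v i] = c ^+ d * q.@[v].
Proof.
move=> /dhomogP qd; rewrite !mevalE mulr_sumr !big_seq; apply: eq_bigr => m mq.
under eq_bigr do rewrite exprMn.
by rewrite big_split /= prodrXr -mdegE (qd m mq) mulrCA.
Qed.

Lemma poly2_branch_form (J : finType) (r : J -> K) : poly2 (branch_form r).
Proof.
apply: (poly2_ext (f := fun z x => (-1) * \prod_j (x - r j * z))).
  by move=> z x; rewrite mulN1r.
apply: poly2M; first exact: poly2_const.
elim: (index_enum _) => [|i s IHs].
  by apply: poly2_ext (poly2_const 1) => z x; rewrite big_nil.
have lin c : poly2 (fun z x : K => x - c * z).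
  apply: poly2B; first exact: poly2_snd.
  by apply: poly2_ext (poly2_fst (c *: 'X)) => z x; rewrite !hornerE.
by apply: poly2_ext (poly2M (lin _) IHs) => z x; rewrite big_cons.
Qed.

Lemma branch_formZ (J : finType) (r : J -> K) (b e0 e1 : K) :
  branch_form r (b * e0) (b * e1) = b ^+ #|J| * branch_form r e0 e1.
Proof.
rewrite /branch_form mulrN -prodr_const -big_split; congr (- _).
by apply: eq_bigr => j _ /=; rewrite mulrBr mulrCA.
Qed.

Lemma branch_form_fst (J : finType) (r : J -> K) (e0 e1 : K) : e0 != 0 ->
  branch_form r e0 e1 = e0 ^+ #|J| * branch_form r 1 (e1 / e0).
Proof. by move=> e00; rewrite -branch_formZ mulr1 mulrCA divff ?mulr1. Qed.

Lemma branch_form_snd (J : finType) (r : J -> K) (e0 e1 : K) : e1 != 0 ->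
  branch_form r e0 e1 = e1 ^+ #|J| * branch_form r (e0 / e1) 1.
Proof. by move=> e10; rewrite -branch_formZ mulr1 mulrCA divff ?mulr1. Qed.

(** At a zero of one factor the others do not vanish, by the last hypothesis,
    and a linear factor has a simple zero. *)
Lemma simple_root_prod (J : finType) (L : J -> {poly K}) (b : K) : b != 0 ->
    (forall j, L j != 0) -> (forall j, (size (L j) <= 2)%N) ->
    (forall j k z, (L j).[z] = 0 -> (L k).[z] = 0 -> j = k) ->
  forall z, simple_root (b *: \prod_j L j) z.
Proof.
move=> b0 L0 L2 Linj z /eqP; rewrite hornerZ mulf_eq0 (negPf b0) horner_prod.
move=> /prodf_eq0[j _ /eqP Ljz].
have /factor_theorem[M LE] : root (L j) z by rewrite rootE Ljz.
have M0 : M != 0 by apply: contra_neq (L0 j) => M0; rewrite LE M0 mul0r.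
have /eqP/size_poly1P[m m0 ME] : size M = 1%N.
  apply/eqP; rewrite eqn_leq size_poly_gt0 M0 andbT.
  by have := L2 j; rewrite LE size_Mmonic ?monicXsubC // size_XsubC addnC.
exists ((b * m) *: \prod_(k | k != j) L k).
  by rewrite (bigD1 j) //= LE ME -!mul_polyC polyCM; ring.
rewrite hornerZ !mulf_neq0 // horner_prod; apply/prodf_neq0 => k kj.
by apply: contra_neq kj => Lkz; apply: Linj Lkz Ljz.
Qed.

Definition branch_poly (J : finType) (r : J -> K) : {poly K} :=
  (-1) *: \prod_j ('X - (r j)%:P).

Definition branch_poly_inf (J : finType) (r : J -> K) : {poly K} :=
  (-1) *: \prod_j (1 - r j *: 'X).

(** For [e0 = 0] this is a limit of the case [e0 = 1]: both sides are
    polynomials in [e0] and [e1]. *)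
Lemma hyperelliptic_formE (J : finType) (r : J -> K) (q : {mpoly K[g.+2]}) :
    #|J| = g.+1.*2 -> q \is 2.-homog ->
    (forall z, q.@[fun i : 'I_g.+2 => z ^+ i] = - \prod_j (z - r j)) ->
  forall c e0 e1 : K,
  q.@[fun i => c * (e0 ^+ (g.+1 - i) * e1 ^+ i)] = c ^+ 2 * branch_form r e0 e1.
Proof.
move=> cardJ qhom qE c e0 e1; rewrite (meval_homog _ _ qhom); congr (_ * _).
have mono i : poly2 (fun e0 e1 : K => e0 ^+ (g.+1 - i) * e1 ^+ i).
  apply: poly2M; last by apply: poly2X; exact: poly2_snd.
  by apply: poly2X; apply: poly2_ext (poly2_fst 'X) => z x; rewrite hornerX.
apply/eqP; rewrite -subr_eq0; apply/eqP; move: e0 e1; apply: poly2_eq0.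
  by apply: poly2B; [apply: poly2_meval => j; exact: mono|exact: poly2_branch_form].
apply: genericS (generic1 (cofin_neq 0)) => e0 e1 /eqP e00.
apply/eqP; rewrite subr_eq0; apply/eqP.
rewrite (meval_eq (v2 := fun i : 'I_g.+2 => e0 ^+ g.+1 * (e1 / e0) ^+ i)); last first.
  move=> i; rewrite expr_div_n mulrCA mulrC -expfB_cond ?(negPf e00) //.
  exact: (ltn_ord i).
rewrite (meval_homog _ _ qhom) qE branch_form_fst // cardJ -muln2 exprM; congr (_ * _).
by rewrite /branch_form; under [in RHS]eq_bigr do rewrite mulr1.
Qed.

Implicit Types (b c xi eta e : K).

Lemma two_i_neq0 : 2 * 'i != 0 :> K.
Proof. by rewrite mulf_neq0 ?pnatr_eq0 ?neq0Ci. Qed.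

Lemma coordE n (v : 'rV[K]_n.+1) (j : 'I_n.+1) : coord v j = v 0 j.
Proof. by rewrite /coord inord_val. Qed.

(** The factors of [Y^2 + W^2]: in terms of them the equation of [T] is that
    of a family of conics [xi eta = c^2 h]. *)
Definition xiT (v : 'rV[K]_g.+4) : K := coord v g.+3 + 'i * coord v g.+2.
Definition etaT (v : 'rV[K]_g.+4) : K := coord v g.+3 - 'i * coord v g.+2.

(** The point of the cone over the rational normal curve with parameter
    [(e0, e1)] and scale [c], completed by [W] and [Y] as determined by [xi]
    and [eta]. *)
Definition Tpoint (c e0 e1 xi eta : K) : 'rV[K]_g.+4 :=
  \row_j (if (j < g.+2)%N then c * (e0 ^+ (g.+1 - j) * e1 ^+ j)
          else if j == g.+2 :> nat then (xi - eta) / (2 * 'i) else (xi + eta) / 2).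

Lemma coord_Tpoint c e0 e1 xi eta k : (k < g.+2)%N ->
  coord (Tpoint c e0 e1 xi eta) k = c * (e0 ^+ (g.+1 - k) * e1 ^+ k).
Proof.
by move=> kg; rewrite /coord /Tpoint mxE inordK ?kg // (leq_trans kg (leqW (leqnSn _))).
Qed.

Lemma coord_Tpoint_W c e0 e1 xi eta :
  coord (Tpoint c e0 e1 xi eta) g.+2 = (xi - eta) / (2 * 'i).
Proof. by rewrite /coord /Tpoint mxE inordK // ltnn eqxx. Qed.

Lemma coord_Tpoint_Y c e0 e1 xi eta :
  coord (Tpoint c e0 e1 xi eta) g.+3 = (xi + eta) / 2.
Proof. by rewrite /coord /Tpoint mxE inordK // ltnNge leqnSn /= eqn_leq ltnn. Qed.

Lemma xiT_Tpoint c e0 e1 xi eta : xiT (Tpoint c e0 e1 xi eta) = xi.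
Proof.
rewrite /xiT coord_Tpoint_W coord_Tpoint_Y invfM; have i0 : 'i != 0 :> K := neq0Ci _.
by field.
Qed.

Lemma etaT_Tpoint c e0 e1 xi eta : etaT (Tpoint c e0 e1 xi eta) = eta.
Proof.
rewrite /etaT coord_Tpoint_W coord_Tpoint_Y invfM; have i0 : 'i != 0 :> K := neq0Ci _.
by field.
Qed.

Lemma coord_xi_eta (v : 'rV[K]_g.+4) j : v 0 j =
  if (j < g.+2)%N then coord v j else
  if j == g.+2 :> nat then (xiT v - etaT v) / (2 * 'i) else (xiT v + etaT v) / 2.
Proof.
rewrite -coordE; case: ltnP => // gj; have i0 : 'i != 0 :> K := neq0Ci _.
rewrite /xiT /etaT; case: eqP => [->|/eqP jg]; first by field.
have -> : nat_of_ord j = g.+3.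
  by apply/eqP; rewrite eqn_leq -ltnS ltn_ord ltn_neqAle eq_sym jg gj.
by field.
Qed.

Lemma Tpoint_over_line v (e : 'rV[K]_2) c : over_line v e c ->
  v = Tpoint c (coord e 0) (coord e 1) (xiT v) (etaT v).
Proof.
move=> ve; apply/rowP => j; rewrite mxE coord_xi_eta; case: ltnP => // jg.
exact: (ve (Ordinal jg)).
Qed.

Lemma over_line_Tpoint c e0 e1 xi eta (e : 'rV[K]_2) :
  coord e 0 = e0 -> coord e 1 = e1 -> over_line (Tpoint c e0 e1 xi eta) e c.
Proof. by move=> <- <- j; rewrite coord_Tpoint. Qed.

Lemma TpointZ b c e0 e1 xi eta :
  b *: Tpoint c e0 e1 xi eta = Tpoint (b * c) e0 e1 (b * xi) (b * eta).
Proof.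
apply/rowP => j; rewrite !mxE; case: ifP => _; first by rewrite mulrA.
by case: ifP => _; rewrite -?mulrBr -?mulrDr mulrA.
Qed.

Lemma Tpoint_scale b c e0 e1 xi eta :
  Tpoint c (b * e0) (b * e1) xi eta = Tpoint (b ^+ g.+1 * c) e0 e1 xi eta.
Proof.
apply/rowP => j; rewrite !mxE; case: ifP => // jg.
have -> : b ^+ g.+1 = b ^+ (g.+1 - j) * b ^+ j by rewrite -exprD subnK.
by rewrite !exprMn; ring.
Qed.

Lemma Tpoint_neq0 c e0 e1 xi eta : (e0 != 0) || (e1 != 0) ->
  [|| c != 0, xi != 0 | eta != 0] -> Tpoint c e0 e1 xi eta != 0.
Proof.
move=> e_neq0; apply: contraTneq => T0; rewrite -!negb_and !negbK; apply/and3P; split.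
- case/orP: e_neq0 => e0_neq0; apply/eqP.
    have := @coord_Tpoint c e0 e1 xi eta 0 isT; rewrite T0 /coord mxE subn0 expr0 mulr1 => /esym/eqP.
    by rewrite mulf_eq0 expf_eq0 (negPf e0_neq0) andbF orbF => /eqP.
  have := @coord_Tpoint c e0 e1 xi eta g.+1 (leqnn _); rewrite T0 /coord mxE subnn expr0 mul1r => /esym/eqP.
  by rewrite mulf_eq0 expf_eq0 (negPf e0_neq0) andbF orbF => /eqP.
- by rewrite -(xiT_Tpoint c e0 e1 xi eta) T0 /xiT /coord !mxE mulr0 addr0.
- by rewrite -(etaT_Tpoint c e0 e1 xi eta) T0 /etaT /coord !mxE mulr0 subr0.
Qed.

(** [surfaceT] over any algebraically closed field with conjugation; over the
    complex numbers the two are convertible. *)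
Definition hyperelliptic_surface (q : {mpoly K[g.+2]}) : variety K :=
  proj [set v : 'rV[K]_g.+4 |
    (exists (e : 'rV[K]_2) c, over_line v e c) /\
    coord v g.+3 ^+ 2 =
      q.@[fun i : 'I_g.+2 => coord v i] - coord v g.+2 ^+ 2]%classic.

Section Equation.
Variables (J : finType) (r : J -> K) (q : {mpoly K[g.+2]}).
Hypotheses (cardJ : #|J| = g.+1.*2) (qhom : q \is 2.-homog).
Hypothesis qE : forall z, q.@[fun i : 'I_g.+2 => z ^+ i] = - \prod_j (z - r j).
Local Notation h := (branch_form r).
Local Notation T := (hyperelliptic_surface q).

Lemma T_equation (v : 'rV[K]_g.+4) :
  coord v g.+3 ^+ 2 = q.@[fun i : 'I_g.+2 => coord v i] - coord v g.+2 ^+ 2 <->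
  xiT v * etaT v = q.@[fun i : 'I_g.+2 => coord v i].
Proof.
have -> : xiT v * etaT v = coord v g.+3 ^+ 2 + coord v g.+2 ^+ 2.
  by rewrite /xiT /etaT mulrC -subr_sqr exprMn sqrCi mulN1r opprK.
by split=> [->|<-]; ring.
Qed.

Lemma pts_Tpoint c e0 e1 xi eta : (e0 != 0) || (e1 != 0) ->
  [|| c != 0, xi != 0 | eta != 0] -> xi * eta = c ^+ 2 * h e0 e1 ->
  @pts _ T (Tpoint c e0 e1 xi eta).
Proof.
move=> e_neq0 v_neq0 xe; split; first exact: Tpoint_neq0.
split.
  exists (\row_j [:: e0; e1]`_j), c; apply: over_line_Tpoint.
    by rewrite /coord /Tpoint mxE inordK.
  by rewrite /coord /Tpoint mxE inordK.
apply/T_equation; rewrite xiT_Tpoint etaT_Tpoint xe -(hyperelliptic_formE cardJ qhom qE).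
by apply: meval_eq => j; rewrite coord_Tpoint.
Qed.

Lemma pts_T (v : coords T) : pts v -> exists c e0 e1 xi eta,
  [/\ (e0 != 0) || (e1 != 0), [|| c != 0, xi != 0 | eta != 0],
     xi * eta = c ^+ 2 * h e0 e1 & v = Tpoint c e0 e1 xi eta].
Proof.
move=> [v0 [[e [c ve]] /T_equation vT]]; have vE := Tpoint_over_line ve.
have vTh : xiT v * etaT v = c ^+ 2 * h (coord e 0) (coord e 1).
  by rewrite vT -(hyperelliptic_formE cardJ qhom qE); apply: meval_eq => j; exact: ve.
have nz c' e0 e1 : v = Tpoint c' e0 e1 (xiT v) (etaT v) ->
    [|| c' != 0, xiT v != 0 | etaT v != 0].
  move=> vE'; apply: contraNT v0; rewrite !negb_or !negbK => /and3P[/eqP c0 /eqP x0 /eqP y0].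
  rewrite vE' c0 x0 y0; apply/eqP/rowP => j; rewrite !mxE !mul0r subrr addr0 !mul0r.
  by case: ifP => // _; case: ifP.
have [e0|e0] := boolP ((coord e 0 != 0) || (coord e 1 != 0)).
  by exists c, (coord e 0), (coord e 1), (xiT v), (etaT v); split=> //; apply: nz vE.
move: e0; rewrite negb_or !negbK => /andP[/eqP e00 /eqP e10].
have vE0 : v = Tpoint 0 1 0 (xiT v) (etaT v).
  rewrite {1}vE e00 e10; apply/rowP => j; rewrite !mxE; case: ifP => // jg.
  by rewrite mul0r -exprD subnK // expr0n /= mulr0.
exists 0, 1, 0, (xiT v), (etaT v); rewrite oner_neq0; split=> //; first exact: nz vE0.
rewrite vTh e00 e10 -(hyperelliptic_formE cardJ qhom qE) -(hyperelliptic_formE cardJ qhom qE).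
by apply: meval_eq => j; rewrite -exprD subnK -1?ltnS // expr0n mulr0 mul0r.
Qed.

Lemma pts_TZ b (v : coords T) : b != 0 -> pts v -> @pts _ T (b *: v).
Proof.
move=> b0 /pts_T[c [e0 [e1 [xi [eta [e_neq0 v_neq0 xe ->]]]]]]; rewrite TpointZ.
by apply: pts_Tpoint; rewrite ?mulf_eq0 ?(negPf b0) // mulrACA xe; ring.
Qed.

(** Near a point whose coordinate [i0] does not vanish, [T] is the affine
    surface [xi eta = hb(z)], embedded by monomials in [z]; it is smooth
    because the zeros of [hb] are simple. *)
Lemma T_nonsingular_chart (i0 i1 : 'I_g.+4) (n : nat -> nat) (hb : {poly K})
    (p : coords T) :
    (forall v : coords T, pts v -> v 0 i0 != 0 ->
       (forall j, (j < g.+2)%N -> coord v j = v 0 i0 * (v 0 i1 / v 0 i0) ^+ n j) /\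
       xiT v * etaT v = v 0 i0 ^+ 2 * hb.[v 0 i1 / v 0 i0]) ->
    (forall z, simple_root hb z) -> pts p -> p 0 i0 != 0 ->
  nonsingular_at 2 p.
Proof.
move=> chart hb_simple Tp p0.
have ratio (f : coords T -> K) : polyfun f -> (forall (b : K) (v : coords T), f (b *: v) = b * f v) ->
    regular_at p (fun v => f v / v 0 i0).
  move=> fP fZ; apply: regular_ratio => //; first exact: polyfun_coord.
  by move=> v v' _ _ [b b0 ->]; exists b; rewrite ?mxE.
pose z (v : coords T) : K := v 0 i1 / v 0 i0.
pose x (v : coords T) : K := xiT v / v 0 i0; pose y (v : coords T) : K := etaT v / v 0 i0.
have zr : regular_at p z.
  by apply: (ratio (fun v => v 0 i1)) => [|b v]; [exact: polyfun_coord|rewrite mxE].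
have linP a b (j k : 'I_g.+4) : polyfun (fun v : 'rV[K]_g.+4 => a * v 0 j + b * v 0 k).
  by apply: polyfunD; apply: polyfunM; first [exact: polyfun_const|exact: polyfun_coord].
have xr : regular_at p x.
  apply: (ratio (@xiT)) => [|b v]; last by rewrite /xiT /coord !mxE; ring.
  by apply: polyfun_ext (linP 1 'i (inord g.+3) (inord g.+2)) => v; rewrite mul1r.
have yr : regular_at p y.
  apply: (ratio (@etaT)) => [|b v]; last by rewrite /etaT /coord !mxE; ring.
  by apply: polyfun_ext (linP 1 (- 'i) (inord g.+3) (inord g.+2)) => v; rewrite mul1r mulNr.
(* The representative [nr v] of [v] has the same coordinate [i0] as [p]. *)
pose nr (j : 'I_g.+4) (v : coords T) : K := p 0 i0 * (v 0 j / v 0 i0).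
have rr j : regular_at p (nr j).
  apply: regularM; first exact: regular_const.
  by apply: (ratio (fun v => v 0 j)) => [|b v]; [exact: polyfun_coord|rewrite mxE].
have near_p : locally p (fun v : coords T => v 0 i0 != 0).
  by apply: locally_neq0 => //; exact: polyfun_coord.
have xyE (v : coords T) : pts v -> v 0 i0 != 0 -> x v * y v = hb.[z v].
  move=> Tv v0; have [_ xyE] := chart v Tv v0.
  by rewrite /x /y mulf_div xyE -expr2 mulrC mulKf // expf_neq0.
have Ihorner (u : 'I_2 -> coords T -> K) (F : {poly K}) :
    in_ideal p u (fun v => z v - z p) -> in_ideal p u (fun v => F.[z v] - F.[z p]).
  move=> Iz; have /factor_theorem[G FE] : root (F - F.[z p]%:P) (z p).
    by rewrite rootE !hornerE subrr.
  apply: in_ideal_ext (in_idealM (regular_horner G zr) Iz) => v.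
  have := congr1 (fun P : {poly K} => P.[z v]) FE.
  by rewrite hornerD hornerN hornerC hornerM hornerXsubC.
have gen (u : 'I_2 -> coords T -> K) :
    (forall i, regular_at p (u i) /\ u i p = 0) ->
    in_ideal p u (fun v => z v - z p) -> in_ideal p u (fun v => x v - x p) ->
    in_ideal p u (fun v => y v - y p) -> nonsingular_at 2 p.
  move=> ur Iz Ix Iy; exists u; apply: (@coords_generate_maximal_ideal _ T _ p u nr) => //.
  - by move=> j; rewrite /nr mulrC divfK.
  - apply: locallyS near_p => v Tv v0.
    have rE : \row_j nr j v = (p 0 i0 / v 0 i0) *: v.
      by apply/rowP => j; rewrite !mxE /nr mulrA mulrAC.
    have b0 : p 0 i0 / v 0 i0 != 0 by rewrite mulf_neq0 ?invr_neq0.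
    by rewrite rE; split; [exists (p 0 i0 / v 0 i0)|exact: pts_TZ].
  move=> j; case: (ltnP j g.+2) => [jg|gj].
    have I1 := in_idealM (regular_const p (p 0 i0)) (Ihorner u ('X^(n j)) Iz).
    apply: in_ideal_local I1; apply: locallyS near_p => v Tv v0.
    have [vE _] := chart v Tv v0; have [pE _] := chart p Tp p0.
    rewrite /nr -[v 0 j]coordE -[p 0 j]coordE (vE _ jg) (pE _ jg) !hornerXn.
    by rewrite mulrBr [v 0 i0 * _]mulrC mulfK.
  pose s : K := if j == g.+2 :> nat then -1 else 1.
  pose d : K := if j == g.+2 :> nat then 2 * 'i else 2.
  have jE (v : coords T) : v 0 j = (xiT v + s * etaT v) / d.
    rewrite coord_xi_eta ltnNge gj /= /s /d.
    by case: ifP => _; rewrite ?mulN1r ?mul1r.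
  have I1 := in_idealM (regular_const p (p 0 i0 / d))
    (in_idealD Ix (in_idealM (regular_const p s) Iy)).
  apply: in_ideal_local I1; apply: locallyS near_p => v Tv v0.
  rewrite /nr /x /y (jE v) (jE p).
  have d0 : d != 0 by rewrite /d; case: ifP => _; rewrite ?two_i_neq0 ?pnatr_eq0.
  by field; rewrite v0 p0 d0.
pose u2 (a b : coords T -> K) (i : 'I_2) := if i == 0 then a else b.
have u2r (a b : coords T -> K) : regular_at p a -> regular_at p b -> a p = 0 -> b p = 0 ->
    forall i, regular_at p (u2 a b i) /\ u2 a b i p = 0.
  by move=> ar br ap bp i; rewrite /u2; case: ifP.
have u20 (a b : coords T -> K) : in_ideal p (u2 a b) a by exact: (in_ideal_gen p (u2 a b) 0).
have u21 (a b : coords T -> K) : in_ideal p (u2 a b) b by exact: (in_ideal_gen p (u2 a b) 1).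
have sub_r (f : coords T -> K) : regular_at p f -> regular_at p (fun v => f v - f p).
  by move=> fr; apply: regularB => //; exact: regular_const.
have quot (u : 'I_2 -> coords T -> K) (s t : coords T -> K) : regular_at p s ->
    s p != 0 -> (forall v : coords T, pts v -> v 0 i0 != 0 -> s v * t v = hb.[z v]) ->
    in_ideal p u (fun v => z v - z p) -> in_ideal p u (fun v => s v - s p) ->
    in_ideal p u (fun v => t v - t p).
  move=> sr sp0 stE Iz Is.
  have I1 := in_idealM (regularV Tp sr sp0) (in_idealD (Ihorner u hb Iz)
    (in_idealM (regular_const p (- t p)) Is)).
  apply: in_ideal_local I1.
  apply: locallyS (locallyI near_p (regular_locally_neq0 Tp sr sp0)) => v Tv [v0 sv0].
  by rewrite -!stE //; field.
(* Where [x] or [y] does not vanish, it forms a system of local parameters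
   with [z], and the other one is a quotient. At a common zero, [hb] has a
   simple zero, so that [z - z p] is [x y] times a unit, and [x] and [y]
   are local parameters. *)
have [xp0|xp0] := eqVneq (x p) 0; last first.
  apply: (gen (u2 (fun v => z v - z p) (fun v => x v - x p))).
  - by apply: u2r; rewrite ?subrr //; exact: sub_r.
  - exact: u20.
  - exact: u21.
  - exact: (quot _ x).
have [yp0|yp0] := eqVneq (y p) 0; last first.
  apply: (gen (u2 (fun v => z v - z p) (fun v => y v - y p))).
  - by apply: u2r; rewrite ?subrr //; exact: sub_r.
  - exact: u20.
  - by apply: (quot _ y) => // v Tv v0; rewrite mulrC xyE.
  - exact: u21.
have [k hbE kz] : exists2 k : {poly K}, hb = ('X - (z p)%:P) * k & k.[z p] != 0.
  by apply: hb_simple; rewrite -xyE // xp0 mul0r.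
apply: (gen (u2 x y)).
- exact: u2r.
- have kr := regular_horner k zr.
  apply: in_ideal_local (in_idealM (regularM (regularV Tp kr kz) yr) (u20 x y)).
  apply: locallyS (locallyI near_p (regular_locally_neq0 Tp kr kz)) => v Tv [v0 kv0].
  by rewrite -mulrA [y v * _]mulrC xyE // hbE hornerM hornerXsubC; field.
- by apply: in_ideal_ext (u20 x y) => v; rewrite xp0 subr0.
- by apply: in_ideal_ext (u21 x y) => v; rewrite yp0 subr0.
Qed.

(** The charts [e0 != 0] and [e1 != 0] cover the points with [c != 0]; the two
    points with [c = 0], which all the conics pass through, are left out. *)
Lemma T_nonsingular c e0 e1 xi eta : injective r ->
    @pts _ T (Tpoint c e0 e1 xi eta) -> c != 0 -> (e0 != 0) || (e1 != 0) ->
  @nonsingular_at _ T 2 (Tpoint c e0 e1 xi eta).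
Proof.
move=> rinj Tp c0 e_neq0.
have [e00|e00] := eqVneq e0 0; last first.
  apply: (@T_nonsingular_chart ord0 (inord 1) id (branch_poly r)) => //.
  - move=> v /pts_T[b [d0 [d1 [x [y [d_neq0 v_neq0 xy ->]]]]]] v0.
    have v0E : Tpoint b d0 d1 x y 0 ord0 = b * d0 ^+ g.+1.
      by rewrite -coordE coord_Tpoint // subn0 expr0 mulr1.
    have v1E : Tpoint b d0 d1 x y 0 (inord 1) = b * (d0 ^+ g * d1).
      by rewrite -/(coord _ 1) coord_Tpoint // subSS subn0 expr1.
    move: v0; rewrite v0E v1E mulf_eq0 negb_or expf_eq0 /= => /andP[b0 d00].
    have -> : b * (d0 ^+ g * d1) / (b * d0 ^+ g.+1) = d1 / d0.
      by rewrite exprS; field; rewrite b0 d00 expf_neq0.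
    split=> [j jg|].
      rewrite coord_Tpoint // expr_div_n -mulrA; congr (_ * _).
      by rewrite mulrCA mulrC -expfB_cond ?(negPf d00).
    rewrite xiT_Tpoint etaT_Tpoint xy exprMn -exprM muln2 -cardJ -[RHS]mulrA; congr (_ * _).
    rewrite branch_form_fst //; congr (_ * _).
    rewrite /branch_form /branch_poly hornerZ horner_prod mulN1r; congr (- _).
    by apply: eq_bigr => j _; rewrite hornerXsubC mulr1.
  - apply: simple_root_prod => [|j|j|j k z]; rewrite ?oppr_eq0 ?oner_neq0 //.
    + by rewrite polyXsubC_eq0.
    + by rewrite size_XsubC.
    rewrite !hornerXsubC => /eqP; rewrite subr_eq0 => /eqP -> /eqP.
    by rewrite subr_eq0 => /eqP/rinj.
  - by rewrite -coordE coord_Tpoint // subn0 expr0 mulr1 mulf_neq0 ?expf_neq0.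
have e10 : e1 != 0 by move: e_neq0; rewrite e00 eqxx.
apply: (@T_nonsingular_chart (inord g.+1) (inord g) (fun j => g.+1 - j)%N (branch_poly_inf r)) => //.
- move=> v /pts_T[b [d0 [d1 [x [y [d_neq0 v_neq0 xy ->]]]]]] v0.
  have v0E : Tpoint b d0 d1 x y 0 (inord g.+1) = b * d1 ^+ g.+1.
    by rewrite -/(coord _ g.+1) coord_Tpoint // subnn expr0 mul1r.
  have v1E : Tpoint b d0 d1 x y 0 (inord g) = b * (d0 * d1 ^+ g).
    by rewrite -/(coord _ g) coord_Tpoint ?leqnSn // subSnn expr1.
  move: v0; rewrite v0E v1E mulf_eq0 negb_or expf_eq0 /= => /andP[b0 d10].
  have -> : b * (d0 * d1 ^+ g) / (b * d1 ^+ g.+1) = d0 / d1.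
    by rewrite exprS; field; rewrite b0 d10 expf_neq0.
  split=> [j jg|].
    rewrite coord_Tpoint // expr_div_n -mulrA; congr (_ * _).
    rewrite mulrCA; congr (_ * _); rewrite -expfB_cond ?(negPf d10) ?leq_subr //.
    by rewrite subKn.
  rewrite xiT_Tpoint etaT_Tpoint xy exprMn -exprM muln2 -cardJ -[RHS]mulrA; congr (_ * _).
  rewrite branch_form_snd //; congr (_ * _).
  rewrite /branch_form /branch_poly_inf hornerZ horner_prod mulN1r; congr (- _).
  by apply: eq_bigr => j _; rewrite !hornerE.
- apply: simple_root_prod => [|j|j|j k z]; rewrite ?oppr_eq0 ?oner_neq0 //.
  + apply/eqP => /(congr1 (fun P : {poly K} => P.[0])).
    by rewrite !hornerE subr0 => /eqP; rewrite oner_eq0.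
  + rewrite (leq_trans (size_polyD _ _)) // geq_max size_poly1 size_polyN.
    by rewrite (leq_trans (size_scale_leq _ _)) ?size_polyX.
  rewrite !hornerE => /eqP; rewrite subr_eq0 => /eqP j1 /eqP; rewrite subr_eq0 {1}j1 => /eqP jk.
  apply: rinj; have z0 : z != 0.
    by apply: contra_eq_neq j1 => ->; rewrite mulr0 oner_neq0.
  exact: (mulIf z0).
- by rewrite -/(coord _ g.+1) coord_Tpoint // subnn expr0 mul1r mulf_neq0 ?expf_neq0.
Qed.

End Equation.

End HyperellipticSurface.

(** * Resolutions of a projective surface *)

Section Resolution.

Variable K : numClosedFieldType.

Lemma proj_sym n (B : set 'rV[K]_n) (v w : coords (proj B)) : same v w -> same w v.
Proof. by move=> [c c0 ->]; exists c^-1; rewrite ?invr_neq0 // scalerA mulVf // scale1r. Qed.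

Lemma proj_trans n (B : set 'rV[K]_n) (u v w : coords (proj B)) :
  same u v -> same v w -> same u w.
Proof. by move=> [c c0 ->] [d d0 ->]; exists (d * c); rewrite ?mulf_neq0 // scalerA. Qed.

Lemma pts_projective_varietyZ n (B : set 'rV[K]_n) (c : K) (v : coords (proj B)) :
  projective_variety B -> c != 0 -> pts v -> @pts _ (proj B) (c *: v).
Proof.
move=> [[I Ihom BE] _] c0 [v0 Bv]; split; first by rewrite scaler_eq0 negb_or c0.
move: Bv; rewrite BE => Iv F IF; have [d Fd] := Ihom F IF.
rewrite (meval_eq (v2 := fun i => c * v 0 i)) => [|i]; last by rewrite mxE.
by rewrite (meval_homog _ _ Fd) Iv // mulr0.
Qed.

Section Composite.
Variables (V : variety K) (n : nat) (B : set 'rV[K]_n) (m : nat) (C : set 'rV[K]_m).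
Local Notation W := (proj C).
Variables (mu : coords (proj B) -> coords W) (phi : coords V -> coords (proj B)).

(** The polynomials that represent [mu] near [phi p] may be composed with
    those that represent [phi] near [p], because [mu] is unaffected by the
    scale of its argument. *)
Lemma morphism_comp : projective_variety B -> morphism mu -> morphism phi ->
  morphism (fun p => mu (phi p)).
Proof.
move=> Bproj [muV mus muloc] [phiV phis philoc]; split=> [p Vp|p q Vp Vq pq|p Vp].
- by apply: muV; apply: phiV.
- by apply: mus; [apply: phiV|apply: phiV|apply: phis].
have [P Ploc] := philoc p Vp; have [c c0 /rowP pE] := locally_pt Vp Ploc.
have [G [H H0 GE]] := muloc _ (phiV p Vp).
(* The polynomial representative of [phi p] is [c] times [phi p]; the
   neighbourhood of [phi p] on which [mu] is polynomial is not invariant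
   under this rescaling. *)
pose lq := [tuple (c^-1 *: P j) | j < n].
have lqE (v : coords V) : (fun j => (tnth lq j).@[v 0]) =1
    (c^-1 *: (\row_j (P j).@[v 0]) : 'rV_n) 0.
  by move=> j; rewrite tnth_mktuple mevalZ !mxE.
exists (fun k => G k \mPo lq).
have Hp : (H \mPo lq).@[p 0] != 0.
  rewrite comp_mpoly_meval (meval_eq _ (lqE p)) (_ : c^-1 *: _ = phi p) //.
  by apply/rowP => j; have := pE j; rewrite !mxE => ->; rewrite mulKf.
apply: locallyS (locallyI Ploc (locally_neq0 (polyfun_meval _) Hp)).
move=> q Vq [[d d0 qE]]; rewrite comp_mpoly_meval (meval_eq _ (lqE q)) qE scalerA => Hq.
have cd0 : c^-1 * d != 0 by rewrite mulf_neq0 ?invr_neq0.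
have Bq := pts_projective_varietyZ Bproj cd0 (phiV q Vq).
apply: (@proj_trans _ C _ (mu ((c^-1 * d) *: phi q))).
  by apply: mus => //; [exact: phiV|exists (c^-1 * d)].
have := GE _ Bq Hq; congr (same _ _); apply/rowP => k; rewrite !mxE comp_mpoly_meval.
by rewrite (meval_eq _ (lqE q)) qE scalerA.
Qed.

(** Over the smooth locus a resolution is an isomorphism. *)
Lemma resolution_onto : resolution mu -> isomorphism phi ->
  forall w, pts w -> nonsingular_at 2 w ->
  exists2 p : coords V, pts p & @same _ W (mu (phi p)) w.
Proof.
move=> [Bproj _ [muV mus _] [_ [nu [[nuV _ _] _ munu]]]].
move=> [[phiV _ _] [psi [[psiV _ _] _ phipsi]]] w Ww wns.
have [Bb bns] := nuV w (conj Ww wns).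
exists (psi (nu w)); first exact: psiV.
apply: (@proj_trans _ C _ (mu (nu w))); last exact: munu.
by apply: mus => //; [exact/phiV/psiV|exact: phipsi].
Qed.

Lemma resolution_injective :
    (forall p q : coords V, same p q -> same q p) ->
    (forall p q r : coords V, same p q -> same q r -> same p r) ->
    resolution mu -> isomorphism phi ->
  forall p q : coords V, pts p -> pts q ->
    nonsingular_at 2 (mu (phi p)) -> nonsingular_at 2 (mu (phi q)) ->
    @same _ W (mu (phi p)) (mu (phi q)) -> same p q.
Proof.
move=> Vsym Vtrans [Bproj _ [muV _ _] [_ [nu [[_ nus _] numu _]]]].
move=> [[phiV _ _] [psi [[_ psis _] psiphi _]]] p q Vp Vq pns qns pq.
have phipq : same (phi p) (phi q).
  have Bp := phiV p Vp; have Bq := phiV q Vq.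
  apply: (@proj_trans _ B _ (nu (mu (phi p)))).
    by apply: proj_sym; apply: numu.
  apply: (@proj_trans _ B _ (nu (mu (phi q)))); last exact: numu.
  by apply: nus => //; split=> //; exact: muV.
apply: (Vtrans _ (psi (phi p))); first by apply: Vsym; exact: psiphi.
apply: (Vtrans _ (psi (phi q))); last exact: psiphi.
by apply: psis => //; exact: phiV.
Qed.

End Composite.
End Resolution.

(** * Automorphisms of the projective line *)

Section Moebius.

Variable K : numClosedFieldType.
Implicit Types (x y z w : K).

Definition pt2 x y : 'rV[K]_2 := \row_j [:: x; y]`_j.

Lemma coord_pt2 x y : (coord (pt2 x y) 0 = x) * (coord (pt2 x y) 1 = y).
Proof. by rewrite /coord /pt2 !mxE !inordK. Qed.

Lemma pt2_coord (e : 'rV[K]_2) : e = pt2 (coord e 0) (coord e 1).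
Proof.
apply/rowP => j; rewrite mxE -[in LHS](inord_val j).
by case: j => -[|[|]].
Qed.

Lemma pt2Z b x y : b *: pt2 x y = pt2 (b * x) (b * y).
Proof. by apply/rowP => j; rewrite !mxE; case: j => -[|[|]]. Qed.

Lemma pt2_inj x y x' y' : pt2 x y = pt2 x' y' -> x = x' /\ y = y'.
Proof.
move=> e; have := congr1 (fun v => coord v 0) e; have := congr1 (fun v => coord v 1) e.
by rewrite !coord_pt2.
Qed.

Lemma pt2_neq0 x y : (pt2 x y != 0) = (x != 0) || (y != 0).
Proof.
rewrite -negb_and; congr (~~ _); apply/eqP/andP => [e|[/eqP-> /eqP->]].
  have := congr1 (fun v => coord v 0) e; have := congr1 (fun v => coord v 1) e.
  by rewrite !coord_pt2 /coord !mxE => -> ->.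
by apply/rowP => j; rewrite !mxE; case: j => -[|[|]].
Qed.

Lemma pt2_same x y x' y' : (x != 0) || (y != 0) -> (x' != 0) || (y' != 0) ->
  x * y' = x' * y -> @same _ (P1 K) (pt2 x y) (pt2 x' y').
Proof.
move=> nz nz' xy; case/orP: nz => [x0|y0].
  exists (x' / x); last by rewrite pt2Z divfK // mulrAC -xy mulrAC divff // mul1r.
  rewrite mulf_neq0 ?invr_neq0 //; apply: contraTneq nz' => x'0.
  by move/eqP: xy; rewrite x'0 mul0r mulf_eq0 (negPf x0) eqxx /= => ->.
exists (y' / y); last by rewrite pt2Z divfK // mulrAC [y' * x]mulrC xy mulfK.
rewrite mulf_neq0 ?invr_neq0 //; apply: contraTneq nz' => y'0.
by move/esym/eqP: xy; rewrite y'0 mulr0 mulf_eq0 (negPf y0) orbF eqxx orbF negbK.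
Qed.

Lemma same_pt2 x y x' y' : @same _ (P1 K) (pt2 x y) (pt2 x' y') -> x * y' = x' * y.
Proof. by move=> [c _]; rewrite pt2Z => /pt2_inj[-> ->]; ring. Qed.

Lemma poly2_pt2 (u v : K -> K -> K) : poly2 u -> poly2 v ->
  forall j, poly2 (fun z x => pt2 (u z x) (v z x) 0 j).
Proof.
move=> uP vP; case=> -[|[|//]] jlt.
  by apply: poly2_ext uP => z x; rewrite mxE.
by apply: poly2_ext vP => z x; rewrite mxE.
Qed.

(** In the affine coordinate, an automorphism is a rational function that is
    injective off finitely many points, so it has degree one; the linear
    expression then holds everywhere by continuation. *)
Lemma automorphism_P1 (m : coords (P1 K) -> coords (P1 K)) : isomorphism m ->
  exists A B C D : K, A * D - B * C != 0 /\
    forall x y, (x != 0) || (y != 0) ->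
      @same _ (P1 K) (m (pt2 x y)) (pt2 (A * x + B * y) (C * x + D * y)).
Proof.
move=> [mmor [m' [[_ m's _] m'm _]]]; have [mV ms mloc] := mmor.
have V2 x y : (x != 0) || (y != 0) -> @pts _ (P1 K) (pt2 x y).
  by move=> xy; split=> //; rewrite pt2_neq0.
have minj x y x' y' : (x != 0) || (y != 0) -> (x' != 0) || (y' != 0) ->
    @same _ (P1 K) (m (pt2 x y)) (m (pt2 x' y')) -> x * y' = x' * y.
  move=> nz nz' mm; apply: same_pt2.
  apply: (@proj_trans _ _ _ _ (m' (m (pt2 x y)))); first by apply: proj_sym; exact/m'm/V2.
  apply: (@proj_trans _ _ _ _ (m' (m (pt2 x' y')))); last exact/m'm/V2.
  by apply: m's => //; exact/mV/V2.
have one z : (1 != 0 :> K) || (z != 0) by rewrite oner_neq0.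
have [G [H H0 GE]] := mloc _ (V2 1 0 (one 0)).
have pull (F : {mpoly K[2]}) : exists P : {poly K}, forall z, P.[z] = F.@[pt2 1 z 0].
  have [|P PE] := poly2_meval F (r := fun j z x => pt2 1 z 0 j).
    by apply: poly2_pt2; [exact: poly2_const|apply: poly2_ext (poly2_fst 'X) => z x; rewrite hornerX].
  by exists P.[0%:P] => z; rewrite -PE.
have [N0 N0E] := pull (G ord0); have [N1 N1E] := pull (G (lift ord0 ord0)).
have [HN HNE] := pull H.
have HN0 : HN != 0 by apply: contra_neq H0 => HN0; rewrite -HNE HN0 horner0.
have GN z : HN.[z] != 0 -> @same _ (P1 K) (m (pt2 1 z)) (pt2 N0.[z] N1.[z]).
  rewrite HNE => Hz; have := GE _ (V2 1 z (one z)) Hz; congr (same _ _).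
  apply/rowP => j; rewrite !mxE N0E N1E; case: j => -[|[|//]] jlt /=.
    by rewrite (_ : Ordinal jlt = ord0) //; apply/val_inj.
  by rewrite (_ : Ordinal jlt = lift ord0 ord0) //; apply/val_inj.
have Nnz z : HN.[z] != 0 -> (N0.[z] != 0) || (N1.[z] != 0).
  move=> /GN[c c0 E]; have [m0 _] := mV _ (V2 1 z (one z)).
  by rewrite -pt2_neq0 E scaler_eq0 negb_or c0.
have HN00 : HN.[0] != 0 by rewrite HNE.
have N_neq0 : (N1 != 0) || (N0 != 0).
  move: (Nnz 0 HN00); apply: contraTT; rewrite !negb_or !negbK => /andP[/eqP-> /eqP->].
  by rewrite !horner0 eqxx.
(* The fraction [P / Q] is [N1 / N0] in lowest terms. *)
pose d := gcdp N1 N0; have d0 : d != 0 by rewrite gcdp_eq0 negb_and.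
have := coprimep_div_gcd N_neq0; rewrite -/d.
have := divpK (dvdp_gcdl N1 N0); have := divpK (dvdp_gcdr N1 N0); rewrite -/d.
move: (N1 %/ d) (N0 %/ d) => P Q N0Q N1P cPQ.
have [sP sQ] : (size P <= 2)%N /\ (size Q <= 2)%N.
  apply: (injective_ratio_size cPQ).
  have [s sE] := cofin_horner_neq0 HN0; exists s => z z' /sE zs /sE z's PQ.
  have := minj 1 z 1 z' (one z) (one z'); rewrite !mul1r => /(_ _)/esym; apply.
  apply: (proj_trans (GN z zs)); apply: proj_trans (proj_sym (GN z' z's)).
  apply: pt2_same; try exact: Nnz.
  by rewrite -N0Q -N1P !hornerM; transitivity ((P.[z'] * Q.[z]) * d.[z] * d.[z']); [ring|rewrite -PQ; ring].
have lin (F : {poly K}) : (size F <= 2)%N -> forall z, F.[z] = F`_0 * 1 + F`_1 * z.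
  by move=> sF z; rewrite (horner_coef_wide _ sF) big_ord_recl big_ord1 expr0 expr1.
exists Q`_0, Q`_1, P`_0, P`_1.
have good := cofinI (cofin_horner_neq0 HN0) (cofin_horner_neq0 d0).
have nz x : (Q`_0 * 1 + Q`_1 * x != 0) || (P`_0 * 1 + P`_1 * x != 0).
  by rewrite -!lin // orbC -implyNb negbK; apply/implyP => Px; exact: (coprimep_root cPQ).
have m1 x : HN.[x] != 0 /\ d.[x] != 0 ->
    @same _ (P1 K) (m (pt2 1 x)) (pt2 (Q`_0 * 1 + Q`_1 * x) (P`_0 * 1 + P`_1 * x)).
  move=> [Hx dx]; apply: (proj_trans (GN x Hx)); exists d.[x]^-1; rewrite ?invr_neq0 //.
  by rewrite pt2Z -N0Q -N1P !hornerM -!lin // ![d.[x]^-1 * _]mulrC !mulfK.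
have det0 : Q`_0 * P`_1 - Q`_1 * P`_0 != 0.
  apply/negP; rewrite subr_eq0 => /eqP det0.
  have [x gx] := cofin_ex good; have [x' [gx' xx']] := cofin_ex (cofinI good (cofin_neq x)).
  have := minj 1 x 1 x' (one x) (one x'); rewrite !mul1r => E; apply: xx'; apply: E.
  apply: (proj_trans (m1 x gx)); apply: proj_trans (proj_sym (m1 x' gx')).
  apply: pt2_same => //; apply/eqP; rewrite -subr_eq0; apply/eqP.
  transitivity ((Q`_0 * P`_1 - Q`_1 * P`_0) * (x' - x)); first by ring.
  by rewrite det0 subrr mul0r.
split=> // x y nzxy.
have X2 : poly2 (fun z x : K => z) by apply: poly2_ext (poly2_fst 'X) => z x'; rewrite hornerX.
have lin2 (u v : K) : poly2 (fun z x => u * z + v * x).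
  by apply: poly2D; apply: poly2M; try exact: poly2_const; [exact: X2|exact: poly2_snd].
apply: (@morphism_extend _ (P1 K) 2 setT m (fun z x => pt2 z x)
    (fun z x => pt2 (Q`_0 * z + Q`_1 * x) (P`_0 * z + P`_1 * x)) x y) => //.
- by apply: poly2_pt2; [exact: X2|exact: poly2_snd].
- by apply: poly2_pt2.
- apply: cofinS (cofin_neq 0) => z /eqP z0.
  have zfin b : cofin (fun x => x / z <> b).
    by apply: cofinS (cofin_neq (b * z)) => x' + x'E; apply; rewrite -x'E divfK.
  apply: cofinS (cofin_comp zfin good) => t gt.
  have nzt : (z != 0) || (t != 0) by rewrite z0.
  split; first exact: V2.
  apply: (@proj_trans _ _ _ _ (m (pt2 1 (t / z)))).
    apply: proj_sym; apply: ms; [exact: V2|exact: V2|exists z => //].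
    by rewrite pt2Z mulr1 mulrC divfK.
  by apply: (proj_trans (m1 _ gt)); exists z => //; rewrite pt2Z; congr pt2; field.
- exact: V2.
rewrite pt2_neq0; apply: contraTT nzxy; rewrite !negb_or !negbK => /andP[/eqP e0 /eqP e1].
apply/andP; split; apply/eqP; apply: (mulfI det0); rewrite mulr0.
  transitivity (P`_1 * (Q`_0 * x + Q`_1 * y) - Q`_1 * (P`_0 * x + P`_1 * y)); first by ring.
  by rewrite e0 e1 !mulr0 subrr.
transitivity (Q`_0 * (P`_0 * x + P`_1 * y) - P`_0 * (Q`_0 * x + Q`_1 * y)); first by ring.
by rewrite e0 e1 !mulr0 subrr.
Qed.

End Moebius.

(** * The conic bundle S *)

Section ConicSurface.

Variable K : numClosedFieldType.
Implicit Types (x y z w t b c : K).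

Lemma coord_row5 (z0 z1 x y t : K) : let v := row5 z0 z1 x y t in
  (coord v 0 = z0) * (coord v 1 = z1) * (coord v 2 = x) * (coord v 3 = y) *
  (coord v 4 = t).
Proof. by rewrite /coord /row5 !mxE !inordK. Qed.

Lemma row5_coord (v : 'rV[K]_5) :
  v = row5 (coord v 0) (coord v 1) (coord v 2) (coord v 3) (coord v 4).
Proof.
apply/rowP => j; rewrite mxE -[in LHS](inord_val j).
by case: j => -[|[|[|[|[|]]]]].
Qed.

Lemma row5_eq (u v : 'rV[K]_5) : coord u 0 = coord v 0 -> coord u 1 = coord v 1 ->
  coord u 2 = coord v 2 -> coord u 3 = coord v 3 -> coord u 4 = coord v 4 -> u = v.
Proof. by move=> e0 e1 e2 e3 e4; rewrite (row5_coord u) (row5_coord v) e0 e1 e2 e3 e4. Qed.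

(** The rescalings of coordinates that leave a point of [S] unchanged: [b]
    acts on the base and [c] on the fibre of P(O(l) + O(l) + O). *)
Definition torus5 l b c (v : 'rV[K]_5) : 'rV[K]_5 :=
  row5 (b * coord v 0) (b * coord v 1) (c * b ^+ l * coord v 2)
       (c * b ^+ l * coord v 3) (c * coord v 4).

Definition root_form (J : finType) (r : J -> K) (z0 z1 : K) : K :=
  \prod_j (z1 - r j * z0).

Lemma root_formE (J : finType) (r : J -> K) z0 z1 :
  root_form r z0 z1 = - branch_form r z0 z1.
Proof. by rewrite opprK. Qed.

(** [surfaceS] over any algebraically closed field with conjugation; over the
    complex numbers the two are convertible. *)
Definition conic_surface (l : nat) (a : 'I_(2 * l) -> K) : variety K :=
  @Variety K 5
    [set v | [/\ (coord v 0 != 0) || (coord v 1 != 0),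
        [|| coord v 2 != 0, coord v 3 != 0 | coord v 4 != 0] &
        coord v 2 * coord v 3 = coord v 4 ^+ 2 * root_form a (coord v 0) (coord v 1)]]%classic
    (fun v (w : 'rV[K]_5) => exists b c : K, [/\ b != 0, c != 0 & w = torus5 l b c v]).

Section Surface.
Variables (l : nat) (a : 'I_(2 * l) -> K).
Local Notation S := (conic_surface a).
Implicit Types (p : coords S).

Lemma root_formZ b z0 z1 : root_form a (b * z0) (b * z1) = (b ^+ l) ^+ 2 * root_form a z0 z1.
Proof. by rewrite !root_formE branch_formZ card_ord [RHS]mulrN -exprM [(l * 2)%N]mulnC. Qed.

Lemma same_torus5 p b c : b != 0 -> c != 0 -> same p (torus5 l b c p).
Proof. by move=> b0 c0; exists b, c. Qed.

Lemma S_sym p q : same p q -> same q p.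
Proof.
move=> [b [c [b0 c0 ->]]]; exists b^-1, c^-1; rewrite !invr_neq0 //; split=> //.
by apply: row5_eq; rewrite /torus5 !coord_row5 ?exprVn; field; rewrite ?b0 ?c0 ?expf_neq0.
Qed.

Lemma S_trans p q r : same p q -> same q r -> same p r.
Proof.
move=> [b [c [b0 c0 ->]]] [d [e [d0 e0 ->]]]; exists (d * b), (e * c).
rewrite !mulf_neq0 //; split=> //.
by apply: row5_eq; rewrite /torus5 !coord_row5 ?exprMn; ring.
Qed.

Lemma pts_row5 z0 z1 x y t : (z0 != 0) || (z1 != 0) ->
  [|| x != 0, y != 0 | t != 0] -> x * y = t ^+ 2 * root_form a z0 z1 ->
  @pts _ S (row5 z0 z1 x y t).
Proof. by move=> *; split; rewrite !coord_row5. Qed.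

Lemma pts_torus5 p b c : b != 0 -> c != 0 -> pts p -> @pts _ S (torus5 l b c p).
Proof.
move=> b0 c0 [z_neq0 f_neq0 pE]; rewrite /torus5; apply: pts_row5.
- by rewrite !mulf_eq0 (negPf b0).
- by rewrite !mulf_eq0 !expf_eq0 (negPf b0) (negPf c0) !andbF.
by rewrite root_formZ mulrACA pE; ring.
Qed.

End Surface.

End ConicSurface.

(** * Families of Moebius maps *)

Section MoebiusFamilies.

Variable K : numClosedFieldType.
Implicit Types (al be ga de p : {poly K}).

Lemma cofin_size_map (P : {poly {poly K}}) :
  cofin (fun z => size (map_poly (horner_eval z) P) = size P).
Proof.
have [->|P0] := eqVneq P 0; first by apply: cofinT => z; rewrite map_poly0 !size_poly0.
have lP0 : lead_coef P != 0 by rewrite lead_coef_eq0.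
by apply: cofinS (cofin_horner_neq0 lP0) => z Pz; apply: size_map_poly_id0.
Qed.

(** For general [z], the fraction of [N] and [M], once reduced to lowest terms
    over the rational functions in [z], is an injective rational function of
    [x], hence of degree one. *)
Lemma moebius_of_injective (N M : {poly {poly K}}) :
    (exists z x, M.[x%:P].[z] != 0) ->
    cofin (fun z => exists s : seq K, forall x x', x \notin s -> x' \notin s ->
      N.[x%:P].[z] * M.[x'%:P].[z] = N.[x'%:P].[z] * M.[x%:P].[z] -> x = x') ->
  exists al be ga de, al * de - be * ga != 0 /\
    forall z x, N.[x%:P].[z] * (ga.[z] + de.[z] * x) =
                M.[x%:P].[z] * (al.[z] + be.[z] * x).
Proof.
move=> M0 inj; have M_neq0 : M != 0.
  by have [z [x]] := M0; apply: contra_neq => ->; rewrite !horner0.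
(* Pseudo-division over the polynomials in [z]: [c1] and [c2] are
   denominators, and [P / Q] is [N / M] in lowest terms over the rational
   functions in [z]. *)
pose d := gcdp N M; have d0 : d != 0 by rewrite gcdp_eq0 negb_and M_neq0 orbT.
have /Pdiv.WeakIdomain.dvdpP[[c1 P] /= c10 NP] := dvdp_gcdl N M.
have /Pdiv.WeakIdomain.dvdpP[[c2 Q] /= c20 MQ] := dvdp_gcdr N M.
have [u] := Pdiv.CommonIdomain.Bezoutp N M.
move=> /Pdiv.CommonIdomain.eqpP[[e1 e2] /= /andP[e10 e20] bez].
rewrite -/d in NP MQ bez.
have {}bez : (e1 * c2) *: (u.1 * P) + (e1 * c1) *: (u.2 * Q) = (e2 * c1 * c2)%:P.
  apply: (mulIf d0); move: NP MQ bez; rewrite -!mul_polyC !polyCM => NP MQ bez.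
  transitivity (c1%:P * c2%:P * (e1%:P * (u.1 * N + u.2 * M))); last by rewrite bez; ring.
  by transitivity (e1%:P * (c2%:P * u.1 * (P * d) + c1%:P * u.2 * (Q * d))); [ring|rewrite -NP -MQ; ring].
pose ev (R : {poly {poly K}}) z := map_poly (horner_eval z) R.
have evE R z x : R.[x%:P].[z] = (ev R z).[x] by rewrite horner2E.
have good : cofin (fun z => [/\ (size P <= 2)%N, (size Q <= 2)%N &
    (c2 * P`_0 * (c1 * Q`_1) - c2 * P`_1 * (c1 * Q`_0)).[z] != 0]).
  have r0 : e2 * c1 * c2 != 0 by rewrite !mulf_neq0.
  apply: cofinS (cofinI (cofinI inj (cofinI (cofin_size_map P) (cofin_size_map Q)))
    (cofinI (cofin_horner_neq0 r0) (cofinI (cofin_horner_neq0 c10) (cofin_horner_neq0 c20)))).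
  move=> z [[[s sinj] [sP sQ]] [rz [c1z c2z]]].
  (* The Bezout relation survives the evaluation at a general [z]. *)
  have cop : coprimep (ev P z) (ev Q z).
    apply/Bezout_coprimepP; exists ((e1 * c2).[z] *: ev u.1 z, (e1 * c1).[z] *: ev u.2 z) => /=.
    rewrite -!scalerAl -!rmorphM /=.
    have := congr1 (fun R => ev R z) bez; rewrite /ev rmorphD /= !map_polyZ map_polyC /=.
    by rewrite /horner_eval => ->; rewrite polyC_eqp1.
  have NE x : c1.[z] * N.[x%:P].[z] = (ev P z).[x] * d.[x%:P].[z].
    by rewrite -evE; have := congr1 (fun R : {poly {poly K}} => R.[x%:P].[z]) NP; rewrite /= hornerZ !hornerM.
  have ME x : c2.[z] * M.[x%:P].[z] = (ev Q z).[x] * d.[x%:P].[z].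
    by rewrite -evE; have := congr1 (fun R : {poly {poly K}} => R.[x%:P].[z]) MQ; rewrite /= hornerZ !hornerM.
  have Pinj x x' : x \notin s -> x' \notin s ->
      (ev P z).[x] * (ev Q z).[x'] = (ev P z).[x'] * (ev Q z).[x] -> x = x'.
    move=> xs x's PQ; apply: sinj => //; apply: (mulfI c1z); apply: (mulfI c2z).
    transitivity (c1.[z] * N.[x%:P].[z] * (c2.[z] * M.[x'%:P].[z])); first by ring.
    transitivity (c1.[z] * N.[x'%:P].[z] * (c2.[z] * M.[x%:P].[z])); last by ring.
    rewrite !NE !ME.
    transitivity ((ev P z).[x] * (ev Q z).[x'] * d.[x%:P].[z] * d.[x'%:P].[z]); first by ring.
    by rewrite PQ; ring.
  have [] := injective_ratio_size cop; first by exists s.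
  rewrite /ev sP sQ => sP2 sQ2; split=> //.
  rewrite !(hornerD, hornerN, hornerM); apply/negP => /eqP det0.
  have lin (R : {poly {poly K}}) x : (size R <= 2)%N -> (ev R z).[x] = (R`_0).[z] + (R`_1).[z] * x.
    move=> sR; rewrite (@horner_coef_wide _ 2) ?(leq_trans (size_poly _ _)) //.
    by rewrite big_ord_recl big_ord1 expr0 expr1 mulr1 !coef_map.
  have cs : cofin (fun x => x \notin s) by exists s.
  have [x xs] := cofin_ex cs; have [x' [x's]] := cofin_ex (cofinI cs (cofin_neq x)).
  apply; apply/esym; apply: Pinj => //; rewrite !lin //.
  apply: (mulfI c1z); apply: (mulfI c2z); apply/eqP; rewrite -subr_eq0; apply/eqP.
  by rewrite -[RHS](mulr0 (x - x')) -[in RHS]oppr0 -[in RHS]det0; ring.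
have [z0 [sP sQ det0]] := cofin_ex good.
exists (c2 * P`_0), (c2 * P`_1), (c1 * Q`_0), (c1 * Q`_1); split.
  by apply: contra_neq det0 => det0; rewrite det0 horner0.
move=> z x; have lin (R : {poly {poly K}}) : (size R <= 2)%N -> R.[x%:P].[z] = (R`_0).[z] + (R`_1).[z] * x.
  by move=> sR; rewrite (horner_coef_wide _ sR) big_ord_recl big_ord1 expr0 expr1 mulr1 !hornerE.
rewrite !hornerM -!mulrA -!mulrDr -!lin //.
have NE : c1.[z] * N.[x%:P].[z] = P.[x%:P].[z] * d.[x%:P].[z].
  by have := congr1 (fun R : {poly {poly K}} => R.[x%:P].[z]) NP; rewrite /= hornerZ !hornerM.
have ME : c2.[z] * M.[x%:P].[z] = Q.[x%:P].[z] * d.[x%:P].[z].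
  by have := congr1 (fun R : {poly {poly K}} => R.[x%:P].[z]) MQ; rewrite /= hornerZ !hornerM.
rewrite mulrCA mulrA NE; apply/esym; rewrite mulrCA mulrA ME; ring.
Qed.

(** Dividing all entries by [X - c], for a common zero [c], lowers the degree
    of the determinant by two, so the process stops. The set [Z] serves to
    remove common zeros at one chosen point only. *)
Lemma quad_factor (Z : K -> Prop) al be ga de : al * de - be * ga != 0 ->
  exists s al' be' ga' de', let D := \prod_(c <- s) ('X - c%:P) in
  [/\ forall c, c \in s -> Z c,
      [/\ al = D * al', be = D * be', ga = D * ga' & de = D * de'] &
      forall z, Z z -> [|| al'.[z] != 0, be'.[z] != 0, ga'.[z] != 0 | de'.[z] != 0]].
Proof.
have [n] := ubnP (size (al * de - be * ga)); elim: n => // n IHn in al be ga de *.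
rewrite ltnS => sn det0.
have [[z [Zz az bz cz dz]]|none] := pselect (exists z,
    [/\ Z z, al.[z] = 0, be.[z] = 0, ga.[z] = 0 & de.[z] = 0]); last first.
  exists [::], al, be, ga, de; rewrite /= big_nil !mul1r; split=> // z Zz.
  apply/negPn/negP; rewrite !negb_or !negbK => /and4P[/eqP ? /eqP ? /eqP ? /eqP ?].
  by apply: none; exists z.
have [al1 alE] := root_factor az; have [be1 beE] := root_factor bz.
have [ga1 gaE] := root_factor cz; have [de1 deE] := root_factor dz.
have detE : al * de - be * ga = ('X - z%:P) * (('X - z%:P) * (al1 * de1 - be1 * ga1)).
  by rewrite alE beE gaE deE; ring.
have det1 : al1 * de1 - be1 * ga1 != 0.
  by apply: contra_neq det0 => det1; rewrite detE det1 !mulr0.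
have sdet1 : (size (al1 * de1 - be1 * ga1)%R < n)%N.
  apply: leq_trans sn; rewrite detE !size_monicM ?monicXsubC ?size_XsubC //=.
  by rewrite mulf_neq0 ?polyXsubC_eq0.
have [s [al2 [be2 [ga2 [de2 [sZ [aE bE cE dE] nz]]]]]] := IHn _ _ _ _ sdet1 det1.
exists (z :: s), al2, be2, ga2, de2; rewrite /= big_cons -!mulrA -aE -bE -cE -dE.
by split=> // c; rewrite inE => /predU1P[->|/sZ].
Qed.

(** [p] in the coordinate at infinity, for a section of degree [n]. *)
Definition rev_poly n p : {poly K} := \poly_(i < n.+1) p`_(n - i).

Lemma horner_rev_poly n p w : (size p <= n.+1)%N -> w != 0 ->
  (rev_poly n p).[w] = w ^+ n * p.[w^-1].
Proof.
move=> sp w0; rewrite horner_poly (horner_coef_wide _ sp) mulr_sumr.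
rewrite (reindex_inj rev_ord_inj); apply: eq_bigr => i _ /=.
rewrite subSS subKn -1?ltnS // [RHS]mulrCA; congr (_ * _).
by rewrite exprVn -expfB_cond ?(negPf w0) //; exact: ltn_ord i.
Qed.

Lemma size_rev_poly_factor n p j r : (size p <= n.+1)%N -> rev_poly n p = 'X^j * r ->
  (size p <= n.+1 - j)%N.
Proof.
move=> sp E; apply/leq_sizeP => i ji.
have [ni|ni] := ltnP n i; first by move/leq_sizeP: sp; apply.
have := congr1 (fun q : {poly K} => q`_(n - i)) E; rewrite coef_poly coefXnM.
by rewrite ltnS leq_subr subKn // ltn_subLR // (_ : n < i + j)%N //; lia.
Qed.

Lemma size_rev_poly_exact n p j r : (size p <= n.+1)%N -> rev_poly n p = 'X^j * r ->
  r.[0] != 0 -> size p = (n - j).+1 /\ (j <= n)%N.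
Proof.
move=> sp E r0; have := congr1 (fun q : {poly K} => q`_j) E.
rewrite coef_poly coefXnM ltnn subnn -horner_coef0 ltnS.
case: ifP => [jn pE|_ /esym/eqP]; last by rewrite (negPf r0).
split=> //; apply/eqP; rewrite eqn_leq -(subSn jn) (size_rev_poly_factor sp E) subSn //=.
by rewrite ltnNge; apply: contraNN r0 => /leq_sizeP/(_ _ (leqnn _)); rewrite pE => ->.
Qed.

Lemma simple_roots_normal p : p != 0 -> (forall z, simple_root p z) ->
  exists2 rs, uniq rs & p = lead_coef p *: \prod_(c <- rs) ('X - c%:P).
Proof.
move=> p0 psimple; have [rs pE] := closed_field_poly_normal p; exists rs => //.
apply: count_mem_uniq => c; have [crs|] := boolP (c \in rs); last by move/count_memPn.
have pc : p.[c] = 0 by rewrite pE hornerZ; have /rootP -> := etrans (root_prod_XsubC rs c) crs; rewrite mulr0.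
have [k pk kc] := psimple c pc.
have prs := perm_to_rem crs.
have kE : k = lead_coef p *: \prod_(c <- rem c rs) ('X - c%:P).
  apply: (mulfI (x := 'X - c%:P)); first by rewrite polyXsubC_eq0.
  by rewrite -pk {1}pE (perm_big _ prs) /= big_cons scalerAr.
rewrite (permP prs) /= eqxx; congr (_.+1); apply/count_memPn; apply: contraNN kc => crem.
by rewrite kE hornerZ; have /rootP -> := etrans (root_prod_XsubC _ _) crem; rewrite mulr0.
Qed.

Lemma size_root_prod (rs : seq K) : size (\prod_(c <- rs) ('X - c%:P)) = (size rs).+1.
Proof. exact: size_prod_XsubC. Qed.

Lemma root_prod_dvdp (rs : seq K) p : uniq rs -> (forall c, c \in rs -> p.[c] = 0) ->
  \prod_(c <- rs) ('X - c%:P) %| p.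
Proof.
move=> urs rsp; apply: uniq_roots_dvdp; last by rewrite uniq_rootsE.
by apply/allP => c /rsp/rootP.
Qed.

Section Degrees.
Variables (l : nat) (a : 'I_(2 * l) -> K).
Hypotheses (l_gt0 : (0 < l)%N) (a_inj : injective a).
Definition fibre_poly : {poly K} := \prod_i ('X - (a i)%:P).

Lemma fibre_polyE : fibre_poly = \prod_(c <- map a (enum 'I_(2 * l))) ('X - c%:P).
Proof. by rewrite big_map big_enum. Qed.

Lemma size_fibre_poly : size fibre_poly = (2 * l).+1.
Proof. by rewrite fibre_polyE size_root_prod size_map size_enum_ord. Qed.

Lemma uniq_fibres : uniq (map a (enum 'I_(2 * l))).
Proof. by rewrite map_inj_uniq ?enum_uniq. Qed.

Lemma mem_fibres i : a i \in map a (enum 'I_(2 * l)).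
Proof. by rewrite map_f ?mem_enum. Qed.

Lemma fibre_poly_dvdp p : (forall i, p.[a i] = 0) -> fibre_poly %| p.
Proof.
move=> ap; rewrite fibre_polyE; apply: root_prod_dvdp; first exact: uniq_fibres.
by move=> c /mapP[i _ ->].
Qed.

Lemma fibre_poly_monic : fibre_poly \is monic.
Proof. exact: monic_prod_XsubC. Qed.

Lemma simple_roots_fibre_poly p : size p = (2 * l).+1 -> (forall z, simple_root p z) ->
  (forall z, p.[z] = 0 -> exists i, z = a i) -> p = lead_coef p *: fibre_poly.
Proof.
move=> sp psimple proots; have p0 : p != 0 by rewrite -size_poly_gt0 sp.
have [rs urs pE] := simple_roots_normal p0 psimple.
rewrite {1}pE fibre_polyE; congr (_ *: _); apply: perm_big.
have lp0 : lead_coef p != 0 by rewrite lead_coef_eq0.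
have srs : size rs = (2 * l)%N.
  by apply/eqP; rewrite -eqSS -size_root_prod -(size_scale _ lp0) -pE sp.
have sub : {subset rs <= map a (enum 'I_(2 * l))}.
  move=> c crs; have [|i ->] := proots c; last exact: mem_fibres.
  by rewrite pE hornerZ; have /rootP -> := etrans (root_prod_XsubC rs c) crs; rewrite mulr0.
have [|_ memE] := uniq_min_size urs sub; first by rewrite size_map size_enum_ord srs.
by apply: uniq_perm => //; exact: uniq_fibres.
Qed.

(** The degrees leave only the two monomial Moebius maps. The determinant
    vanishes only at those [a i] where the second alternative holds, and
    simply there, so that there are exactly [2 k] of them; [al] and [de]
    vanish at all of these, but have degree at most [k]. Since [be] vanishes
    at all the [2 l] points [a i] and has degree at most [k + l], either
    [be = 0] and [k = 0], or [k = l] and [be] is a multiple of the fibre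
    polynomial. *)
Lemma monomial_matrix al be ga de k :
    (forall z, (al * de - be * ga).[z] = 0 -> exists i, z = a i) ->
    (forall i, [/\ be.[a i] = 0, al.[a i] != 0 & de.[a i] != 0] \/
      exists al1 be1 de1, [/\ al = ('X - (a i)%:P) * al1, be = ('X - (a i)%:P) * be1,
        de = ('X - (a i)%:P) * de1, be1.[a i] != 0 & ga.[a i] != 0]) ->
    size (al * de - be * ga) = (2 * k).+1 ->
    (size al <= k.+1)%N -> (size de <= k.+1)%N -> (size be <= (k + l).+1)%N ->
    (size ga <= k.+1 - l)%N ->
  (exists c d, [/\ c != 0, d != 0, be = 0, ga = 0 & al = c%:P /\ de = d%:P]) \/
  (exists c d, [/\ c != 0, d != 0, al = 0, de = 0 & be = c *: fibre_poly /\ ga = d%:P]).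
Proof.
move=> det_roots loc sdet sal sde sbe sga; set det := _ - _ in det_roots sdet.
have det0 : det != 0 by rewrite -size_poly_gt0 sdet.
have det_simple z : simple_root det z.
  move=> dz; have [i zi] := det_roots z dz; have [[b0 a0 d0]|] := loc i.
    move: dz; rewrite zi /det !hornerE b0 mul0r subr0 => /eqP.
    by rewrite mulf_eq0 (negPf a0) (negPf d0).
  move=> [al1 [be1 [de1 [alE beE deE b10 c0]]]].
  exists (('X - (a i)%:P) * al1 * de1 - be1 * ga); rewrite zi.
    by rewrite /det alE beE deE; ring.
  by rewrite hornerD hornerN !hornerM hornerXsubC subrr !mul0r add0r oppr_eq0 mulf_neq0.
have [rs urs detE] := simple_roots_normal det0 det_simple.
have ld0 : lead_coef det != 0 by rewrite lead_coef_eq0.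
have srs : size rs = (2 * k)%N.
  by apply/eqP; rewrite -eqSS -size_root_prod -(size_scale _ ld0) -detE sdet.
have rs_det c : c \in rs -> det.[c] = 0.
  by move=> crs; rewrite detE hornerZ; have /rootP -> := etrans (root_prod_XsubC rs c) crs; rewrite mulr0.
have rs_vanish c : c \in rs -> al.[c] = 0 /\ de.[c] = 0.
  move=> /rs_det dc; have [i ci] := det_roots c dc; rewrite ci; have [[b0 a0 d0]|] := loc i.
    move: dc; rewrite ci /det !hornerE b0 mul0r subr0 => /eqP.
    by rewrite mulf_eq0 (negPf a0) (negPf d0).
  move=> [al1 [be1 [de1 [-> _ -> _ _]]]].
  by rewrite !hornerM hornerXsubC subrr !mul0r.
have al_dvd : \prod_(c <- rs) ('X - c%:P) %| al by apply: root_prod_dvdp => // c /rs_vanish[].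
have de_dvd : \prod_(c <- rs) ('X - c%:P) %| de by apply: root_prod_dvdp => // c /rs_vanish[].
have kl : (2 * k <= 2 * l)%N.
  rewrite -srs -[leqRHS](size_enum_ord) -(size_map a); apply: uniq_leq_size => // c /rs_det/det_roots[i ->].
  exact: mem_fibres.
have be_dvd : fibre_poly %| be.
  apply: fibre_poly_dvdp => i; have [[]//|] := loc i.
  by move=> [al1 [be1 [de1 [_ -> _ _ _]]]]; rewrite hornerM hornerXsubC subrr mul0r.
have size_al p : \prod_(c <- rs) ('X - c%:P) %| p -> p != 0 -> (2 * k < size p)%N.
  by move=> dvd p0; have := dvdp_leq p0 dvd; rewrite size_root_prod srs.
have [be0|be0] := eqVneq be 0.
  have detE' : det = al * de by rewrite /det be0 mul0r subr0.
  move: det0; rewrite detE' mulf_eq0 negb_or => /andP[al0 de0].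
  have sal' := size_al _ al_dvd al0; have sde' := size_al _ de_dvd de0.
  have k0 : k = 0%N by lia.
  have /size_poly1P[c c0 cE] : size al == 1%N by lia.
  have /size_poly1P[d d0 dE] : size de == 1%N by lia.
  left; exists c, d; split=> //; apply/eqP; rewrite -size_poly_leq0; lia.
have sfb := dvdp_leq be0 be_dvd; rewrite size_fibre_poly in sfb.
have kE : k = l by have := leq_trans sfb sbe; lia.
have al0 : al = 0.
  by apply/eqP; apply: contraLR isT => /(size_al _ al_dvd) al_gt; have := leq_trans al_gt sal; lia.
have de0 : de = 0.
  by apply/eqP; apply: contraLR isT => /(size_al _ de_dvd) de_gt; have := leq_trans de_gt sde; lia.
have ga0 : ga != 0.
  by apply: contra_neq det0 => ga0; rewrite /det al0 ga0 mul0r mulr0 subrr.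
have /size_poly1P[d d0 dE] : size ga == 1%N.
  by rewrite eqn_leq size_poly_gt0 ga0 andbT (leq_trans sga) //; lia.
have /eqpfP beE : be %= fibre_poly.
  rewrite eqp_sym -(dvdp_size_eqp be_dvd) size_fibre_poly eqn_leq sfb.
  by rewrite (leq_trans sbe) //; lia.
right; exists (lead_coef be), d; split=> //; first by rewrite lead_coef_eq0.
by split=> //; rewrite {1}beE (monicP fibre_poly_monic) divr1.
Qed.

End Degrees.

End MoebiusFamilies.

(** * Fibre-preserving maps from S to T *)

Section FibrewiseMoebius.

Variable K : numClosedFieldType.
Implicit Types (x y z w s t b c xi eta : K).

Variables (l : nat) (a : 'I_(2 * l) -> K).
Local Notation S := (conic_surface a).
Local Notation F := (root_form a).
Implicit Types (p : coords S).

(** The charts [x = 1] and [y = 1] of the conic [x y = t^2 F], where [s] is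
    the coordinate [t]. Their union misses one point only, the node of a
    reducible fibre. *)
Definition chart_x z0 z1 s : coords S := row5 z0 z1 1 (F z0 z1 * s ^+ 2) s.
Definition chart_y z0 z1 s : coords S := row5 z0 z1 (F z0 z1 * s ^+ 2) 1 s.
Definition node_pt z0 z1 : coords S := row5 z0 z1 0 0 1.

Lemma pts_chart_x z0 z1 s : (z0 != 0) || (z1 != 0) -> pts (chart_x z0 z1 s).
Proof. by move=> z_neq0; apply: pts_row5; rewrite ?oner_neq0 // mul1r mulrC. Qed.

Lemma pts_chart_y z0 z1 s : (z0 != 0) || (z1 != 0) -> pts (chart_y z0 z1 s).
Proof. by move=> z_neq0; apply: pts_row5; rewrite ?oner_neq0 ?orbT // mulr1 mulrC. Qed.

Lemma pts_node z0 z1 : (z0 != 0) || (z1 != 0) -> F z0 z1 = 0 -> pts (node_pt z0 z1).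
Proof. by move=> z_neq0 F0; apply: pts_row5; rewrite ?oner_neq0 ?orbT // F0 !mulr0. Qed.

Lemma torus5_chart_xy z0 z1 s : F z0 z1 != 0 -> s != 0 ->
  chart_y z0 z1 s = torus5 l 1 (F z0 z1 * s ^+ 2) (chart_x z0 z1 ((F z0 z1)^-1 / s)).
Proof.
move=> F0 s0; rewrite /chart_x /chart_y /torus5.
by apply: row5_eq; rewrite !coord_row5 ?expr1n //; field; rewrite ?F0 ?s0.
Qed.

Lemma fibre_cases p : pts p -> exists2 c, c != 0 &
  let z0 := coord p 0 in let z1 := coord p 1 in
  [\/ exists s, torus5 l 1 c p = chart_x z0 z1 s,
      exists s, torus5 l 1 c p = chart_y z0 z1 s |
      F z0 z1 = 0 /\ torus5 l 1 c p = node_pt z0 z1].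
Proof.
move=> [z_neq0 nz pE] /=.
have [x0|x0] := eqVneq (coord p 2) 0; last first.
  exists (coord p 2)^-1; rewrite ?invr_neq0 //; apply: Or31; exists (coord p 4 / coord p 2).
  rewrite /torus5 expr1n mulr1 !mul1r; apply: row5_eq; rewrite !coord_row5 ?mulVf //; last exact: mulrC.
  apply: (mulfI x0); rewrite mulrA divff // mul1r.
  by apply: (mulfI x0); rewrite pE; field.
have [y0|y0] := eqVneq (coord p 3) 0; last first.
  exists (coord p 3)^-1; rewrite ?invr_neq0 //; apply: Or32; exists (coord p 4 / coord p 3).
  rewrite /torus5 expr1n mulr1 !mul1r; apply: row5_eq; rewrite !coord_row5 ?mulVf //; last exact: mulrC.
  apply: (mulfI y0); rewrite mulrA divff // mul1r.
  by apply: (mulfI y0); rewrite mulrC pE; field.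
have t0 : coord p 4 != 0 by move: nz; rewrite x0 y0 eqxx.
exists (coord p 4)^-1; rewrite ?invr_neq0 //; apply: Or33; split.
  move/esym/eqP: pE; rewrite x0 mul0r mulf_eq0 expf_eq0 (negPf t0) andbF /= => /eqP //.
by rewrite /torus5 expr1n mulr1 !mul1r; apply: row5_eq; rewrite !coord_row5 ?mulVf ?x0 ?y0 ?mulr0.
Qed.

(** [Fr p c xi eta] stands for the statement that a fibre-preserving map from
    [S] to a family of conics [xi eta = c^2 h] sends [p] to the point
    [(c, xi, eta)] over the same base point. The hypotheses say that the
    triple is unique up to scale, that the map is bijective over the points
    with [c != 0], and that algebraic expressions for it extend by continuity. *)
Variables (Fr : coords S -> K -> K -> K -> Prop) (h : K -> K -> K).
Hypothesis h_hom : forall b z0 z1, h (b * z0) (b * z1) = b ^+ l ^+ 2 * h z0 z1.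
Hypothesis Fr_eq : forall p c xi eta, pts p -> Fr p c xi eta ->
  xi * eta = c ^+ 2 * h (coord p 0) (coord p 1).
Hypothesis Fr_prop : forall p c xi eta c' xi' eta', pts p ->
  Fr p c xi eta -> Fr p c' xi' eta' ->
  exists2 b, b != 0 & [/\ c' = b * c, xi' = b * xi & eta' = b * eta].
Hypothesis FrZ : forall p b c xi eta, b != 0 ->
  Fr p c xi eta -> Fr p (b * c) (b * xi) (b * eta).
Hypothesis Fr_torus5 : forall p b d c xi eta, pts p -> b != 0 -> d != 0 ->
  Fr p c xi eta -> Fr (torus5 l b d p) c (b ^+ l * xi) (b ^+ l * eta).
Hypothesis Fr_onto : forall z0 z1 c xi eta, (z0 != 0) || (z1 != 0) -> c != 0 ->
    xi * eta = c ^+ 2 * h z0 z1 ->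
  exists p, [/\ pts p, coord p 0 = z0, coord p 1 = z1 & Fr p c xi eta].
Hypothesis Fr_inj : forall p p' c xi eta, pts p -> pts p' -> c != 0 ->
  coord p 0 = coord p' 0 -> coord p 1 = coord p' 1 ->
  Fr p c xi eta -> Fr p' c xi eta -> same p p'.
Hypothesis Fr_extend : forall (chi : K -> K -> coords S) (c xi eta : K -> K -> K) z x,
    (forall j, poly2 (fun z x => chi z x 0 j)) -> poly2 c -> poly2 xi -> poly2 eta ->
    generic (fun z x => pts (chi z x) /\ Fr (chi z x) (c z x) (xi z x) (eta z x)) ->
    pts (chi z x) -> [|| c z x != 0, xi z x != 0 | eta z x != 0] ->
  Fr (chi z x) (c z x) (xi z x) (eta z x).

(** The points [(1, X u, Y u)] lie on one fibre of the target, and each is hit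
    because the map is onto. A single point of [S] has only one image, so the
    finitely many exceptional [s] and the node account for finitely many of
    the infinitely many [u]; the other points of the fibre hit none of them. *)
Lemma fibre_not_covered z0 z1 (X Y : K -> K) (u0 : seq K) :
    (z0 != 0) || (z1 != 0) ->
    (forall u, u \notin u0 -> X u * Y u = h z0 z1) ->
    (forall u u', X u = X u' -> Y u = Y u' -> u = u') ->
    cofin (fun s => forall u, u \notin u0 -> ~ Fr (chart_x z0 z1 s) 1 (X u) (Y u)) ->
    (F z0 z1 = 0 ->
     cofin (fun s => forall u, u \notin u0 -> ~ Fr (chart_y z0 z1 s) 1 (X u) (Y u))) ->
  False.
Proof.
move=> z_neq0 XY XYinj [Bx BxP] cofy.
have one p : pts p -> cofin (fun u => ~ Fr p 1 (X u) (Y u)).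
  move=> Sp; have [[v vP]|none] := pselect (exists v, Fr p 1 (X v) (Y v)); last first.
    by apply: cofinT => u uP; apply: none; exists u.
  apply: cofinS (cofin_neq v) => u uv uP; apply: uv.
  have [b b0 []] := Fr_prop Sp vP uP; rewrite mulr1 => <-.
  by rewrite !mul1r; exact: XYinj.
have [By ByP] : exists By : seq K, F z0 z1 = 0 -> forall s, s \notin By -> forall u, u \notin u0 ->
    ~ Fr (chart_y z0 z1 s) 1 (X u) (Y u).
  have [F0|F0] := eqVneq (F z0 z1) 0; last by exists [::] => E; rewrite E eqxx in F0.
  by have [By ByP] := cofy F0; exists By => _.
have g0 : cofin (fun u => u \notin u0) by exists u0.
have g1 := cofin_all (s := Bx) (fun s _ => one _ (pts_chart_x s z_neq0)).
have g2 := cofin_all (s := 0 :: By) (fun s _ => one _ (pts_chart_y s z_neq0)).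
have g3 : cofin (fun u => F z0 z1 = 0 -> ~ Fr (node_pt z0 z1) 1 (X u) (Y u)).
  have [F0|F0] := pselect (F z0 z1 = 0); last by apply: cofinT => u /F0.
  by apply: cofinS (one _ (pts_node z_neq0 F0)).
have [u [[[uu0 uBx] uBy] unode]] := cofin_ex (cofinI (cofinI (cofinI g0 g1) g2) g3).
have [|p [Sp p0 p1 pu]] := Fr_onto (eta := Y u) (xi := X u) z_neq0 (oner_neq0 K).
  by rewrite expr1n mul1r XY.
have [c c0 /=] := fibre_cases Sp; rewrite p0 p1.
have := Fr_torus5 Sp (oner_neq0 K) c0 pu; rewrite expr1n !mul1r => cpu.
case=> [[s sE]|[s sE]|[F0 nE]]; first 2 last.
- by apply: (unode F0); rewrite -nE.
- by rewrite sE in cpu; have [/uBx|/BxP] := boolP (s \in Bx); [|move/(_ u uu0)]; apply.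
rewrite sE in cpu; have [F0|F0] := eqVneq (F z0 z1) 0.
  have [sBy|/(ByP F0)/(_ u uu0)//] := boolP (s \in By).
  by apply: (uBy s); rewrite // inE sBy orbT.
have [s0|s0] := eqVneq s 0; first by apply: (uBy s); rewrite // inE s0 eqxx.
have d0 : (F z0 z1 * s ^+ 2)^-1 != 0 by rewrite invr_neq0 ?mulf_neq0 ?expf_neq0.
pose s' := (F z0 z1)^-1 / s.
have s'E : chart_x z0 z1 s' = torus5 l 1 (F z0 z1 * s ^+ 2)^-1 (chart_y z0 z1 s).
  apply: row5_eq; rewrite /torus5 !coord_row5 ?expr1n /s' //; field; rewrite ?F0 ?s0 //.
have := Fr_torus5 (pts_chart_y s z_neq0) (oner_neq0 K) d0 cpu; rewrite expr1n !mul1r -s'E.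
by have [/uBx|/BxP/(_ u uu0)] := boolP (s' \in Bx).
Qed.

Lemma Fr_eta0 p c xi X u : pts p -> Fr p c xi 0 -> u != 0 -> ~ Fr p 1 X u.
Proof.
move=> Sp E u0 E'; have [b b0 [_ _ uE]] := Fr_prop Sp E E'.
by move: u0; rewrite uE mulr0 eqxx.
Qed.

Lemma Fr_xi0 p c eta Y u : pts p -> Fr p c 0 eta -> u != 0 -> ~ Fr p 1 u Y.
Proof.
move=> Sp E u0 E'; have [b b0 [_ uE _]] := Fr_prop Sp E E'.
by move: u0; rewrite uE mulr0 eqxx.
Qed.

(** The factor [d] may vanish at [(z, x)], where the formula with the factor
    has no content. *)
Lemma Fr_extend_factor (chi : K -> K -> coords S) (d c xi eta : K -> K -> K) z x :
    (forall j, poly2 (fun z x => chi z x 0 j)) -> (forall z x, pts (chi z x)) ->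
    poly2 d -> poly2 c -> poly2 xi -> poly2 eta -> (exists z x, d z x != 0) ->
    generic (fun z x =>
      Fr (chi z x) (d z x * c z x) (d z x * xi z x) (d z x * eta z x)) ->
    [|| c z x != 0, xi z x != 0 | eta z x != 0] ->
  Fr (chi z x) (c z x) (xi z x) (eta z x).
Proof.
move=> chiP chiS dP cP xiP etaP [z' [x' d0]] gen nz; apply: Fr_extend => //.
apply: genericS (genericI gen (poly2_neq0 dP d0)) => z1 x1 [E dzx]; split=> //.
have dV : (d z1 x1)^-1 != 0 by rewrite invr_neq0.
by have := FrZ dV E; rewrite !mulKf.
Qed.

(** A neighbourhood of a fibre, with base coordinates [(g0 w, g1 w)]; both
    affine charts of the base are instances. In the hypothesis [gen_x], the
    point [(P Q, P^2, Q^2 h)] is the one on the conic with [xi / c = P / Q],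
    so that the map is the Moebius transformation with matrix
    [(al, be; ga, de)] on a general fibre. *)
Section Local.
Variables (g0 g1 fg hg al be ga de : {poly K}) (w0 : K).
Hypothesis g_neq0 : forall w, (g0.[w] != 0) || (g1.[w] != 0).
Hypothesis fgE : forall w, F g0.[w] g1.[w] = fg.[w].
Hypothesis hgE : forall w, h g0.[w] g1.[w] = hg.[w].
Hypothesis hg_simple : simple_root hg w0.
Hypothesis fg_neq0 : fg != 0.
Local Notation chi := (fun w s => chart_x g0.[w] g1.[w] s).
Local Notation psi := (fun w s => chart_y g0.[w] g1.[w] s).
Local Notation P := (fun w s => al.[w] + be.[w] * s).
Local Notation Q := (fun w s => ga.[w] + de.[w] * s).
Hypothesis gen_x : generic (fun w s => Fr (chi w s) (P w s * Q w s) (P w s ^+ 2)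
  (Q w s ^+ 2 * hg.[w])).

Lemma poly2_lin (A B : {poly K}) : poly2 (fun w s => A.[w] + B.[w] * s).
Proof.
by apply: poly2D; [exact: poly2_fst|apply: poly2M; [exact: poly2_fst|exact: poly2_snd]].
Qed.

Lemma poly2_row5 (c0 c1 c2 c3 c4 : K -> K -> K) :
    poly2 c0 -> poly2 c1 -> poly2 c2 -> poly2 c3 -> poly2 c4 ->
  forall j, poly2 (fun w s => row5 (c0 w s) (c1 w s) (c2 w s) (c3 w s) (c4 w s) 0 j).
Proof.
move=> P0 P1 P2 P3 P4; case=> -[|[|[|[|[|//]]]]] jlt.
- by apply: poly2_ext P0 => w s; rewrite mxE.
- by apply: poly2_ext P1 => w s; rewrite mxE.
- by apply: poly2_ext P2 => w s; rewrite mxE.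
- by apply: poly2_ext P3 => w s; rewrite mxE.
- by apply: poly2_ext P4 => w s; rewrite mxE.
Qed.

Lemma poly2_chi j : poly2 (fun w s => chi w s 0 j).
Proof.
apply: poly2_row5; try exact: poly2_fst; try exact: poly2_snd; try exact: poly2_const.
apply: (poly2_ext (f := fun w s => fg.[w] * s ^+ 2)); first by move=> w s; rewrite fgE.
by apply: poly2M; [exact: poly2_fst|exact/poly2X/poly2_snd].
Qed.

Lemma poly2_psi j : poly2 (fun w s => psi w s 0 j).
Proof.
apply: poly2_row5; try exact: poly2_fst; try exact: poly2_snd; try exact: poly2_const.
apply: (poly2_ext (f := fun w s => fg.[w] * s ^+ 2)); first by move=> w s; rewrite fgE.
by apply: poly2M; [exact: poly2_fst|exact/poly2X/poly2_snd].
Qed.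

Local Notation P' := (fun w s => (al * fg).[w] * s + be.[w]).
Local Notation Q' := (fun w s => (ga * fg).[w] * s + de.[w]).

(** The coordinates of the two charts are related by [s' = 1 / (F s)]. *)
Lemma gen_y : generic (fun w s => Fr (psi w s) (P' w s * Q' w s) (P' w s ^+ 2)
  (Q' w s ^+ 2 * hg.[w])).
Proof.
apply: cofinS (cofinI gen_x (cofin_horner_neq0 fg_neq0)) => w [gw fw].
have fV : (fg.[w])^-1 != 0 by rewrite invr_neq0.
apply: cofinS (cofinI (cofin_div fV gw) (cofin_neq 0)) => s [E /eqP s0].
have d0 : fg.[w] * s ^+ 2 != 0 by rewrite mulf_neq0 ?expf_neq0.
have := Fr_torus5 (pts_chart_x _ (g_neq0 w)) (oner_neq0 K) d0 E.
have F0 : F g0.[w] g1.[w] != 0 by rewrite fgE.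
have := torus5_chart_xy F0 s0; rewrite fgE => <-; rewrite expr1n !mul1r.
have e0 : fg.[w] ^+ 2 * s ^+ 2 != 0 by rewrite mulf_neq0 ?expf_neq0.
move=> /(FrZ e0); congr Fr; rewrite !hornerM; field; rewrite ?fw ?s0 //.
Qed.

Lemma poly2_shift : poly2 (fun w _ => w - w0).
Proof. by apply: poly2_ext (poly2_fst ('X - w0%:P)) => w s; rewrite !hornerE. Qed.

Lemma shift_neq0 : exists w (s : K), w - w0 != 0.
Proof. by exists (w0 + 1), 0; rewrite addrC addKr oner_neq0. Qed.

Lemma x_eval (d c xi eta : K -> K -> K) s : poly2 d -> poly2 c -> poly2 xi -> poly2 eta ->
    (exists w s, d w s != 0) ->
    (forall w s, P w s * Q w s = d w s * c w s) ->
    (forall w s, P w s ^+ 2 = d w s * xi w s) ->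
    (forall w s, Q w s ^+ 2 * hg.[w] = d w s * eta w s) ->
    [|| c w0 s != 0, xi w0 s != 0 | eta w0 s != 0] ->
  Fr (chi w0 s) (c w0 s) (xi w0 s) (eta w0 s).
Proof.
move=> dP cP xiP etaP d0 cE xiE etaE nz.
apply: (@Fr_extend_factor chi d) => //; first exact: poly2_chi.
- by move=> w x; exact: pts_chart_x.
by apply: genericS gen_x => w x; rewrite cE xiE etaE.
Qed.

Lemma y_eval (d c xi eta : K -> K -> K) s : poly2 d -> poly2 c -> poly2 xi -> poly2 eta ->
    (exists w s, d w s != 0) ->
    (forall w s, P' w s * Q' w s = d w s * c w s) ->
    (forall w s, P' w s ^+ 2 = d w s * xi w s) ->
    (forall w s, Q' w s ^+ 2 * hg.[w] = d w s * eta w s) ->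
    [|| c w0 s != 0, xi w0 s != 0 | eta w0 s != 0] ->
  Fr (psi w0 s) (c w0 s) (xi w0 s) (eta w0 s).
Proof.
move=> dP cP xiP etaP d0 cE xiE etaE nz.
apply: (@Fr_extend_factor psi d) => //; first exact: poly2_psi.
- by move=> w x; exact: pts_chart_y.
by apply: genericS gen_y => w x; rewrite cE xiE etaE.
Qed.

Ltac poly2_tac := repeat first
  [exact: poly2_snd | exact: poly2_shift | exact: poly2_const | exact: poly2_fst
  | apply: poly2M | apply: poly2D | apply: poly2X].

Let z_neq0 := g_neq0 w0.

(** If [h] vanished, the image of the fibre would lie in one component,
    [eta = 0] or [xi = 0], of a reducible conic; if the determinant vanished,
    the image would lie in a point. In both cases the fibre of [T] would not
    be covered. *)
Lemma smooth_fibre : fg.[w0] != 0 ->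
    [|| al.[w0] != 0, be.[w0] != 0, ga.[w0] != 0 | de.[w0] != 0] ->
  hg.[w0] != 0 /\ (al * de - be * ga).[w0] != 0.
Proof.
move=> fw0 nz.
have noy (R : Prop) : F g0.[w0] g1.[w0] = 0 -> R.
  by rewrite fgE => f0; rewrite f0 eqxx in fw0.
have one2 : exists (w s : K), 1 != 0 :> K by exists 0, 0; rewrite oner_neq0.
have direct s : (P w0 s != 0) || (Q w0 s ^+ 2 * hg.[w0] != 0) ->
    Fr (chi w0 s) (P w0 s * Q w0 s) (P w0 s ^+ 2) (Q w0 s ^+ 2 * hg.[w0]).
  move=> PQ; apply: (@x_eval (fun _ _ => 1) (fun w s => P w s * Q w s)
    (fun w s => P w s ^+ 2) (fun w s => Q w s ^+ 2 * hg.[w])); try poly2_tac => //.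
  all: try by move=> *; rewrite mul1r.
  by rewrite sqrf_eq0 PQ orbT.
(* If [h] vanishes at [w0], the image of the chart is [(P Q, P^2, 0)]; if
   [P = (w - w0) P1] vanishes along the fibre too, division by [w - w0]
   gives [(P1 Q, 0, Q^2 k)] instead. *)
have hw0 : hg.[w0] != 0.
  apply/negP => /eqP h0; have [k hgk k0] := hg_simple h0.
  have [/andP[/eqP a0 /eqP b0]|ab0] := boolP ((al.[w0] == 0) && (be.[w0] == 0)); last first.
    apply: (@fibre_not_covered _ _ (fun=> 0) id [:: 0] z_neq0) => //; last exact: noy.
    - by move=> u _; rewrite mul0r hgE h0.
    - rewrite negb_and in ab0; apply: cofinS (cofin_lin ab0) => s Ps u; rewrite inE => u0.
      apply: (Fr_eta0 (pts_chart_x s z_neq0)) => //.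
      by have := direct s; rewrite Ps h0 mulr0; apply.
  have [al1 alE] := root_factor a0; have [be1 beE] := root_factor b0.
  move: nz; rewrite a0 b0 eqxx /= => cd0.
  apply: (@fibre_not_covered _ _ id (fun=> 0) [:: 0] z_neq0) => //; last exact: noy.
  - by move=> u _; rewrite mulr0 hgE h0.
  - apply: cofinS (cofin_lin cd0) => s Qs u; rewrite inE => u0.
    apply: (Fr_xi0 (pts_chart_x s z_neq0)) => //.
    have := @x_eval (fun w _ => w - w0) (fun w s => (al1.[w] + be1.[w] * s) * Q w s)
      (fun w s => (w - w0) * (al1.[w] + be1.[w] * s) ^+ 2) (fun w s => Q w s ^+ 2 * k.[w]) s.
    rewrite subrr mul0r; apply; try poly2_tac => //; try exact: shift_neq0.
    + by move=> w x; rewrite alE beE !(hornerM, hornerXsubC); ring.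
    + by move=> w x; rewrite alE beE !(hornerM, hornerXsubC); ring.
    + by move=> w x; rewrite hgk !(hornerM, hornerXsubC); ring.
    by rewrite [X in [|| _, _ | X]]mulf_neq0 ?orbT // sqrf_eq0.
split=> //; apply/negP; rewrite hornerD hornerN !hornerM subr_eq0 => /eqP det0.
(* The constant value of the degenerate Moebius map [P / Q]. *)
pose u1 := if ga.[w0] == 0 then be.[w0] / de.[w0] else al.[w0] / ga.[w0].
have u1E s : Q w0 s != 0 -> P w0 s = u1 * Q w0 s.
  rewrite /u1; have [g0'|g0'] := eqVneq ga.[w0] 0; last first.
    move=> _ /=; apply: (mulfI g0').
    transitivity (ga.[w0] * al.[w0] + be.[w0] * ga.[w0] * s); first by ring.
    by rewrite -det0; field.
  rewrite /= g0' add0r mulf_eq0 negb_or => /andP[d0 s0].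
  have a0 : al.[w0] = 0.
    by move/eqP: det0; rewrite g0' mulr0 mulf_eq0 (negPf d0) orbF => /eqP.
  by rewrite a0 add0r; field.
apply: (@fibre_not_covered _ _ id (fun u => hg.[w0] / u) [:: 0; u1] z_neq0) => //; last exact: noy.
- by move=> u; rewrite !inE negb_or hgE => /andP[u0 _]; rewrite mulrC divfK.
have PQnz : cofin (fun s => (P w0 s != 0) || (Q w0 s != 0)).
  case: (boolP ((al.[w0] != 0) || (be.[w0] != 0))) => [/cofin_lin|ab0].
    by apply: cofinS => s ->.
  move: nz; rewrite orbA (negPf ab0) => /cofin_lin.
  by apply: cofinS => s ->; rewrite orbT.
apply: cofinS PQnz => s nzs u; rewrite !inE negb_or => /andP[u0 uu1] E.
have E' : Fr (chi w0 s) (P w0 s * Q w0 s) (P w0 s ^+ 2) (Q w0 s ^+ 2 * hg.[w0]).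
  by apply: direct; rewrite mulf_eq0 (negPf hw0) orbF sqrf_eq0.
have [b b0 []] := Fr_prop (pts_chart_x s z_neq0) E E'; rewrite mulr1 => PQb P2 _.
have [Q0|Q0] := eqVneq (Q w0 s) 0.
  by move/eqP: b0; apply; rewrite -PQb Q0 mulr0.
move/eqP: uu1; apply; move: PQb P2; rewrite (u1E s Q0) => PQb P2.
apply: (mulfI b0); rewrite -P2 -PQb; ring.
Qed.

(** Two components of the fibre of [S] have to cover both components of the
    fibre of [T]. If [al] or [be] is nonzero, the first component goes to
    [eta = 0], and the second one has to cover [xi = 0], which forces the
    first alternative; otherwise the roles of [xi] and [eta] are exchanged. *)
Lemma reducible_fibre (k : {poly K}) : fg = ('X - w0%:P) * k -> k.[w0] != 0 ->
    hg.[w0] = 0 -> [|| al.[w0] != 0, be.[w0] != 0, ga.[w0] != 0 | de.[w0] != 0] ->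
  [/\ be.[w0] = 0, al.[w0] != 0 & de.[w0] != 0] \/
  exists al1 be1 de1, [/\ al = ('X - w0%:P) * al1, be = ('X - w0%:P) * be1,
    de = ('X - w0%:P) * de1, be1.[w0] != 0 & ga.[w0] != 0].
Proof.
move=> fgk k0 h0 nz; have [kap hgk kap0] := hg_simple h0.
have one2 : exists (w s : K), 1 != 0 :> K by exists 0, 0; rewrite oner_neq0.
have sh2 : exists (w s : K), (w - w0) ^+ 2 != 0.
  by have [w [s ws]] := shift_neq0; exists w, s; rewrite expf_neq0.
have sh3 : exists (w s : K), (w - w0) ^+ 3 != 0.
  by have [w [s ws]] := shift_neq0; exists w, s; rewrite expf_neq0.
have lin' (A B : K) : (A != 0) || (B != 0) -> cofin (fun s => A * s + B != 0).
  by rewrite orbC => /cofin_lin; apply: cofinS => s; rewrite addrC mulrC.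
have lin1 (A : K) : A != 0 -> cofin (fun s : K => A != 0) by move=> A0; apply: cofinT.
have horners := (hornerM, hornerXsubC).
have [/andP[/eqP a0 /eqP b0]|ab0] := boolP ((al.[w0] == 0) && (be.[w0] == 0)); last first.
  have cover : cofin (fun s => forall u, u \notin [:: 0] -> ~ Fr (psi w0 s) 1 0 u) -> False.
    move=> cy; apply: (@fibre_not_covered _ _ (fun=> 0) id [:: 0] z_neq0) => // [u _|].
      by rewrite mul0r hgE h0.
    rewrite negb_and in ab0; apply: cofinS (cofin_lin ab0) => s Ps u; rewrite inE => u0.
    apply: (Fr_eta0 (pts_chart_x s z_neq0)) => //.
    have := @x_eval (fun _ _ => 1) (fun w s => P w s * Q w s)
      (fun w s => P w s ^+ 2) (fun w s => Q w s ^+ 2 * hg.[w]) s.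
    rewrite h0 mulr0; apply; try poly2_tac => //; try by move=> *; rewrite mul1r.
    by rewrite sqrf_eq0 Ps orbT.
  have b0 : be.[w0] = 0.
    apply/eqP/negPn/negP => b0; apply: cover.
    apply: cofinS (lin1 _ b0) => s _ u; rewrite inE => u0.
    apply: (Fr_eta0 (pts_chart_y s z_neq0)) => //.
    have := @y_eval (fun _ _ => 1) (fun w s => P' w s * Q' w s)
      (fun w s => P' w s ^+ 2) (fun w s => Q' w s ^+ 2 * hg.[w]) s.
    rewrite h0 mulr0; apply; try poly2_tac => //; try by move=> *; rewrite mul1r.
    by rewrite sqrf_eq0 fgk !horners subrr mul0r mulr0 mul0r add0r b0 orbT.
  have a0 : al.[w0] != 0 by move: ab0; rewrite b0 eqxx andbT.
  left; split=> //; apply/negP => /eqP d0; apply: cover.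
  have [be1 beE] := root_factor b0; have [de1 deE] := root_factor d0.
  have ak : (al.[w0] * k.[w0] != 0) || (be1.[w0] != 0) by rewrite mulf_neq0.
  apply: cofinS (lin' _ _ ak) => s Ps u; rewrite inE => u0.
  apply: (Fr_eta0 (pts_chart_y s z_neq0)) => //.
  have := @y_eval (fun w _ => (w - w0) ^+ 2)
    (fun w s => (al.[w] * k.[w] * s + be1.[w]) * (ga.[w] * k.[w] * s + de1.[w]))
    (fun w s => (al.[w] * k.[w] * s + be1.[w]) ^+ 2)
    (fun w s => (w - w0) * ((ga.[w] * k.[w] * s + de1.[w]) ^+ 2 * kap.[w])) s.
  rewrite subrr mul0r; apply; try poly2_tac => //.
  - by move=> w x; rewrite fgk beE deE !horners; ring.
  - by move=> w x; rewrite fgk beE !horners; ring.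
  - by move=> w x; rewrite fgk deE hgk !horners; ring.
  by rewrite sqrf_eq0 Ps orbT.
right; have [al1 alE] := root_factor a0; have [be1 beE] := root_factor b0.
move: nz; rewrite a0 b0 eqxx /= => cd0.
have cover : cofin (fun s => forall u, u \notin [:: 0] -> ~ Fr (psi w0 s) 1 u 0) -> False.
  move=> cy; apply: (@fibre_not_covered _ _ id (fun=> 0) [:: 0] z_neq0) => // [u _|].
    by rewrite mulr0 hgE h0.
  apply: cofinS (cofin_lin cd0) => s Qs u; rewrite inE => u0.
  apply: (Fr_xi0 (pts_chart_x s z_neq0)) => //.
  have := @x_eval (fun w _ => w - w0) (fun w s => (al1.[w] + be1.[w] * s) * Q w s)
    (fun w s => (w - w0) * (al1.[w] + be1.[w] * s) ^+ 2) (fun w s => Q w s ^+ 2 * kap.[w]) s.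
  rewrite subrr mul0r; apply; try poly2_tac => //; try exact: shift_neq0.
  + by move=> w x; rewrite alE beE !horners; ring.
  + by move=> w x; rewrite alE beE !horners; ring.
  + by move=> w x; rewrite hgk !horners; ring.
  by rewrite [X in [|| _, _ | X]]mulf_neq0 ?orbT // sqrf_eq0.
have d0 : de.[w0] = 0.
  apply/eqP/negPn/negP => d0; apply: cover.
  apply: cofinS (lin1 _ d0) => s _ u; rewrite inE => u0.
  apply: (Fr_xi0 (pts_chart_y s z_neq0)) => //.
  have := @y_eval (fun w _ => w - w0) (fun w s => ((al1 * fg).[w] * s + be1.[w]) * Q' w s)
    (fun w s => (w - w0) * ((al1 * fg).[w] * s + be1.[w]) ^+ 2)
    (fun w s => Q' w s ^+ 2 * kap.[w]) s.
  rewrite subrr mul0r; apply; try poly2_tac => //; try exact: shift_neq0.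
  + by move=> w x; rewrite alE beE !horners; ring.
  + by move=> w x; rewrite alE beE !horners; ring.
  + by move=> w x; rewrite hgk !horners; ring.
  rewrite [X in [|| _, _ | X]]mulf_neq0 ?orbT // sqrf_eq0.
  by rewrite fgk !horners subrr mul0r mulr0 mul0r add0r.
have c0 : ga.[w0] != 0 by move: cd0; rewrite d0 eqxx orbF.
have [de1 deE] := root_factor d0; exists al1, be1, de1; split=> //.
apply/negP => /eqP b10; apply: cover; have [be2 be1E] := root_factor b10.
have ck : (ga.[w0] * k.[w0] != 0) || (de1.[w0] != 0) by rewrite mulf_neq0.
apply: cofinS (lin' _ _ ck) => s Qs u; rewrite inE => u0.
apply: (Fr_xi0 (pts_chart_y s z_neq0)) => //.
have := @y_eval (fun w _ => (w - w0) ^+ 3)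
  (fun w s => (al1.[w] * k.[w] * s + be2.[w]) * (ga.[w] * k.[w] * s + de1.[w]))
  (fun w s => (w - w0) * (al1.[w] * k.[w] * s + be2.[w]) ^+ 2)
  (fun w s => (ga.[w] * k.[w] * s + de1.[w]) ^+ 2 * kap.[w]) s.
rewrite subrr mul0r; apply; try poly2_tac => //.
- by move=> w x; rewrite fgk alE beE be1E deE !horners; ring.
- by move=> w x; rewrite fgk alE beE be1E !horners; ring.
- by move=> w x; rewrite fgk deE hgk !horners; ring.
by rewrite [X in [|| _, _ | X]]mulf_neq0 ?orbT // sqrf_eq0.
Qed.

End Local.

(** The polynomials [hz] and [hi] are [h] in the two affine coordinates of the
    base, and [Fr_local] says that the map is polynomial near a point whose
    image has [c != 0]. *)
Section Classification.
Hypotheses (l_gt0 : (0 < l)%N) (a_inj : injective a).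
Variables hz hi : {poly K}.
Hypotheses (hzE : forall z, h 1 z = hz.[z]) (hiE : forall w, h w 1 = hi.[w]).
Hypotheses (hz_simple : forall z, simple_root hz z) (hi_simple : forall w, simple_root hi w).
Hypotheses (hz_neq0 : hz != 0) (hz_size : (size hz <= (2 * l).+1)%N).
Hypothesis Fr_local : forall chi : K -> K -> coords S,
    (forall j, poly2 (fun z x => chi z x 0 j)) -> (forall z x, pts (chi z x)) ->
    (exists z x xi eta, Fr (chi z x) 1 xi eta) ->
  exists c xi eta : K -> K -> K, [/\ poly2 c, poly2 xi, poly2 eta,
    exists z x, c z x != 0 &
    generic (fun z x => Fr (chi z x) (c z x) (xi z x) (eta z x))].
Local Notation f := (fibre_poly a).

Definition fibre_poly_inf : {poly K} := \prod_i (1 - a i *: 'X).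

Lemma F_fst z : F 1 z = f.[z].
Proof.
by rewrite /root_form /fibre_poly horner_prod; apply: eq_bigr => i _; rewrite hornerXsubC mulr1.
Qed.

Lemma F_snd w : F w 1 = fibre_poly_inf.[w].
Proof.
by rewrite /root_form /fibre_poly_inf horner_prod; apply: eq_bigr => i _; rewrite !hornerE.
Qed.

Lemma fibre_poly_inf0 : fibre_poly_inf.[0] = 1.
Proof.
by rewrite /fibre_poly_inf horner_prod big1 // => i _; rewrite !hornerE ?mulr0 subr0.
Qed.

Lemma fibre_poly_neq0 : f != 0.
Proof. by rewrite monic_neq0 ?fibre_poly_monic. Qed.

Lemma fibre_poly_inf_neq0 : fibre_poly_inf != 0.
Proof.
by apply: contra_eq_neq fibre_poly_inf0 => ->; rewrite horner0 eq_sym oner_neq0.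
Qed.

Let one_neq0 (z : K) : (1 != 0 :> K) || (z != 0).
Proof. by rewrite oner_neq0. Qed.

Let fst_neq0 (z : K) : ((1 : {poly K}).[z] != 0) || ('X.[z] != 0).
Proof. by rewrite hornerC oner_neq0. Qed.

Let snd_neq0 (w : K) : ('X.[w] != 0) || ((1 : {poly K}).[w] != 0).
Proof. by rewrite hornerC oner_neq0 orbT. Qed.

(** The coordinate [xi / c] of the image is a rational function of [s] on the
    general fibre, and it is injective because the map is. *)
Lemma moebius_form : exists al be ga de : {poly K},
  [/\ al * de - be * ga != 0,
      forall z, [|| al.[z] != 0, be.[z] != 0, ga.[z] != 0 | de.[z] != 0] &
      generic (fun z s => Fr (chart_x 1 z s)
        ((al.[z] + be.[z] * s) * (ga.[z] + de.[z] * s)) ((al.[z] + be.[z] * s) ^+ 2)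
        ((ga.[z] + de.[z] * s) ^+ 2 * hz.[z]))].
Proof.
have chiP j : poly2 (fun z s => chart_x 1 z s 0 j).
  apply: poly2_row5; try exact: poly2_const; try exact: poly2_snd.
    by apply: poly2_ext (poly2_fst 'X) => z s; rewrite hornerX.
  apply: (poly2_ext (f := fun z s => f.[z] * s ^+ 2)); first by move=> z s; rewrite F_fst.
  by apply: poly2M; [exact: poly2_fst|exact/poly2X/poly2_snd].
have [z0 [f0 h0]] := cofin_ex (cofinI (cofin_horner_neq0 fibre_poly_neq0) (cofin_horner_neq0 hz_neq0)).
have [||c [xi [eta [cP xiP etaP [z1 [x1 c0]] gen]]]] := Fr_local chiP.
- by move=> z s; exact: pts_chart_x.
- apply: contrapT => none.
  apply: (@fibre_not_covered 1 z0 id (fun u => hz.[z0] / u) [:: 0] (one_neq0 z0)) => //.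
  + by move=> u; rewrite inE hzE => u0; rewrite mulrC divfK.
  + by apply: cofinT => s u _ E; apply: none; exists z0, s, u, (hz.[z0] / u).
  by rewrite F_fst => f00; rewrite f00 eqxx in f0.
have c_gen := poly2_neq0 cP c0.
have [[N NE] [M ME]] := (xiP, cP).
have [||al [be [ga [de [det0 NM]]]]] := @moebius_of_injective K N M.
- by exists z1, x1; rewrite -ME.
- apply: cofinS (cofinI (cofinI gen c_gen) (cofin_horner_neq0 hz_neq0)).
  move=> z [[genz cz] hz0]; have [s sP] := cofinI genz cz; exists s => x x'.
  move=> /sP[E cx] /sP[E' cx']; rewrite -!ME -!NE => xc.
  have normal t : Fr (chart_x 1 z t) (c z t) (xi z t) (eta z t) -> c z t != 0 ->
      Fr (chart_x 1 z t) 1 (xi z t / c z t) (hz.[z] / (xi z t / c z t)).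
    move=> Et ct; have cV : (c z t)^-1 != 0 by rewrite invr_neq0.
    have := FrZ cV Et; rewrite mulVf // => Et1.
    have := Fr_eq (pts_chart_x t (one_neq0 z)) Et1.
    rewrite /chart_x !coord_row5 expr1n mul1r hzE [_^-1 * xi z t]mulrC => xe.
    have x0 : xi z t / c z t != 0 by move: hz0; rewrite -xe mulf_eq0 negb_or => /andP[].
    by move: Et1; rewrite [_^-1 * xi z t]mulrC -xe [_ * (_ * eta z t)]mulrC mulfK.
  have E1 := normal x E cx; have E1' := normal x' E' cx'.
  have xcE : xi z x / c z x = xi z x' / c z x'.
    by apply/eqP; rewrite eqr_div // xc.
  rewrite -xcE in E1'.
  have [b [d []]] : same (chart_x 1 z x) (chart_x 1 z x').
    by apply: (Fr_inj _ _ (oner_neq0 K) _ _ E1 E1'); rewrite /chart_x ?coord_row5 //; exact: pts_chart_x.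
  move=> b0 d0 xx'; have := congr1 (fun v => coord v 0) xx'.
  have := congr1 (fun v => coord v 2) xx'; have := congr1 (fun v => coord v 4) xx'.
  rewrite /torus5 /chart_x !coord_row5 => x'E dE bE; rewrite x'E.
  by move: dE; rewrite -{1}[b]mulr1 -bE expr1n !mulr1 => <-; rewrite mul1r.
have [s [al1 [be1 [ga1 [de1 [_ [alE beE gaE deE] nz]]]]]] := quad_factor (fun=> True) det0.
set D := \prod_(c <- s) _ in alE beE gaE deE.
have detE : al * de - be * ga = D * D * (al1 * de1 - be1 * ga1).
  by rewrite alE beE gaE deE; ring.
move: det0; rewrite detE mulf_eq0 negb_or mulf_eq0 orbb => /andP[D0 det1].
exists al1, be1, ga1, de1; split=> // [z|]; first exact: nz.
have nzc (A B : {poly K}) : (A != 0) || (B != 0) -> generic (fun z s => A.[z] + B.[z] * s != 0).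
  move=> AB; have [z1' [s1 v1]] : exists z s, A.[z] + B.[z] * s != 0.
    case/orP: AB => /cofin_horner_neq0/cofin_ex[z Az].
      by exists z, 0; rewrite mulr0 addr0.
    have [A0|A0] := eqVneq A.[z] 0; last by exists z, 0; rewrite mulr0 addr0.
    by exists z, 1; rewrite A0 add0r mulr1.
  exact: poly2_neq0 (poly2_lin A B) v1.
have ab0 : (al1 != 0) || (be1 != 0).
  by apply: contraNT det1; rewrite negb_or !negbK => /andP[/eqP-> /eqP->]; rewrite !mul0r subrr.
have cd0 : (ga1 != 0) || (de1 != 0).
  by apply: contraNT det1; rewrite negb_or !negbK => /andP[/eqP-> /eqP->]; rewrite !mulr0 subrr.
apply: genericS (genericI (genericI gen c_gen) (genericI (generic1 (cofin_horner_neq0 D0))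
  (genericI (nzc _ _ ab0) (nzc _ _ cd0)))) => z x [[E cz] [Dz [Pz Qz]]].
set P := al1.[z] + _ in Pz *; set Q := ga1.[z] + _ in Qz *.
have := NM z x; rewrite -ME -NE gaE deE alE beE !hornerM.
have -> : D.[z] * ga1.[z] + D.[z] * de1.[z] * x = D.[z] * Q by rewrite /Q; ring.
have -> : D.[z] * al1.[z] + D.[z] * be1.[z] * x = D.[z] * P by rewrite /P; ring.
rewrite mulrCA [RHS]mulrCA => /(mulfI Dz) xQ.
have := Fr_eq (pts_chart_x x (one_neq0 z)) E; rewrite /chart_x !coord_row5 hzE => xe.
have m0 : P * Q / c z x != 0 by rewrite mulf_neq0 ?invr_neq0 ?mulf_neq0.
have xi0 : xi z x != 0.
  by apply: contraTneq (mulf_neq0 cz Pz) => xi0; rewrite -xQ xi0 mul0r eqxx.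
have := FrZ m0 E; congr (Fr _ _ _ _).
- by rewrite divfK.
- have -> : xi z x = c z x * P / Q by rewrite -xQ mulfK.
  by field; rewrite Qz cz.
apply: (mulfI xi0); transitivity (P * Q / c z x * (xi z x * eta z x)); first by ring.
rewrite xe; have -> : xi z x = c z x * P / Q by rewrite -xQ mulfK.
by field; rewrite Qz cz.
Qed.

(** In the coordinate [w = 1 / z] the matrix becomes, up to a power of [w],
    one without a common zero at [w = 0]. The fibre there is smooth, so its
    determinant does not vanish at [w = 0], which gives the degree of the
    original determinant. The shifts by [l] come from the transition function
    of the fibre coordinate. *)
Lemma matrix_at_infinity al be ga de : al * de - be * ga != 0 ->
    generic (fun z s => Fr (chart_x 1 z s)
        ((al.[z] + be.[z] * s) * (ga.[z] + de.[z] * s)) ((al.[z] + be.[z] * s) ^+ 2)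
        ((ga.[z] + de.[z] * s) ^+ 2 * hz.[z])) ->
  hi.[0] != 0 /\ exists k, [/\ size (al * de - be * ga) = (2 * k).+1,
    (size al <= k.+1)%N, (size de <= k.+1)%N, (size be <= (k + l).+1)%N &
    (size ga <= k.+1 - l)%N].
Proof.
move=> det0 gen; pose N := (l + size al + size be + size ga + size de)%N.
have [sal sbe sga sde] : [/\ (size al <= N.+1)%N, (size be <= (N + l).+1)%N,
    (size ga <= (N - l).+1)%N & (size de <= N.+1)%N] by split; rewrite /N; lia.
have lN : (l <= N)%N by rewrite /N; lia.
clearbody N.
(* The entries in the coordinate [w], with [N] large. The fibre coordinate
   at infinity is [s / z^l], which accounts for the degrees [N + l] and
   [N - l]. *)
pose al1 := rev_poly N al; pose be1 := rev_poly (N + l) be.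
pose ga1 := rev_poly (N - l) ga; pose de1 := rev_poly N de.
have sdet : (size (al * de - be * ga)%R <= (2 * N).+1)%N.
  rewrite (leq_trans (size_polyD _ _)) // size_polyN geq_max.
  by rewrite !(leq_trans (size_polyMleq _ _)) //; lia.
have detE : al1 * de1 - be1 * ga1 = rev_poly (2 * N) (al * de - be * ga).
  apply/eqP; rewrite -subr_eq0; apply/eqP/cofin_poly0; apply: cofinS (cofin_neq 0) => w /eqP w0.
  rewrite hornerD hornerN [(rev_poly _ _).[w]]horner_rev_poly //.
  rewrite !(hornerD, hornerN, hornerM) !horner_rev_poly //.
  have -> : w ^+ (2 * N) = w ^+ N * w ^+ N by rewrite -exprD addnn mul2n.
  have -> : w ^+ (N + l) = w ^+ N * w ^+ l by rewrite exprD.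
  have wN : w ^+ N = w ^+ l * w ^+ (N - l) by rewrite -exprD subnKC.
  by rewrite wN; ring.
have det1 : al1 * de1 - be1 * ga1 != 0.
  rewrite detE; apply: contra_neq det0 => det1; apply/eqP.
  rewrite -size_poly_leq0 -(subnn (2 * N).+1); apply: (size_rev_poly_factor (r := 0)) => //.
  by rewrite det1 mulr0.
have [s [al2 [be2 [ga2 [de2 [sZ]]]]]] := quad_factor (fun w => w = 0) det1.
have -> : \prod_(c <- s) ('X - c%:P) = 'X^(size s) :> {poly K}.
  elim: s sZ => [|c s IHs] sZ; first by rewrite big_nil expr0.
  rewrite big_cons IHs => [|c' c's]; last by apply: sZ; rewrite inE c's orbT.
  by rewrite (sZ c) ?mem_head // subr0 -exprS.
set j := size s; move=> [alE beE gaE deE] /(_ 0 erefl) nz.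
have gen2 : generic (fun w s => Fr (chart_x 'X.[w] (1 : {poly K}).[w] s)
    ((al2.[w] + be2.[w] * s) * (ga2.[w] + de2.[w] * s)) ((al2.[w] + be2.[w] * s) ^+ 2)
    ((ga2.[w] + de2.[w] * s) ^+ 2 * hi.[w])).
  have winv : cofin (fun w => cofin (fun s => Fr (chart_x 1 w^-1 s)
      ((al.[w^-1] + be.[w^-1] * s) * (ga.[w^-1] + de.[w^-1] * s))
      ((al.[w^-1] + be.[w^-1] * s) ^+ 2) ((ga.[w^-1] + de.[w^-1] * s) ^+ 2 * hz.[w^-1]))).
    have := cofin_div (oner_neq0 K) gen; apply: cofinS => w; by rewrite div1r.
  apply: cofinS (cofinI winv (cofin_neq 0)) => w [gw /eqP w0].
  have wl0 : w ^+ l != 0 by rewrite expf_neq0.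
  have scal : cofin (fun s => Fr (chart_x 1 w^-1 (w ^+ l * s))
      ((al.[w^-1] + be.[w^-1] * (w ^+ l * s)) * (ga.[w^-1] + de.[w^-1] * (w ^+ l * s)))
      ((al.[w^-1] + be.[w^-1] * (w ^+ l * s)) ^+ 2)
      ((ga.[w^-1] + de.[w^-1] * (w ^+ l * s)) ^+ 2 * hz.[w^-1])).
    apply: (cofin_comp _ gw) => c; apply: cofinS (cofin_neq (c / w ^+ l)) => s' s'c s'E.
    by apply: s'c; rewrite -s'E mulrC mulKf.
  apply: cofinS scal => s' E; rewrite hornerX hornerC.
  have wV : (w ^+ l)^-1 != 0 by rewrite invr_neq0.
  have := Fr_torus5 (pts_chart_x _ (one_neq0 _)) w0 wV E.
  have -> : torus5 l w (w ^+ l)^-1 (chart_x 1 w^-1 (w ^+ l * s')) = chart_x w 1 s'.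
    have FE : F w 1 = w ^+ l ^+ 2 * F 1 w^-1 by rewrite -root_formZ mulr1 mulfV.
    by apply: row5_eq; rewrite /torus5 /chart_x !coord_row5 ?FE; field; rewrite ?w0 ?wl0.
  have hE : hi.[w] = w ^+ l ^+ 2 * hz.[w^-1] by rewrite -hiE -hzE -h_hom mulr1 mulfV.
  (* The scale between the old triple and the new one. *)
  pose m := w ^+ N * w ^+ (N - l) / w ^+ j ^+ 2.
  have m0 : m != 0 by rewrite /m !mulf_neq0 ?invr_neq0 ?expf_neq0.
  have wj : w ^+ j != 0 by rewrite expf_neq0.
  have ew n (p r : {poly K}) : (size p <= n.+1)%N -> rev_poly n p = 'X^j * r ->
      r.[w] = w ^+ n * p.[w^-1] / w ^+ j.
    move=> sp E'; apply: (mulfI wj); rewrite -(horner_rev_poly sp w0) E' hornerM hornerXn.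
    by field.
  rewrite (ew _ _ _ sal alE) (ew _ _ _ sbe beE) (ew _ _ _ sga gaE) (ew _ _ _ sde deE) hE.
  have -> : w ^+ (N + l) = w ^+ N * w ^+ l by rewrite exprD.
  rewrite /m; have -> : w ^+ N = w ^+ l * w ^+ (N - l) by rewrite -exprD subnKC.
  by move=> /(FrZ m0); rewrite /m -[in w ^+ N](subnKC lN) exprD; congr Fr; field; rewrite wj.
have fi0 : fibre_poly_inf.[0] != 0 by rewrite fibre_poly_inf0 oner_neq0.
have [hi0 det20] := @smooth_fibre 'X 1 fibre_poly_inf hi al2 be2 ga2 de2 0 snd_neq0
  (fun w => etrans (congr2 _ (hornerX w) (hornerC 1 w)) (F_snd w))
  (fun w => etrans (congr2 _ (hornerX w) (hornerC 1 w)) (hiE w))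
  (@hi_simple 0) gen2 fi0 nz.
split=> //; have detE2 : rev_poly (2 * N) (al * de - be * ga) =
    'X^(j + j) * (al2 * de2 - be2 * ga2).
  by rewrite -detE alE beE gaE deE exprD; ring.
have [sdetE jN] := size_rev_poly_exact sdet detE2 det20.
exists (N - j)%N; split.
- by rewrite sdetE; congr (_.+1); lia.
- by apply: leq_trans (size_rev_poly_factor sal alE) _; lia.
- by apply: leq_trans (size_rev_poly_factor sde deE) _; lia.
- by apply: leq_trans (size_rev_poly_factor sbe beE) _; lia.
- by apply: leq_trans (size_rev_poly_factor sga gaE) _; lia.
Qed.

Lemma fibre_poly_root z : f.[z] = 0 -> exists i, z = a i.
Proof.
rewrite /fibre_poly horner_prod => /eqP/prodf_eq0[i _]; rewrite hornerXsubC subr_eq0 => /eqP ->.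
by exists i.
Qed.

Lemma fibre_poly_simple z : simple_root f z.
Proof.
have := @simple_root_prod K _ (fun i => 'X - (a i)%:P) 1 (oner_neq0 K).
rewrite scale1r; apply=> [j|j|j k w]; rewrite ?polyXsubC_eq0 ?size_XsubC // !hornerXsubC.
by move=> /eqP; rewrite subr_eq0 => /eqP -> /eqP; rewrite subr_eq0 => /eqP/a_inj.
Qed.

(** By [smooth_fibre], [h] vanishes at most at the [a i], and its zeros are
    simple, so by its degree it is a multiple of the fibre polynomial [F]. *)
Lemma generic_monomial : exists c1 c2 c3 : K, [/\ c1 != 0, c2 != 0, c3 != 0 &
  generic (fun z s => Fr (chart_x 1 z s) (c1 * s) c2 (c3 * (F 1 z * s ^+ 2))) \/
  generic (fun z s => Fr (chart_x 1 z s) (c1 * s) (c2 * (F 1 z * s ^+ 2)) c3)].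
Proof.
have [al [be [ga [de [det0 nz gen]]]]] := moebius_form.
have [hi0 [k [sdet sal sde sbe sga]]] := matrix_at_infinity det0 gen.
have gen1 : generic (fun w s => Fr (chart_x (1 : {poly K}).[w] 'X.[w] s)
    ((al.[w] + be.[w] * s) * (ga.[w] + de.[w] * s)) ((al.[w] + be.[w] * s) ^+ 2)
    ((ga.[w] + de.[w] * s) ^+ 2 * hz.[w])).
  by apply: genericS gen => z s; rewrite hornerC hornerX.
have fE w : F (1 : {poly K}).[w] 'X.[w] = f.[w] by rewrite hornerC hornerX F_fst.
have hE w : h (1 : {poly K}).[w] 'X.[w] = hz.[w] by rewrite hornerC hornerX hzE.
have smooth z := @smooth_fibre 1 'X f hz al be ga de z fst_neq0 fE hE (@hz_simple z) gen1.
have roots z : (hz.[z] = 0 \/ (al * de - be * ga).[z] = 0) -> exists i, z = a i.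
  move=> E; have [f0|f0] := eqVneq f.[z] 0; first exact: fibre_poly_root.
  by have [h0 d0] := smooth z f0 (nz z); case: E => E; [rewrite E eqxx in h0|rewrite E eqxx in d0].
have hiE' : rev_poly (2 * l) hz = 'X^0 * hi.
  apply/eqP; rewrite -subr_eq0; apply/eqP/cofin_poly0; apply: cofinS (cofin_neq 0) => w /eqP w0.
  rewrite expr0 mul1r hornerD hornerN horner_rev_poly // -hiE -hzE.
  have := h_hom w 1 w^-1; rewrite mulr1 mulfV // => ->.
  by rewrite -exprM [(l * 2)%N]mulnC subrr.
have [szh _] := size_rev_poly_exact hz_size hiE' hi0; rewrite subn0 in szh.
have hf : hz = lead_coef hz *: f.
  by apply: simple_roots_fibre_poly => // z z0; apply: roots; left.
have lh0 : lead_coef hz != 0 by rewrite lead_coef_eq0.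
set kap := lead_coef hz in hf lh0.
have loc i : [/\ be.[a i] = 0, al.[a i] != 0 & de.[a i] != 0] \/
    exists al1 be1 de1, [/\ al = ('X - (a i)%:P) * al1, be = ('X - (a i)%:P) * be1,
      de = ('X - (a i)%:P) * de1, be1.[a i] != 0 & ga.[a i] != 0].
  have fi0 : f.[a i] = 0.
    by rewrite /fibre_poly horner_prod (bigD1 i) //= hornerXsubC subrr mul0r.
  have [r fr r0] := fibre_poly_simple fi0.
  apply: (@reducible_fibre 1 'X f hz al be ga de (a i) fst_neq0 fE hE (@hz_simple _) _ gen1 r) => //.
    exact: fibre_poly_neq0.
  by rewrite hf hornerZ fi0 mulr0.
have det_roots z (dz : (al * de - be * ga).[z] = 0) := roots z (or_intror dz).
have [|] := monomial_matrix l_gt0 a_inj det_roots loc sdet sal sde sbe sga.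
  move=> [c [d [c0 d0 be0 ga0 [alE deE]]]].
  exists (c * d), (c ^+ 2), (d ^+ 2 * kap); split; rewrite ?mulf_neq0 ?expf_neq0 //; left.
  apply: genericS gen => z s; rewrite be0 ga0 alE deE horner0 !hornerC hf hornerZ F_fst.
  by congr Fr; ring.
move=> [c [d [c0 d0 al0 de0 [beE gaE]]]].
exists (c * d), (c ^+ 2), (d ^+ 2 * kap); split; rewrite ?mulf_neq0 ?expf_neq0 //; right.
apply: genericS (genericI gen (generic1 (cofin_horner_neq0 fibre_poly_neq0))) => z s [E fz].
have fV : (f.[z])^-1 != 0 by rewrite invr_neq0.
have := FrZ fV E; rewrite al0 de0 beE gaE horner0 !hornerC hf !hornerZ F_fst.
by congr Fr; field.
Qed.

Lemma chart_xZ b z0 z1 s : b != 0 ->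
  chart_x (b * z0) (b * z1) s = torus5 l b (b ^+ l)^-1 (chart_x z0 z1 (b ^+ l * s)).
Proof.
move=> b0; have bl : b ^+ l != 0 by rewrite expf_neq0.
by apply: row5_eq; rewrite /torus5 /chart_x !coord_row5 ?root_formZ //; field; rewrite bl.
Qed.

Lemma chart_yZ b z0 z1 s : b != 0 ->
  chart_y (b * z0) (b * z1) s = torus5 l b (b ^+ l)^-1 (chart_y z0 z1 (b ^+ l * s)).
Proof.
move=> b0; have bl : b ^+ l != 0 by rewrite expf_neq0.
by apply: row5_eq; rewrite /torus5 /chart_y !coord_row5 ?root_formZ //; field; rewrite bl.
Qed.

Section Monomial.
Variables (X Y : nat) (c1 c2 c3 : K).
Hypothesis XY : (X, Y) = (2, 3) \/ (X, Y) = (3, 2).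
Hypotheses (c10 : c1 != 0) (c20 : c2 != 0) (c30 : c3 != 0).
Let G p : Prop := Fr p (c1 * coord p 4) (c2 * coord p X) (c3 * coord p Y).

Lemma monomial_torus5 p b d : pts p -> b != 0 -> d != 0 -> G p -> G (torus5 l b d p).
Proof.
move=> Sp b0 d0 Gp; have := FrZ d0 (Fr_torus5 Sp b0 d0 Gp); rewrite /G.
by case: XY => -[-> ->]; rewrite /torus5 !coord_row5; congr Fr; ring.
Qed.

Lemma monomial_extend (chi : K -> K -> coords S) :
    (forall j, poly2 (fun z x => chi z x 0 j)) -> (forall z x, pts (chi z x)) ->
  generic (fun z x => G (chi z x)) -> forall z x, G (chi z x).
Proof.
move=> chiP chiS gen z x.
have cP c j : poly2 (fun z x => c * coord (chi z x) j).
  by apply: poly2M; [exact: poly2_const|exact: chiP].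
apply: (Fr_extend chiP (cP _ _) (cP _ _) (cP _ _)) => //; first by apply: genericS gen.
have [_ nz _] := chiS z x; rewrite !mulf_eq0 (negPf c10) (negPf c20) (negPf c30) /=.
by case: XY => -[-> ->]; case/or3P: nz => ->; rewrite ?orbT.
Qed.

Lemma poly2_chart_fst j : poly2 (fun z s => chart_x 1 z s 0 j) /\ poly2 (fun z s => chart_y 1 z s 0 j).
Proof.
have ZP : poly2 (fun z _ : K => z) by apply: poly2_ext (poly2_fst 'X) => z s; rewrite hornerX.
have FP : poly2 (fun z s => F 1 z * s ^+ 2).
  apply: (poly2_ext (f := fun z s => f.[z] * s ^+ 2)); first by move=> z s; rewrite F_fst.
  by apply: poly2M; [exact: poly2_fst|exact/poly2X/poly2_snd].
by split; apply: poly2_row5 => //; try exact: poly2_const; exact: poly2_snd.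
Qed.

Lemma poly2_chart_snd j : poly2 (fun w s => chart_x w 1 s 0 j) /\ poly2 (fun w s => chart_y w 1 s 0 j).
Proof.
have ZP : poly2 (fun z _ : K => z) by apply: poly2_ext (poly2_fst 'X) => z s; rewrite hornerX.
have FP : poly2 (fun w s => F w 1 * s ^+ 2).
  apply: (poly2_ext (f := fun z s => fibre_poly_inf.[z] * s ^+ 2)); first by move=> z s; rewrite F_snd.
  by apply: poly2M; [exact: poly2_fst|exact/poly2X/poly2_snd].
by split; apply: poly2_row5 => //; try exact: poly2_const; exact: poly2_snd.
Qed.

(** The formula extends from a dense open set to the whole surface, one chart
    at a time; a node of a reducible fibre is reached along its component
    [y = 0]. *)
Lemma monomial_everywhere : generic (fun z s => G (chart_x 1 z s)) ->
  forall p, pts p -> G p.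
Proof.
move=> gen; have one0 := one_neq0.
have zero1 (w : K) : (w != 0) || (1 != 0 :> K) by rewrite oner_neq0 orbT.
have gx : forall z s, G (chart_x 1 z s).
  apply: monomial_extend gen => [j|z s]; first by have [] := poly2_chart_fst j.
  exact: pts_chart_x.
have x_to_y z0 z1 s : (z0 != 0) || (z1 != 0) -> F z0 z1 != 0 -> s != 0 ->
    (forall s, G (chart_x z0 z1 s)) -> G (chart_y z0 z1 s).
  move=> z_neq0 F0 s0 gx'; rewrite torus5_chart_xy //; apply: monomial_torus5 => //.
  - exact: pts_chart_x.
  - exact: oner_neq0.
  - by rewrite mulf_neq0 ?expf_neq0.
have gy : forall z s, G (chart_y 1 z s).
  apply: monomial_extend => [j|z s|]; first by have [] := poly2_chart_fst j.
    exact: pts_chart_y.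
  apply: cofinS (cofin_horner_neq0 fibre_poly_neq0) => z fz.
  by apply: cofinS (cofin_neq 0) => s /eqP s0; apply: x_to_y; rewrite ?F_fst.
have gxi : forall w s, G (chart_x w 1 s).
  apply: monomial_extend => [j|z s|]; first by have [] := poly2_chart_snd j.
    exact: pts_chart_x.
  apply: cofinS (cofin_neq 0) => w /eqP w0; apply: cofinT => s.
  have := chart_xZ 1 w^-1 s w0; rewrite mulr1 mulfV // => ->.
  apply: monomial_torus5; rewrite ?invr_neq0 ?expf_neq0 //; exact: pts_chart_x.
have gyi : forall w s, G (chart_y w 1 s).
  apply: monomial_extend => [j|z s|]; first by have [] := poly2_chart_snd j.
    exact: pts_chart_y.
  apply: cofinS (cofin_horner_neq0 fibre_poly_inf_neq0) => z fz.
  by apply: cofinS (cofin_neq 0) => s /eqP s0; apply: x_to_y; rewrite ?F_snd.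
have zE z0 z1 : (z0 != 0) || (z1 != 0) ->
    (forall s, G (chart_x z0 z1 s)) /\ (forall s, G (chart_y z0 z1 s)).
  move=> z_neq0; have [z00|z00] := eqVneq z0 0; last first.
    have bl : (z0 ^+ l)^-1 != 0 by rewrite invr_neq0 ?expf_neq0.
    have z1E : z0 * (z1 / z0) = z1 by rewrite mulrCA divff // mulr1.
    split=> s.
      have := chart_xZ 1 (z1 / z0) s z00; rewrite mulr1 z1E => ->.
      by apply: monomial_torus5 => //; exact: pts_chart_x.
    have := chart_yZ 1 (z1 / z0) s z00; rewrite mulr1 z1E => ->.
    by apply: monomial_torus5 => //; exact: pts_chart_y.
  have z10 : z1 != 0 by move: z_neq0; rewrite z00 eqxx.
  have bl : (z1 ^+ l)^-1 != 0 by rewrite invr_neq0 ?expf_neq0.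
  rewrite z00; split=> s.
    have := chart_xZ 0 1 s z10; rewrite mulr1 mulr0 => ->.
    by apply: monomial_torus5 => //; exact: pts_chart_x.
  have := chart_yZ 0 1 s z10; rewrite mulr1 mulr0 => ->.
  by apply: monomial_torus5 => //; exact: pts_chart_y.
have gnode z0 z1 : (z0 != 0) || (z1 != 0) -> F z0 z1 = 0 -> G (node_pt z0 z1).
  move=> z_neq0 F0; pose chi (_ x : K) : coords S := row5 z0 z1 x 0 1.
  have chiS z x : pts (chi z x).
    by apply: pts_row5; rewrite ?oner_neq0 ?orbT // F0 !mulr0.
  apply: (@monomial_extend chi _ chiS _ 0 0).
    by apply: poly2_row5; try exact: poly2_const; exact: poly2_snd.
  apply: (generic2 (P := fun x => G (chi 0 x))); apply: cofinS (cofin_neq 0) => x /eqP x0.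
  have -> : chi 0 x = torus5 l 1 x (chart_x z0 z1 x^-1).
    by apply: row5_eq; rewrite /torus5 /chart_x !coord_row5 ?F0 ?expr1n //; field.
  by apply: monomial_torus5; rewrite ?oner_neq0 //; [exact: pts_chart_x|have [] := zE _ _ z_neq0].
move=> p Sp; have [z_neq0 _ _] := Sp; have [c c0 /= cp] := fibre_cases Sp.
have pE : p = torus5 l 1 c^-1 (torus5 l 1 c p).
  by apply: row5_eq; rewrite /torus5 !coord_row5 ?expr1n //; field.
rewrite pE; apply: monomial_torus5; rewrite ?invr_neq0 ?oner_neq0 //.
  by apply: pts_torus5; rewrite ?oner_neq0.
have [gx0 gy0] := zE _ _ z_neq0.
by case: cp => [[s ->]|[s ->]|[F0 ->]] //; exact: gnode.
Qed.

End Monomial.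

Lemma monomial_classification : exists c1 c2 c3 : K, [/\ c1 != 0, c2 != 0, c3 != 0 &
  (forall p, pts p -> Fr p (c1 * coord p 4) (c2 * coord p 2) (c3 * coord p 3)) \/
  (forall p, pts p -> Fr p (c1 * coord p 4) (c2 * coord p 3) (c3 * coord p 2))].
Proof.
have [c1 [c2 [c3 [c10 c20 c30 gen]]]] := generic_monomial; exists c1, c2, c3; split=> //.
case: gen => gen; [left|right].
  apply: (@monomial_everywhere 2 3) => //; first by left.
  by apply: genericS gen => z s; rewrite /chart_x !coord_row5 mulr1.
apply: (@monomial_everywhere 3 2) => //; first by right.
by apply: genericS gen => z s; rewrite /chart_x !coord_row5 mulr1.
Qed.

End Classification.

End FibrewiseMoebius.

(** * The map from S to T *)

Section MorphismToT.
Variable K : numClosedFieldType.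
Implicit Types (x y z w t b c : K).
Variables (g : nat) (a : 'I_(2 * g.+1) -> K).
Variables (J : finType) (r : J -> K) (q : {mpoly K[g.+2]}).
Hypotheses (cardJ : #|J| = g.+1.*2) (rinj : injective r) (qhom : q \is 2.-homog).
Hypothesis qE : forall z, q.@[fun i : 'I_g.+2 => z ^+ i] = - \prod_j (z - r j).
Local Notation l := g.+1.
Local Notation S := (conic_surface a).
Local Notation T := (hyperelliptic_surface q).
Variable f : coords S -> coords T.
Hypothesis f_mor : morphism f.
Hypothesis f_onto : forall v : coords T, pts v -> nonsingular_at 2 v ->
  exists2 p : coords S, pts p & same (f p) v.
Hypothesis f_inj : forall p p' : coords S, pts p -> pts p' ->
  nonsingular_at 2 (f p) -> nonsingular_at 2 (f p') -> same (f p) (f p') -> same p p'.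
Variables (m : coords (P1 K) -> coords (P1 K)) (A B C D : K).
Hypotheses (det0 : A * D - B * C != 0)
  (mE : forall x y, (x != 0) || (y != 0) ->
      @same _ (P1 K) (m (pt2 x y)) (pt2 (A * x + B * y) (C * x + D * y))).
Hypothesis f_conic : forall (p : coords S) (e : coords (P1 K)),
  pts p -> pts e -> conicT (f p) e -> @same _ (P1 K) (m (conicS p)) e.

Implicit Types (p : coords S) (xi eta : K).

(** The automorphism of the base that [f] covers is [(m0 : m1)]. *)
Definition m0 z0 z1 : K := A * z0 + B * z1.
Definition m1 z0 z1 : K := C * z0 + D * z1.

Definition conic_point c z0 z1 xi eta : 'rV[K]_g.+4 :=
  Tpoint g c (m0 z0 z1) (m1 z0 z1) xi eta.

Definition branch z0 z1 : K := branch_form r (m0 z0 z1) (m1 z0 z1).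

Definition image_coords (p : coords S) c xi eta : Prop :=
  @same _ T (f p) (conic_point c (coord p 0) (coord p 1) xi eta).

Lemma m_neq0 z0 z1 : (z0 != 0) || (z1 != 0) -> (m0 z0 z1 != 0) || (m1 z0 z1 != 0).
Proof.
apply: contraTT; rewrite !negb_or !negbK => /andP[/eqP e0 /eqP e1].
have e2 : (A * D - B * C) * z0 = D * m0 z0 z1 - B * m1 z0 z1 by rewrite /m0 /m1; ring.
have e3 : (A * D - B * C) * z1 = A * m1 z0 z1 - C * m0 z0 z1 by rewrite /m0 /m1; ring.
move/eqP: e2; move/eqP: e3; rewrite e0 e1 !mulr0 subrr !mulf_eq0 !(negPf det0) /=.
by move=> -> ->.
Qed.

Lemma conicS_pt2 (p : coords S) : conicS p = pt2 (coord p 0) (coord p 1).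
Proof. by rewrite [LHS]pt2_coord /coord /conicS !mxE !inordK. Qed.

Lemma conic_pointZ b c z0 z1 xi eta :
  b *: conic_point c z0 z1 xi eta = conic_point (b * c) z0 z1 (b * xi) (b * eta).
Proof. exact: TpointZ. Qed.

Lemma conic_point_inj c z0 z1 xi eta c' xi' eta' : (z0 != 0) || (z1 != 0) ->
  conic_point c z0 z1 xi eta = conic_point c' z0 z1 xi' eta' ->
  [/\ c = c', xi = xi' & eta = eta'].
Proof.
move=> /m_neq0 m_neq0 E; split.
- case/orP: m_neq0 => mz.
    have := congr1 (fun v => coord v 0) E.
    by rewrite /conic_point !coord_Tpoint // !expr0 !mulr1 => /(mulIf (expf_neq0 _ mz)).
  have := congr1 (fun v => coord v g.+1) E.
  by rewrite /conic_point !coord_Tpoint // subnn expr0 !mul1r => /(mulIf (expf_neq0 _ mz)).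
- by have := congr1 (@xiT _ _) E; rewrite !xiT_Tpoint.
- by have := congr1 (@etaT _ _) E; rewrite !etaT_Tpoint.
Qed.

Lemma conicT_conic_point c z0 z1 xi eta : (z0 != 0) || (z1 != 0) -> c != 0 ->
  conicT (conic_point c z0 z1 xi eta) (pt2 (m0 z0 z1) (m1 z0 z1)).
Proof.
move=> /m_neq0 m_neq0 c0; split; last first.
  by exists c; apply: over_line_Tpoint; rewrite coord_pt2.
case/orP: m_neq0 => mz.
  by exists ord0; rewrite coord_Tpoint // expr0 mulr1 mulf_neq0 ?expf_neq0.
by exists ord_max; rewrite coord_Tpoint // subnn expr0 mul1r mulf_neq0 ?expf_neq0.
Qed.

Lemma pts_conic_point c z0 z1 xi eta : (z0 != 0) || (z1 != 0) ->
  [|| c != 0, xi != 0 | eta != 0] -> xi * eta = c ^+ 2 * branch z0 z1 ->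
  @pts _ T (conic_point c z0 z1 xi eta).
Proof. by move=> /m_neq0 *; apply: (pts_Tpoint cardJ qhom qE). Qed.

(** Where [c = 0], at the two singular points of [T], the base coordinates of
    the image are arbitrary; elsewhere they are those prescribed by [f_conic]. *)
Lemma image_coords_ex p : pts p -> exists c xi eta,
  [/\ [|| c != 0, xi != 0 | eta != 0], xi * eta = c ^+ 2 * branch (coord p 0) (coord p 1) &
      image_coords p c xi eta].
Proof.
move=> Sp; have [fV _ _] := f_mor; have [z_neq0 _ _] := Sp.
have [c [e0 [e1 [xi [eta [e_neq0 nz xe fpE]]]]]] := pts_T cardJ qhom qE (fV p Sp).
have [c0|c0] := eqVneq c 0.
  exists 0, xi, eta; split; [by rewrite -{1}c0|by rewrite xe c0 !expr0n !mul0r|].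
  exists 1; rewrite ?oner_neq0 // fpE scale1r c0.
  by apply/rowP => j; rewrite !mxE !mul0r.
have : conicT (f p) (pt2 e0 e1).
  split; last by rewrite fpE; exists c; apply: over_line_Tpoint; rewrite coord_pt2.
  rewrite fpE; case/orP: e_neq0 => mz.
    by exists ord0; rewrite coord_Tpoint // expr0 mulr1 mulf_neq0 ?expf_neq0.
  by exists ord_max; rewrite coord_Tpoint // subnn expr0 mul1r mulf_neq0 ?expf_neq0.
have V2 : @pts _ (P1 K) (pt2 e0 e1) by split=> //; rewrite pt2_neq0.
move=> /(f_conic Sp V2); rewrite conicS_pt2 => me.
have := proj_trans (proj_sym (mE z_neq0)) me.
move=> [b b0]; rewrite pt2Z => /pt2_inj[e0E e1E].
exists (b ^+ g.+1 * c), xi, eta; split.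
- by rewrite mulf_eq0 expf_eq0 (negPf b0) andbF.
- by rewrite xe e0E e1E branch_formZ cardJ exprMn -exprM muln2; ring.
- by exists 1; rewrite ?oner_neq0 // scale1r fpE e0E e1E Tpoint_scale.
Qed.

Lemma image_coords_prop p c xi eta c' xi' eta' : pts p ->
  image_coords p c xi eta -> image_coords p c' xi' eta' ->
  exists2 b, b != 0 & [/\ c' = b * c, xi' = b * xi & eta' = b * eta].
Proof.
move=> [z_neq0 _ _] E E'; have [b b0] := proj_trans (proj_sym E) E'.
by rewrite conic_pointZ => /(conic_point_inj z_neq0); exists b.
Qed.

Lemma image_coordsZ p b c xi eta : b != 0 ->
  image_coords p c xi eta -> image_coords p (b * c) (b * xi) (b * eta).
Proof. by move=> b0 /proj_trans; apply; exists b => //; rewrite conic_pointZ. Qed.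

Lemma image_coords_torus5 p b d c xi eta : pts p -> b != 0 -> d != 0 ->
  image_coords p c xi eta ->
  image_coords (torus5 l b d p) c (b ^+ l * xi) (b ^+ l * eta).
Proof.
move=> Sp b0 d0 E; have [_ fs _] := f_mor.
have pp' := same_torus5 p b0 d0.
apply: (proj_trans (proj_sym (fs _ _ Sp (pts_torus5 b0 d0 Sp) pp'))).
apply: (proj_trans E); exists (b ^+ l); first exact: expf_neq0.
rewrite conic_pointZ /conic_point /torus5 !coord_row5.
have -> : m0 (b * coord p 0) (b * coord p 1) = b * m0 (coord p 0) (coord p 1).
  by rewrite /m0; ring.
have -> : m1 (b * coord p 0) (b * coord p 1) = b * m1 (coord p 0) (coord p 1).
  by rewrite /m1; ring.
by rewrite Tpoint_scale.
Qed.

Lemma nonsingular_image p c xi eta : pts p -> c != 0 -> image_coords p c xi eta ->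
  nonsingular_at 2 (f p).
Proof.
move=> Sp c0 /proj_sym[b b0 fpE]; have [z_neq0 _ _] := Sp; have [fV _ _] := f_mor.
have := fV p Sp; rewrite fpE conic_pointZ => Tp.
apply: (T_nonsingular cardJ qhom qE rinj Tp); first by rewrite mulf_neq0.
exact: m_neq0.
Qed.

(** A preimage exists by [f_onto]; its base coordinates are correct up to
    scale, because [f] covers an automorphism. *)
Lemma image_coords_onto z0 z1 c xi eta : (z0 != 0) || (z1 != 0) -> c != 0 ->
    xi * eta = c ^+ 2 * branch z0 z1 ->
  exists p, [/\ pts p, coord p 0 = z0, coord p 1 = z1 & image_coords p c xi eta].
Proof.
move=> z_neq0 c0 xe.
have Tv : @pts _ T (conic_point c z0 z1 xi eta) by apply: pts_conic_point; rewrite ?c0.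
have [p Sp pv] := f_onto Tv (T_nonsingular cardJ qhom qE rinj Tv c0 (m_neq0 z_neq0)).
have [pz_neq0 _ _] := Sp; have [_ fs _] := f_mor.
have [b b0 fpE] := proj_sym pv.
have Vm : pts (pt2 (m0 z0 z1) (m1 z0 z1) : coords (P1 K)).
  by split=> //; rewrite pt2_neq0; exact: m_neq0.
have := f_conic Sp Vm; rewrite fpE conic_pointZ conicS_pt2.
move=> /(_ (conicT_conic_point _ _ z_neq0 (mulf_neq0 b0 c0))) me.
have := proj_trans (proj_sym (mE pz_neq0)) me.
move=> [d d0]; rewrite pt2Z => /pt2_inj[].
rewrite -/(m0 _ _) -/(m1 _ _) => m0E m1E.
have z0E : z0 = d * coord p 0.
  apply: (mulfI det0); transitivity (D * m0 z0 z1 - B * m1 z0 z1); first by rewrite /m0 /m1; ring.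
  by rewrite m0E m1E /m0 /m1; ring.
have z1E : z1 = d * coord p 1.
  apply: (mulfI det0); transitivity (A * m1 z0 z1 - C * m0 z0 z1); first by rewrite /m0 /m1; ring.
  by rewrite m0E m1E /m0 /m1; ring.
have p'S := pts_torus5 d0 (oner_neq0 K) Sp.
have p0E : coord (torus5 l d 1 p) 0 = z0 by rewrite /torus5 coord_row5.
have p1E : coord (torus5 l d 1 p) 1 = z1 by rewrite /torus5 coord_row5.
exists (torus5 l d 1 p); split=> //; rewrite /image_coords p0E p1E.
apply: proj_trans pv; apply: proj_sym; apply: fs => //.
exact: (same_torus5 p d0 (oner_neq0 K)).
Qed.

Lemma image_coords_inj p p' c xi eta : pts p -> pts p' -> c != 0 ->
  coord p 0 = coord p' 0 -> coord p 1 = coord p' 1 ->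
  image_coords p c xi eta -> image_coords p' c xi eta -> same p p'.
Proof.
move=> Sp Sp' c0 e0 e1 E E'; apply: f_inj => //.
- exact: nonsingular_image E.
- exact: nonsingular_image E'.
by apply: proj_trans E _; rewrite e0 e1; apply: proj_sym.
Qed.

Lemma poly2_Tpoint (c z0 z1 xi eta : K -> K -> K) :
    poly2 c -> poly2 z0 -> poly2 z1 -> poly2 xi -> poly2 eta ->
  forall j, poly2 (fun z x => conic_point (c z x) (z0 z x) (z1 z x) (xi z x) (eta z x) 0 j).
Proof.
move=> cP z0P z1P xiP etaP j.
have lin u v : poly2 (fun z x => u * z0 z x + v * z1 z x).
  by apply: poly2D; apply: poly2M => //; exact: poly2_const.
rewrite /conic_point /Tpoint; case: (boolP (j < g.+2)%N) => jg.
  apply: (poly2_ext (f := fun z x => c z x * (m0 (z0 z x) (z1 z x) ^+ (g.+1 - j) *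
    m1 (z0 z x) (z1 z x) ^+ j))); first by move=> z x; rewrite mxE jg.
  by apply: poly2M => //; apply: poly2M; apply: poly2X; exact: lin.
have [jE|jE] := eqVneq (j : nat) g.+2.
  apply: (poly2_ext (f := fun z x => (xi z x - eta z x) * (2 * 'i)^-1)).
    by move=> z x; rewrite mxE (negPf jg) jE eqxx.
  by apply: poly2M; [exact: poly2B|exact: poly2_const].
apply: (poly2_ext (f := fun z x => (xi z x + eta z x) * 2^-1)).
  by move=> z x; rewrite mxE (negPf jg) (negPf jE).
by apply: poly2M; [exact: poly2D|exact: poly2_const].
Qed.

Lemma image_coords_extend (chi : K -> K -> coords S) (c xi eta : K -> K -> K) z x :
    (forall j, poly2 (fun z x => chi z x 0 j)) -> poly2 c -> poly2 xi -> poly2 eta ->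
    generic (fun z x => pts (chi z x) /\
      image_coords (chi z x) (c z x) (xi z x) (eta z x)) ->
    pts (chi z x) -> [|| c z x != 0, xi z x != 0 | eta z x != 0] ->
  image_coords (chi z x) (c z x) (xi z x) (eta z x).
Proof.
move=> chiP cP xiP etaP gen Sp nz; have [z_neq0 _ _] := Sp.
apply: (morphism_extend (Phi := fun z x =>
  conic_point (c z x) (coord (chi z x) 0) (coord (chi z x) 1) (xi z x) (eta z x))
  f_mor chiP _ gen Sp); first by apply: poly2_Tpoint => //; exact: chiP.
by apply: Tpoint_neq0 => //; exact: m_neq0.
Qed.

Lemma branch_hom b z0 z1 : branch (b * z0) (b * z1) = b ^+ l ^+ 2 * branch z0 z1.
Proof.
rewrite /branch -exprM muln2 -cardJ -branch_formZ; congr branch_form.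
  by rewrite /m0; ring.
by rewrite /m1; ring.
Qed.

Lemma image_coords_eq p c xi eta : pts p -> image_coords p c xi eta ->
  xi * eta = c ^+ 2 * branch (coord p 0) (coord p 1).
Proof.
move=> Sp E.
have [c' [xi' [eta' [nz xe E']]]] := image_coords_ex Sp.
have [b b0 [-> -> ->]] := image_coords_prop Sp E' E.
by rewrite mulrACA xe; ring.
Qed.

Definition branch_fst : {poly K} :=
  (-1) *: \prod_j ((C - r j * A)%:P + (D - r j * B) *: 'X).
Definition branch_snd : {poly K} :=
  (-1) *: \prod_j ((D - r j * B)%:P + (C - r j * A) *: 'X).

Lemma branch_fstE z : branch 1 z = branch_fst.[z].
Proof.
rewrite /branch /branch_form /branch_fst hornerZ horner_prod mulN1r; congr (- _).
by apply: eq_bigr => j _; rewrite !hornerE /m0 /m1; ring.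
Qed.

Lemma branch_sndE w : branch w 1 = branch_snd.[w].
Proof.
rewrite /branch /branch_form /branch_snd hornerZ horner_prod mulN1r; congr (- _).
by apply: eq_bigr => j _; rewrite !hornerE /m0 /m1; ring.
Qed.

Lemma size_lin (u v : K) : (size (u%:P + v *: 'X)%R <= 2)%N.
Proof.
rewrite (leq_trans (size_polyD _ _)) // geq_max (leq_trans (size_polyC_leq1 _)) //.
by rewrite (leq_trans (size_scale_leq _ _)) ?size_polyX.
Qed.

Lemma branch_factor_neq0 j : (C - r j * A != 0) || (D - r j * B != 0).
Proof.
apply: contraTT det0; rewrite negb_or !negbK !subr_eq0 => /andP[/eqP -> /eqP ->].
by apply/eqP; ring.
Qed.

Lemma branch_factor_inj j k z0 z1 : (z0 != 0) || (z1 != 0) ->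
  m1 z0 z1 - r j * m0 z0 z1 = 0 -> m1 z0 z1 - r k * m0 z0 z1 = 0 -> j = k.
Proof.
move=> /m_neq0 nz /eqP; rewrite subr_eq0 => /eqP jE /eqP; rewrite subr_eq0 jE => /eqP jk.
apply: rinj; have m00 : m0 z0 z1 != 0.
  by apply: contraTneq nz => m00; rewrite jE m00 mulr0 eqxx.
exact: (mulIf m00).
Qed.

Lemma branch_fst_simple z : simple_root branch_fst z.
Proof.
apply: simple_root_prod => [|j|j|j k {}z]; rewrite ?oppr_eq0 ?oner_neq0 //.
- exact/lin_neq0/branch_factor_neq0.
- exact: size_lin.
rewrite !hornerE => j0 k0; apply: (@branch_factor_inj j k 1 z); rewrite ?oner_neq0 //.
  by rewrite -j0 /m0 /m1; ring.
by rewrite -k0 /m0 /m1; ring.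
Qed.

Lemma branch_snd_simple z : simple_root branch_snd z.
Proof.
apply: simple_root_prod => [|j|j|j k {}z]; rewrite ?oppr_eq0 ?oner_neq0 //.
- by apply: lin_neq0; rewrite orbC; exact: branch_factor_neq0.
- exact: size_lin.
rewrite !hornerE => j0 k0; apply: (@branch_factor_inj j k z 1); rewrite ?oner_neq0 ?orbT //.
  by rewrite -j0 /m0 /m1; ring.
by rewrite -k0 /m0 /m1; ring.
Qed.

Lemma branch_fst_neq0 : branch_fst != 0.
Proof.
rewrite scaler_eq0 negb_or oppr_eq0 oner_neq0; apply/prodf_neq0 => j _.
exact/lin_neq0/branch_factor_neq0.
Qed.

Lemma size_branch_fst : (size branch_fst <= (2 * l).+1)%N.
Proof.
rewrite (leq_trans (size_scale_leq _ _)) // (leq_trans (size_prod_leq _ _)) //.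
rewrite leq_subLR -/(#|J|) cardJ.
have -> : (g.+1.*2 + (2 * g.+1).+1 = (2 * g.+1.*2).+1)%N by lia.
rewrite ltnS -cardJ mulnC -sum_nat_const; apply: leq_sum => j _; exact: size_lin.
Qed.

(** A morphism is polynomial near a point. The coordinate [k] of its
    polynomial representative, divided by the corresponding monomial in [m0]
    and [m1], is the scale [c]; multiplication by that monomial, [M], clears
    the denominator. *)
Lemma image_coords_local (chi : K -> K -> coords S) :
    (forall j, poly2 (fun z x => chi z x 0 j)) -> (forall z x, pts (chi z x)) ->
    (exists z x xi eta, image_coords (chi z x) 1 xi eta) ->
  exists c xi eta : K -> K -> K, [/\ poly2 c, poly2 xi, poly2 eta,
    exists z x, c z x != 0 &
    generic (fun z x => image_coords (chi z x) (c z x) (xi z x) (eta z x))].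
Proof.
move=> chiP chiS [z0 [x0 [xi0 [eta0 E0]]]]; have [_ _ floc] := f_mor.
have [G [H H0 GE]] := floc _ (chiS z0 x0).
pose Gv z x : 'rV[K]_g.+4 := \row_j (G j).@[chi z x 0].
have GP j : poly2 (fun z x => Gv z x 0 j).
  by apply: poly2_ext (poly2_meval (G j) chiP) => z x; rewrite mxE.
have HP := poly2_meval H chiP.
have linP u v : poly2 (fun z x => u * coord (chi z x) 0 + v * coord (chi z x) 1).
  by apply: poly2D; apply: poly2M; try exact: poly2_const; exact: chiP.
have [k [M [kg MP M0 kE]]] : exists k (M : K -> K -> K), [/\ (k < g.+2)%N, poly2 M, M z0 x0 != 0 &
    forall z x c xi eta, coord (conic_point c (coord (chi z x) 0) (coord (chi z x) 1) xi eta) k =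
      c * M z x].
  have [z_neq0 _ _] := chiS z0 x0; case/orP: (m_neq0 z_neq0) => m_neq0.
    exists 0%N, (fun z x => m0 (coord (chi z x) 0) (coord (chi z x) 1) ^+ g.+1); split=> //.
    - by apply: poly2X; exact: linP.
    - by rewrite expf_neq0.
    - by move=> z x c xi eta; rewrite coord_Tpoint // subn0 expr0 mulr1.
  exists g.+1, (fun z x => m1 (coord (chi z x) 0) (coord (chi z x) 1) ^+ g.+1); split=> //.
  - by apply: poly2X; exact: linP.
  - by rewrite expf_neq0.
  - by move=> z x c xi eta; rewrite coord_Tpoint // subnn expr0 mul1r.
have xiP : poly2 (fun z x => xiT (Gv z x)).
  by apply: poly2D; [exact: GP|apply: poly2M; [exact: poly2_const|exact: GP]].
have etaP : poly2 (fun z x => etaT (Gv z x)).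
  by apply: poly2B; [exact: GP|apply: poly2M; [exact: poly2_const|exact: GP]].
have Gcoords z x c xi eta : H.@[chi z x 0] != 0 -> image_coords (chi z x) c xi eta ->
    exists2 b, b != 0 & [/\ coord (Gv z x) k = b * c * M z x, xiT (Gv z x) = b * xi &
      etaT (Gv z x) = b * eta].
  move=> Hzx E; have [b b0] := proj_trans (proj_sym E) (GE _ (chiS z x) Hzx).
  rewrite conic_pointZ -/(Gv z x) => GvE; exists b => //.
  by rewrite GvE kE /conic_point xiT_Tpoint etaT_Tpoint.
exists (fun z x => coord (Gv z x) k), (fun z x => M z x * xiT (Gv z x)),
  (fun z x => M z x * etaT (Gv z x)); split.
- exact: GP.
- exact: poly2M.
- exact: poly2M.
- exists z0, x0; have [b b0 [-> _ _]] := Gcoords _ _ _ _ _ H0 E0.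
  by rewrite mulr1 mulf_neq0.
apply: genericS (genericI (poly2_neq0 HP H0) (poly2_neq0 MP M0)) => z x [Hzx Mzx].
have [c [xi [eta [nz xe E]]]] := image_coords_ex (chiS z x).
have [b b0 [-> -> ->]] := Gcoords _ _ _ _ _ Hzx E.
have Mb : M z x * b != 0 by rewrite mulf_neq0.
by have := image_coordsZ Mb E; congr image_coords; ring.
Qed.

Theorem morphism_classification : injective a -> exists c1 c2 c3 : K,
  [/\ c1 != 0, c2 != 0, c3 != 0 &
  (forall p, pts p -> image_coords p (c1 * coord p 4) (c2 * coord p 2) (c3 * coord p 3)) \/
  (forall p, pts p -> image_coords p (c1 * coord p 4) (c2 * coord p 3) (c3 * coord p 2))].
Proof.
move=> a_inj.
apply: (@monomial_classification _ _ a image_coords branch branch_hom image_coords_eq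
  _ _ _ _ _ _ isT a_inj branch_fst branch_snd).
- by move=> p c xi eta c' xi' eta' Sp E E'; exact: (image_coords_prop Sp E E').
- exact: image_coordsZ.
- exact: image_coords_torus5.
- move=> z0 z1 c xi eta nz c0 xe.
  exact: image_coords_onto.
- move=> p p' c xi eta Sp Sp' c0 e0 e1 E E'.
  exact: image_coords_inj E E'.
- by move=> *; apply: image_coords_extend.
- exact: branch_fstE.
- exact: branch_sndE.
- exact: branch_fst_simple.
- exact: branch_snd_simple.
- exact: branch_fst_neq0.
- exact: size_branch_fst.
- exact: image_coords_local.
Qed.

End MorphismToT.

(** * The equation of a twistor line *)

Section Twistor.

Variable K : numClosedFieldType.

(** A function on the source of the quadratic map [z / u] that is invariant
    under its deck involution [u -> ka / u] comes from the target. The proof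
    subtracts a multiple of the top power of [z]; by symmetry the rest
    vanishes at 0, and is [u] times an invariant of lower degree. *)
Lemma invariant_poly (A b ka : K) (z : {poly K}) n (N : {poly K}) :
    A != 0 -> ka != 0 -> z = A *: 'X^2 + b *: 'X + (ka * A)%:P ->
    (size N <= (2 * n).+1)%N ->
    (forall u, u != 0 -> N.[ka / u] * u ^+ (2 * n) = ka ^+ n * N.[u]) ->
  exists p : nat -> K, N = \sum_(j < n.+1) p j *: (z ^+ j * 'X^(n - j)).
Proof.
move=> A0 ka0 zE; elim: n N => [|n IHn] N sN Nsym.
  exists (fun=> N.[0]); rewrite big_ord1 expr0 mul1r subn0 expr0 alg_polyC.
  by rewrite [LHS]size1_polyC ?horner_coef0 // (leq_trans sN).
have zsym u : u != 0 -> z.[ka / u] * u ^+ 2 = ka * z.[u].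
  by move=> u0; rewrite zE !(hornerD, hornerZ, hornerXn, hornerX, hornerC); field.
have sz : size z = 3%N.
  have zE' : z = Poly [:: ka * A; b; A].
    by rewrite zE /= !cons_poly_def -!mul_polyC; ring.
  by rewrite zE' (PolyK (c := 0)).
have lz : lead_coef z = A.
  by rewrite lead_coefE sz zE !(coefD, coefZ, coefXn, coefX, coefC) /= mulr1 mulr0 !addr0.
have sze m : size (z ^+ m) = (2 * m).+1.
  rewrite -[LHS]prednK ?size_exp ?sz // size_poly_gt0 expf_neq0 //.
  by rewrite -lead_coef_eq0 lz.
have zlead m : (z ^+ m)`_(2 * m) = A ^+ m.
  by rewrite -lz -lead_coef_exp lead_coefE sze.
pose c := N`_(2 * n.+1) / A ^+ n.+1; pose N1 := N - c *: z ^+ n.+1.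
have An : A ^+ n.+1 != 0 by rewrite expf_neq0.
have sN1 : (size N1 <= 2 * n.+1)%N.
  apply/leq_sizeP => j; rewrite leq_eqVlt => /predU1P[<-|jn].
    by rewrite coefB coefZ zlead divfK // subrr.
  rewrite coefB coefZ !nth_default ?mulr0 ?subrr ?sze //.
  exact: leq_trans jn.
have N1sym u : u != 0 -> N1.[ka / u] * u ^+ (2 * n.+1) = ka ^+ n.+1 * N1.[u].
  move=> u0; rewrite !(hornerD, hornerN, hornerZ, horner_exp).
  have e : z.[ka / u] ^+ n.+1 * u ^+ (2 * n.+1) = ka ^+ n.+1 * z.[u] ^+ n.+1.
    by rewrite exprM -exprMn zsym // exprMn.
  by rewrite mulrBl Nsym // -mulrA e; ring.
have NE : N = N1 + c *: z ^+ n.+1 by rewrite subrK.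
clearbody N1.
(* By symmetry the constant term is a multiple of the coefficient of degree
   [2 n + 2], which has been removed. *)
have N10 : N1.[0] = 0.
  pose m := (2 * n.+1)%N; pose P := \poly_(i < m.+1) (N1`_i * ka ^+ i) : {poly K}.
  have revP : rev_poly m P - ka ^+ n.+1 *: N1 = 0.
    apply: cofin_poly0; apply: cofinS (cofin_neq 0) => w /eqP w0.
    rewrite !(hornerD, hornerN, hornerZ) horner_rev_poly ?size_poly // -N1sym // -/m.
    rewrite [X in X - _]mulrC; apply/eqP; rewrite subr_eq0; apply/eqP; congr (_ * _).
    rewrite horner_poly (@horner_coef_wide _ m.+1) ?(leq_trans sN1) //.
    by apply: eq_bigr => i _; rewrite expr_div_n exprVn mulrA.
  have := congr1 (fun q : {poly K} => q.[0]) revP.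
  rewrite !(hornerD, hornerN, hornerZ) horner_coef0 coef_poly subn0 /= coef_poly ltnSn.
  rewrite [N1`_m]nth_default // mul0r add0r horner0 => /eqP.
  by rewrite oppr_eq0 mulf_eq0 expf_eq0 (negPf ka0) andbF /= => /eqP.
have /factor_theorem[N2 N2E] : root N1 0 by rewrite rootE N10.
rewrite subr0 in N2E.
have sN2 : (size N2 <= (2 * n).+1)%N.
  have [->|N20] := eqVneq N2 0; first by rewrite size_poly0.
  by move: sN1; rewrite N2E size_mulX // => sN1'; rewrite -ltnS; apply: leq_trans sN1' _; lia.
have [u u0|p pE] := IHn N2 sN2.
  have := N1sym u u0; rewrite N2E !hornerMX => E.
  have kau : ka * u != 0 by rewrite mulf_neq0.
  apply: (mulfI kau); transitivity (N2.[ka / u] * (ka / u) * u ^+ (2 * n.+1)); last first.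
    by rewrite E exprS; ring.
  by have -> : (2 * n.+1 = (2 * n).+2)%N by [lia]; rewrite !exprS; field.
exists (fun j => if j == n.+1 then c else p j).
rewrite big_ord_recr /= eqxx subnn expr0 mulr1.
rewrite NE; congr (_ + _); rewrite N2E pE mulr_suml; apply: eq_bigr => j _.
rewrite ltn_eqF ?ltn_ord // -scalerAl -mulrA -exprSr subSn //; exact: (ltn_ord j).
Qed.

(** Reality maps the roots [g] of [x] to those of [y] by [g -> - 1 / g^*], and
    positivity makes [z_2 g] real, where this is [g -> ka / g]. So the
    involution [u -> ka / u] exchanges the roots of [x] with those of [y], and
    a combination of [x] and [y] is a polynomial in [z / u]. Positivity also
    excludes a root common to both: [g g' = ka] would make [z_2 g z_2 g']
    negative. This gives the last clause, that [y / u^l] takes different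
    values at the two points of a general fibre. *)
Lemma twistor_equation l (a : 'I_(2 * l) -> K) (x y z : {poly K}) :
    (0 < l)%N -> (size x <= (2 * l).+1)%N -> (size y <= (2 * l).+1)%N -> (size z <= 3)%N ->
    x * y = \prod_i (z - a i *: 'X) ->
    (forall u : K, u != 0 -> x.[- (u^* )^-1] = (y.[u])^* / u^* ^+ (2 * l) /\
       z.[- (u^* )^-1] = - (z.[u])^* / u^* ^+ 2) ->
    z`_2 != 0 -> (forall g : K, root x g -> 0 < z`_2 * g) ->
  exists (ka k : K) (p : nat -> K), [/\ ka != 0, k != 0,
    forall u : K, u != 0 -> z.[ka / u] * u ^+ 2 = ka * z.[u],
    forall u, x.[u] + k * y.[u] = \sum_(j < l.+1) p j * (z.[u] ^+ j * u ^+ (l - j)) &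
    cofin (fun u => y.[ka / u] / (ka / u) ^+ l <> y.[u] / u ^+ l)].
Proof.
move=> l0 sx sy sz xyE real; set A := z`_2 => A0 xpos.
have Ac0 : A^* != 0 by rewrite fmorph_eq0.
pose ka := - A^* / A; have ka0 : ka != 0 by rewrite mulf_neq0 ?oppr_eq0 ?invr_neq0.
pose b := z`_1.
have [z0 zE0] : exists z0, z = A *: 'X^2 + b *: 'X + z0%:P.
  exists z`_0; apply/polyP => i; rewrite !(coefD, coefZ, coefXn, coefX, coefC).
  case: i => [|[|[|i]]] /=; rewrite ?mulr0 ?mulr1 ?addr0 ?add0r //.
  by rewrite nth_default // (leq_trans sz).
have z0E : z0 = ka * A.
  have : (z0 + A^* ) *: 'X^2 + (b^* - b) *: 'X + (A + z0^* )%:P = 0 :> {poly K}.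
    apply: cofin_poly0; apply: cofinS (cofin_neq 0) => v /eqP v0.
    have vc0 : v^* != 0 by rewrite fmorph_eq0.
    have [_ E] := real _ vc0; move: E; rewrite conjCK {1 2}zE0.
    rewrite !(hornerD, hornerZ, hornerXn, hornerX, hornerC) !(rmorphD, rmorphM, rmorphXn) /= conjCK.
    move=> E; apply: (mulfI (expf_neq0 2 (invr_neq0 v0))); rewrite mulr0.
    transitivity ((A * (- v^-1) ^+ 2 + b * - v^-1 + z0) -
      (- (A^* * v ^+ 2 + b^* * v + z0^* ) / v ^+ 2)); first by field.
    by rewrite E expr2 subrr.
  move=> /(congr1 (fun q : {poly K} => q`_2)); rewrite !(coefD, coefZ, coefXn, coefX, coefC) /=.
  rewrite mulr1 mulr0 !addr0 ?coef0 => /eqP; rewrite addr_eq0 => /eqP ->.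
  by rewrite /ka divfK.
have zE : z = A *: 'X^2 + b *: 'X + (ka * A)%:P by rewrite -z0E.
have zinv u : u != 0 -> z.[ka / u] * u ^+ 2 = ka * z.[u].
  by move=> u0; rewrite zE !(hornerD, hornerZ, hornerXn, hornerX, hornerC); field.
have sfac i : size (z - a i *: 'X) = 3%N.
  have -> : z - a i *: 'X = Poly [:: ka * A; b - a i; A].
    by rewrite zE /= !cons_poly_def -!mul_polyC polyCB; ring.
  by rewrite (PolyK (c := 0)).
have fac0 i : z - a i *: 'X != 0 by rewrite -size_poly_gt0 sfac.
have xy0 : x * y != 0 by rewrite xyE; apply/prodf_neq0 => i _.
have [x0 y0] : x != 0 /\ y != 0.
  by move: xy0; rewrite mulf_eq0 negb_or => /andP[].
have sxE : size x = (2 * l).+1.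
  have : size (x * y) = (4 * l).+1.
    rewrite xyE size_prod // (eq_bigr (fun=> 3%N)) // sum_nat_const card_ord; lia.
  rewrite size_mul // => sxy; apply/eqP; rewrite eqn_leq sx /=.
  have := sy; have := sxy; move: (size x) (size y) => n1 n2; lia.
have [gs xE] := closed_field_poly_normal x.
set c := lead_coef x in xE; have c0 : c != 0 by rewrite lead_coef_eq0.
have sgs : size gs = (2 * l)%N.
  by apply/eqP; rewrite -eqSS -size_root_prod -(size_scale _ c0) -xE sxE.
have gpos g : g \in gs -> 0 < A * g.
  by move=> ggs; apply: xpos; rewrite xE rootZ // root_prod_XsubC.
have gconj g : g \in gs -> g^* = - (g / ka).
  move=> /gpos/gtr0_real/CrealP; rewrite rmorphM /= => E.
  by apply: (mulfI Ac0); rewrite E /ka; field; rewrite A0 Ac0.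
have yE u : u != 0 -> y.[u] = c^* * \prod_(g <- gs) (-1 + g * u / ka).
  move=> u0; have uc0 : u^* != 0 by rewrite fmorph_eq0.
  have [E _] := real u u0.
  have {E} : y.[u] = (x.[- (u^* )^-1])^* * u ^+ (2 * l).
    rewrite E rmorphM /= conjCK fmorphV rmorphXn /= conjCK.
    by rewrite divfK // expf_neq0.
  rewrite xE hornerZ horner_prod rmorphM /= => ->; rewrite -mulrA; congr (_ * _).
  rewrite rmorph_prod /= -sgs; elim: gs gconj {sgs xE gpos} => [|g gs IHgs] gconj.
    by rewrite !big_nil expr0 mulr1.
  rewrite !big_cons /= exprS mulrACA IHgs => [|g' g's]; last by apply: gconj; rewrite inE g's orbT.
  congr (_ * _); rewrite hornerXsubC rmorphB rmorphN fmorphV /= conjCK gconj ?mem_head //.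
  by field; rewrite u0 ka0.
pose k0 := c * (- ka) ^+ (2 * l) / c^*.
have cc0 : c^* != 0 by rewrite fmorph_eq0.
have k00 : k0 != 0 by rewrite /k0 !mulf_neq0 ?invr_neq0 ?expf_neq0 ?oppr_eq0.
have xinv u : u != 0 -> x.[ka / u] * u ^+ (2 * l) = k0 * y.[u].
  move=> u0; rewrite yE // xE hornerZ horner_prod /k0.
  have -> : (c * \prod_(i <- gs) ('X - i%:P).[ka / u]) * u ^+ (2 * l) =
      c * ((- ka) ^+ (2 * l) * \prod_(g <- gs) (-1 + g * u / ka)).
    rewrite -mulrA -sgs; congr (_ * _); elim: gs {sgs xE gpos gconj yE} => [|g gs IHgs].
      by rewrite !big_nil !expr0.
    rewrite !big_cons /= !exprS mulrACA IHgs hornerXsubC; field; rewrite ?u0 ?ka0 //.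
  by field.
pose k := k0 / ka ^+ l; have kal0 : ka ^+ l != 0 by rewrite expf_neq0.
have k_neq0 : k != 0 by rewrite mulf_neq0 ?invr_neq0.
have k0E : k0 = ka ^+ l * k by rewrite /k mulrC divfK.
have sq (v : K) : v ^+ (2 * l) = v ^+ l ^+ 2 by rewrite mulnC exprM.
have yinv u : u != 0 -> k * (y.[ka / u] * u ^+ (2 * l)) = ka ^+ l * x.[u].
  move=> u0; have kau : ka / u != 0 by rewrite mulf_neq0 ?invr_neq0.
  have U0 : u ^+ l != 0 by rewrite expf_neq0.
  have := xinv _ kau; have -> : ka / (ka / u) = u by field; rewrite ka0 u0.
  rewrite k0E expr_div_n !sq => E; apply: (mulfI kal0).
  transitivity ((ka ^+ l * k * y.[ka / u]) * u ^+ l ^+ 2); first by ring.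
  by rewrite -E; field.
have sN : (size (x + k *: y)%R <= (2 * l).+1)%N.
  rewrite (leq_trans (size_polyD _ _)) // geq_max sx.
  by rewrite (leq_trans (size_scale_leq _ _)).
have Nsym u : u != 0 -> (x + k *: y).[ka / u] * u ^+ (2 * l) = ka ^+ l * (x + k *: y).[u].
  by move=> u0; rewrite !(hornerD, hornerZ) mulrDl xinv // -mulrA yinv // k0E; ring.
have [p pE] := invariant_poly A0 ka0 zE sN Nsym.
exists ka, k, p; split=> // [u|].
  have := congr1 (fun q : {poly K} => q.[u]) pE; rewrite /= hornerD hornerZ => ->.
  by rewrite horner_sum; apply: eq_bigr => j _; rewrite hornerZ hornerM horner_exp hornerXn.
(* If [x] and [k y] were equal, they would have a common root, against
   positivity. *)
have xky : x - k *: y != 0.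
  have [g ggs] : exists g, g \in gs.
    by case: gs sgs {xE gpos gconj yE} => [|g gs _]; [rewrite /=; lia|exists g; rewrite mem_head].
  apply/negP; rewrite subr_eq0 => /eqP xky; have gpos' := gpos g ggs.
  have g0 : g != 0 by apply: contraTneq gpos' => ->; rewrite mulr0 ltxx.
  have : y.[g] = 0.
    apply: (mulfI k_neq0); rewrite mulr0 -hornerZ -xky xE.
    by apply/eqP; rewrite -rootE rootZ // root_prod_XsubC.
  rewrite yE // => /eqP; rewrite mulf_eq0 (negPf cc0) /= prodf_seq_eq0 => /hasP[g' g'gs /=].
  rewrite addrC subr_eq0 => /eqP E.
  have ggE : g' * g = ka by rewrite -[RHS]mul1r -E divfK.
  have : 0 < (A * g') * (A * g) by rewrite mulr_gt0 // gpos.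
  have -> : (A * g') * (A * g) = - (A * A^* ).
    by rewrite mulrACA ggE /ka; field.
  by rewrite oppr_gt0 => /lt_trans/(_ (_ : 0 < A * A^* )); rewrite ltxx mul_conjC_gt0 A0 => /(_ isT).
apply: cofinS (cofinI (cofin_neq 0) (cofin_horner_neq0 xky)) => u [/eqP u0 xky0] E.
have U0 : u ^+ l != 0 by rewrite expf_neq0.
move/eqP: xky0; apply; rewrite hornerD hornerN hornerZ; apply: (mulfI kal0); rewrite mulr0.
have := yinv u u0; rewrite sq => yi; rewrite mulrBr -yi.
have yu : y.[ka / u] * u ^+ l ^+ 2 = y.[u] * ka ^+ l.
  transitivity (y.[ka / u] / (ka / u) ^+ l * (u ^+ l * ka ^+ l)).
    by rewrite expr_div_n; field; rewrite U0 kal0.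
  by rewrite E; field.
by rewrite yu; ring.
Qed.

End Twistor.

(** * Sections of the hyperplane bundle on S *)

Section Sections.
Local Open Scope classical_set_scope.

Variable K : numClosedFieldType.

(** Division by a monic quadratic polynomial in [s] whose two roots are
    distinct along a curve: the remainder is linear in [s] and vanishes at
    both roots. *)
Lemma quadratic_division (B C : {poly K}) (E : K -> K -> K) (w s s' : K -> K) :
    poly2 E -> (forall c, cofin (fun u => w u <> c)) ->
    cofin (fun u => [/\ s u ^+ 2 - B.[w u] * s u + C.[w u] = 0,
      s' u ^+ 2 - B.[w u] * s' u + C.[w u] = 0,
      E (w u) (s u) = 0, E (w u) (s' u) = 0 & s u <> s' u]) ->
  exists2 Q, poly2 Q & forall w s, E w s = Q w s * (s ^+ 2 - B.[w] * s + C.[w]).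
Proof.
move=> [F EF] wfin vanish.
pose M : {poly {poly K}} := 'X^2 - B%:P * 'X + C%:P.
have ME z t : M.[t%:P].[z] = t ^+ 2 - B.[z] * t + C.[z].
  by rewrite /M !(hornerD, hornerN, hornerM, hornerXn, hornerX, hornerC, horner_exp).
have Msize : (size (B%:P * 'X - C%:P)%R <= 2)%N.
  rewrite (leq_trans (size_polyD _ _)) // size_polyN geq_max (leq_trans (size_polyMleq _ _)) ?size_polyX /=.
    by rewrite (leq_trans (size_polyC_leq1 _)).
  by rewrite addn2 /= ltnS size_polyC_leq1.
have MX : M = 'X^2 - (B%:P * 'X - C%:P) by rewrite /M; ring.
have sM : size M = 3%N by rewrite MX size_polyDl ?size_polyN size_polyXn // ltnS.
have Mmonic : M \is monic.
  rewrite monicE lead_coefE sM MX coefB coefXn eqxx /=.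
  by rewrite [X in 1 - X]nth_default ?subr0 // ltnS.
have FE := Pdiv.RingMonic.rdivp_eq Mmonic F.
set Q := Pdiv.CommonRing.rdivp F M in FE; set r := Pdiv.CommonRing.rmodp F M in FE.
have sr : (size r <= 2)%N.
  by rewrite -ltnS -sM Pdiv.CommonRing.ltn_rmodp monic_neq0.
have rE z t : r.[t%:P].[z] = (r`_0).[z] + (r`_1).[z] * t.
  by rewrite (horner_coef_wide _ sr) big_ord_recl big_ord1 expr0 expr1 mulr1 hornerD hornerM hornerC.
have FME z t : E z t = Q.[t%:P].[z] * (t ^+ 2 - B.[z] * t + C.[z]) + r.[t%:P].[z].
  by rewrite EF FE !hornerD !hornerM ME.
have along (R : {poly K}) : cofin (fun u => R.[w u] = 0) -> R = 0.
  move=> Rw; apply/eqP/negPn/negP => /cofin_horner_neq0/(cofin_comp wfin)/(cofinI Rw)/cofin_ex.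
  by move=> [u [->]]; rewrite eqxx.
have r1 : r`_1 = 0.
  apply: along; apply: cofinS vanish => u [M1 M2 E1 E2 ss'].
  move: E1 E2; rewrite !FME M1 M2 !mulr0 !add0r !rE => r1 r2.
  have : (r`_1).[w u] * (s u - s' u) = 0.
    by rewrite -[RHS](subrr 0) -[in X in _ = X - _]r1 -r2; ring.
  by move/eqP; rewrite mulf_eq0 subr_eq0 => /orP[/eqP //|/eqP/ss'].
have r0 : r`_0 = 0.
  apply: along; apply: cofinS vanish => u [M1 _ E1 _ _].
  by move: E1; rewrite FME M1 mulr0 add0r rE r1 horner0 mul0r addr0.
exists (fun z t => Q.[t%:P].[z]); first by exists Q.
by move=> z t; rewrite FME rE r0 r1 !horner0 mul0r !addr0.
Qed.

Section Surface.
Variables (l : nat) (a : 'I_(2 * l) -> K).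
Local Notation S := (conic_surface a).
Implicit Types (p q v : coords S) (sigma d : coords S -> K).

(** Sections of the hyperplane bundle of P(O(l) + O(l) + O). *)
Definition section_form sigma : Prop :=
  polyfun sigma /\ forall b c q, sigma (torus5 l b c q) = c * b ^+ l * sigma q.

(** The zero divisor of the section [sigma], which has the local equations
    [sigma / d], for sections [d] that do not vanish at the point in question. *)
Definition section_divisor (D : effdiv S) : Prop :=
  exists sigma, [/\ section_form sigma, exists2 p, pts p & sigma p != 0 &
    forall p, pts p -> exists h, D p h /\
      exists d, [/\ section_form d, d p != 0 & locally p (fun q => h q * d q = sigma q)]].

Lemma regular_section_ratio p sigma d : section_form sigma -> section_form d ->
  d p != 0 -> regular_at p (fun q => sigma q / d q).
Proof.
move=> [sP sw] [dP dw] dp; apply: regular_ratio => // q q' _ _ [b [c [b0 c0 ->]]].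
by exists (c * b ^+ l); rewrite ?mulf_neq0 ?expf_neq0 // sw dw.
Qed.

(** The rational function is the quotient of the two sections; the unit that
    compares local equations is the quotient of the two denominators. *)
Lemma section_divisors_equivalent D D' :
  section_divisor D -> section_divisor D' -> linearly_equivalent D D'.
Proof.
move=> [s [[[G GE] sw] [p0 Sp0 s0] Dloc]] [s' [[[H HE] s'w] [p1 Sp1 s'1] D'loc]].
exists G, H; split.
- by exists p0; rewrite -?GE.
- by exists p1; rewrite -?HE.
- by move=> p q _ _ [b [c [b0 c0 ->]]]; rewrite -!GE -!HE sw s'w mulrCA mulrA.
move=> p Sp; have [h [Dh [d [dS dp hE]]]] := Dloc p Sp.
have [h' [D'h [d' [d'S d'p h'E]]]] := D'loc p Sp.
exists h, h', (fun q => d q / d' q); split=> //.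
- exact: regular_section_ratio.
- by rewrite mulf_neq0 ?invr_neq0.
apply: locallyS (locallyI (locallyI hE h'E) (locally_neq0 (proj1 d'S) d'p)).
by move=> q Sq [[hq h'q] d'q]; rewrite -GE -HE -hq -h'q; field.
Qed.

Lemma section_form_coord j : (j = 2 \/ j = 3)%N -> section_form (fun q => coord q j).
Proof.
move=> jE; split; first exact: polyfun_coord.
by move=> b c q; case: jE => ->; rewrite /torus5 !coord_row5.
Qed.

Lemma section_form_t i : (i = 0 \/ i = 1)%N ->
  section_form (fun q => coord q 4 * coord q i ^+ l).
Proof.
move=> iE; split; first by apply: polyfunM; [|apply: polyfunX]; exact: polyfun_coord.
by move=> b c q; case: iE => ->; rewrite /torus5 !coord_row5 exprMn; ring.
Qed.

Section Line.
Variables (x y z : {poly K}) (ka k : K) (cf : nat -> K).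
Hypotheses (xyE : x * y = \prod_i (z - a i *: 'X)).
Hypotheses (ka0 : ka != 0) (k0 : k != 0) (sz : size z = 3%N).
Hypothesis z_inv : forall u : K, u != 0 -> z.[ka / u] * u ^+ 2 = ka * z.[u].
Hypothesis xy_sum : forall u,
  x.[u] + k * y.[u] = \sum_(j < l.+1) cf j * (z.[u] ^+ j * u ^+ (l - j)).
Hypothesis y_moves : cofin (fun u => y.[ka / u] / (ka / u) ^+ l <> y.[u] / u ^+ l).

Definition line_pt u : coords S := row5 1 (z.[u] / u) (x.[u] / u ^+ l) (y.[u] / u ^+ l) 1.

Definition line : set (coords S) :=
  zclosure [set v : coords S | pts v /\ exists2 u : K, u != 0 & same (line_pt u) v].

(** The section [x + k y - t p(z)]. *)
Definition line_eq q : K := coord q 2 + k * coord q 3 -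
  coord q 4 * \sum_(j < l.+1) cf j * (coord q 1 ^+ j * coord q 0 ^+ (l - j)).

Lemma pts_line_pt u : u != 0 -> pts (line_pt u).
Proof.
move=> u0; apply: pts_row5; rewrite ?oner_neq0 ?orbT // expr1n mul1r.
have ul : u ^+ l != 0 by rewrite expf_neq0.
apply: (mulfI (expf_neq0 2 ul)); rewrite -root_formZ mulr1.
have -> : u * (z.[u] / u) = z.[u] by field.
have -> : u ^+ l ^+ 2 * (x.[u] / u ^+ l * (y.[u] / u ^+ l)) = (x * y).[u].
  by rewrite hornerM; field.
rewrite xyE horner_prod /root_form; apply: eq_bigr => i _.
by rewrite hornerD hornerN hornerZ hornerX.
Qed.

Lemma line_eq_pt u : u != 0 -> line_eq (line_pt u) = 0.
Proof.
move=> u0; rewrite /line_eq /line_pt !coord_row5 mul1r.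
have ul : u ^+ l != 0 by rewrite expf_neq0.
apply: (mulfI ul); rewrite mulr0 mulrBr.
have -> : u ^+ l * (x.[u] / u ^+ l + k * (y.[u] / u ^+ l)) = x.[u] + k * y.[u] by field.
rewrite xy_sum mulr_sumr; apply/eqP; rewrite subr_eq0; apply/eqP; apply: eq_bigr => j _.
rewrite expr1n mulr1 expr_div_n.
have -> : u ^+ l = u ^+ j * u ^+ (l - j) by rewrite -exprD subnKC // -ltnS.
by field; rewrite expf_neq0.
Qed.

Lemma section_form_line : section_form line_eq.
Proof.
split=> [|b c q].
  apply: polyfunB; first apply: polyfunD; [exact: polyfun_coord|apply: polyfunM|].
  - exact: polyfun_const.
  - exact: polyfun_coord.
  apply: polyfunM; first exact: polyfun_coord.
  apply: polyfun_sum => j; apply: polyfunM; first exact: polyfun_const.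
  by apply: polyfunM; apply: polyfunX; exact: polyfun_coord.
rewrite /line_eq /torus5 !coord_row5.
have -> : \sum_(j < l.+1) cf j * ((b * coord q 1) ^+ j * (b * coord q 0) ^+ (l - j)) =
    b ^+ l * \sum_(j < l.+1) cf j * (coord q 1 ^+ j * coord q 0 ^+ (l - j)).
  rewrite mulr_sumr; apply: eq_bigr => j _.
  have -> : b ^+ l = b ^+ j * b ^+ (l - j) by rewrite -exprD subnKC // -ltnS.
  by rewrite !exprMn; ring.
by ring.
Qed.

Lemma line_eq0 q : line q -> line_eq q = 0.
Proof.
have [lP lw] := section_form_line.
move=> [Sq /(_ [set v | line_eq v = 0])]; apply; first split.
- by move=> p p' _ _ [b [c [b0 c0 ->]]] lp; rewrite /mkset lw lp mulr0.
- by move=> p Sp /eqP lp; apply: locallyS (locally_neq0 lP lp) => v _ /eqP.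
move=> v [Sv [u u0 [b [c [b0 c0 ->]]]]].
by rewrite /mkset lw line_eq_pt // mulr0.
Qed.

Lemma line_mem u b c : u != 0 -> b != 0 -> c != 0 -> line (torus5 l b c (line_pt u)).
Proof.
move=> u0 b0 c0; have Su := pts_line_pt u0; have Sv := pts_torus5 b0 c0 Su.
split=> // B [Bsame _]; apply; split=> //; exists u => //; exact: same_torus5.
Qed.

Lemma ideal_at_line p d : section_form d -> d p != 0 ->
  ideal_at line p (fun q => line_eq q / d q).
Proof.
move=> dS dp; split; first exact: (regular_section_ratio section_form_line).
by apply: locallyT => q _ /line_eq0 ->; rewrite mul0r.
Qed.

Lemma regular_poly2 p (f : K -> K -> K) (r s : coords S -> K) : poly2 f ->
  regular_at p r -> regular_at p s -> regular_at p (fun q => f (r q) (s q)).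
Proof.
move=> [F FE] rr sr; apply: (regular_ext (f := fun q => F.[(s q)%:P].[r q])).
  by move=> q; rewrite FE.
elim/poly_ind: {FE} F => [|F c IHF].
  by apply: regular_ext (regular_const p 0) => q; rewrite !horner0.
apply: regular_ext (regularD (regularM IHF sr) (regular_horner c rr)) => q.
by rewrite hornerMXaddC hornerD hornerM hornerC.
Qed.

Lemma regular_row5 p (n0 n1 n2 n3 n4 : coords S -> K) :
    regular_at p n0 -> regular_at p n1 -> regular_at p n2 -> regular_at p n3 ->
    regular_at p n4 ->
  forall j, regular_at p (fun q => row5 (n0 q) (n1 q) (n2 q) (n3 q) (n4 q) 0 j).
Proof.
move=> r0 r1 r2 r3 r4; case=> -[|[|[|[|[|//]]]]] jlt.
- by apply: regular_ext r0 => q; rewrite mxE.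
- by apply: regular_ext r1 => q; rewrite mxE.
- by apply: regular_ext r2 => q; rewrite mxE.
- by apply: regular_ext r3 => q; rewrite mxE.
- by apply: regular_ext r4 => q; rewrite mxE.
Qed.

(** Near a point with [t != 0]: the base coordinate [Z], of index [Zi], does
    not vanish, and [W], of index [Wi], is the other one. A point near [p] has
    a unique representative with [Z = Z(p)] and [t = t(p)]. *)
Section Chart.
Variables (Zi Wi : nat) (p : coords S).
Hypothesis ZW : (Zi, Wi) = (0, 1)%N \/ (Zi, Wi) = (1, 0)%N.
Hypotheses (Sp : pts p) (zp0 : coord p Zi != 0) (tp0 : coord p 4 != 0).
Let zp := coord p Zi.
Let tp := coord p 4.

Definition chart_fst : {poly K} := if Zi == 0%N then zp%:P else 'X.
Definition chart_snd : {poly K} := if Zi == 0%N then 'X else zp%:P.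

Definition slice_sum (w : K) : K :=
  tp * \sum_(j < l.+1) cf j * (chart_snd.[w] ^+ j * chart_fst.[w] ^+ (l - j)).

(** The normalised points of the zero locus of [line_eq] in the CP2-bundle,
    where [w] is the base coordinate and [s] is [y]. *)
Definition slice_pt (w s : K) : coords S :=
  row5 chart_fst.[w] chart_snd.[w] (slice_sum w - k * s) s tp.

(** The point [u] of the twistor line, normalised, is
    [slice_pt (wu u) (su u)]. *)
Let Zu u : K := coord (line_pt u) Zi.
Let wu u : K := zp / Zu u * coord (line_pt u) Wi.
Let su u : K := tp * (zp / Zu u) ^+ l * (y.[u] / u ^+ l).

Lemma line_slice_pt u : u != 0 -> z.[u] != 0 ->
  zp / Zu u != 0 /\ torus5 l (zp / Zu u) tp (line_pt u) = slice_pt (wu u) (su u).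
Proof.
move=> u0 z0; have Z0 : Zu u != 0.
  by rewrite /Zu /line_pt; case: ZW => -[-> _]; rewrite coord_row5 ?oner_neq0 ?mulf_neq0 ?invr_neq0.
have b0 : zp / Zu u != 0 by rewrite mulf_neq0 ?invr_neq0.
split=> //; set b := zp / Zu u in b0 *; pose v := torus5 l b tp (line_pt u).
have v0 : coord v 0 = chart_fst.[wu u].
  rewrite /v /torus5 coord_row5 /chart_fst /wu /b /Zu /line_pt.
  by case: ZW => -[-> ->]; rewrite /= !coord_row5 ?hornerC ?hornerX ?divr1 ?mulr1.
have v1 : coord v 1 = chart_snd.[wu u].
  move: Z0; rewrite /v /torus5 coord_row5 /chart_snd /wu /b /Zu /line_pt.
  by case: ZW => -[-> ->]; rewrite /= !coord_row5 ?hornerC ?hornerX // => Z0; rewrite divfK.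
have v3 : coord v 3 = su u by rewrite /v /torus5 !coord_row5.
have v4 : coord v 4 = tp by rewrite /v /torus5 !coord_row5 mulr1.
have : line_eq v = 0 by have [_ lw] := section_form_line; rewrite lw line_eq_pt // mulr0.
rewrite /line_eq v0 v1 v3 v4 -/(slice_sum _) => E.
rewrite -/v [v]row5_coord v0 v1 v3 v4 /slice_pt; congr (row5 _ _ _ _ _).
transitivity ((coord v 2 + k * su u - slice_sum (wu u)) + slice_sum (wu u) - k * su u); first by ring.
by rewrite E add0r.
Qed.

Let z_neq0 : z != 0.
Proof. by rewrite -size_poly_gt0 sz. Qed.

Lemma wu_finite_fibres c : cofin (fun u => wu u <> c).
Proof.
have sz' (b : K) : size (z - b *: 'X) = 3%N.
  by rewrite size_polyDl // size_polyN sz (leq_ltn_trans (size_scale_leq _ _)) ?size_polyX.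
have nz (b : K) : z - b *: 'X != 0 by rewrite -size_poly_gt0 sz'.
have X0 : 'X != 0 :> {poly K} by rewrite polyX_eq0.
have good := cofinI (cofin_neq 0) (cofin_horner_neq0 z_neq0).
rewrite /wu /Zu /line_pt; case: ZW => -[-> ->].
  apply: cofinS (cofinI good (cofin_horner_neq0 (nz (c / zp)))) => u [[/eqP u0 zu] cu] E.
  move/eqP: cu; apply; rewrite hornerD hornerN hornerZ hornerX -E !coord_row5.
  by field; rewrite u0 andbT; exact: zp0.
have zpn : zp != 0 by exact: zp0.
have [c0|c0] := eqVneq c 0.
  apply: cofinS good => u [/eqP u0 zu]; rewrite c0 !coord_row5 mulr1 => /eqP; apply/negP.
  by rewrite mulf_neq0 // invr_neq0 // mulf_neq0 // invr_neq0.
apply: cofinS (cofinI good (cofin_horner_neq0 (nz (zp / c)))) => u [[/eqP u0 zu] cu] E.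
move/eqP: cu; apply; rewrite hornerD hornerN hornerZ hornerX -E !coord_row5.
by field; rewrite zpn u0 zu.
Qed.

Lemma line_pt_inv u : u != 0 -> coord (line_pt (ka / u)) 1 = coord (line_pt u) 1.
Proof.
move=> u0; rewrite /line_pt !coord_row5.
have -> : z.[u] / u = (ka * z.[u]) / (ka * u) by field; rewrite u0.
by rewrite -z_inv //; field; rewrite u0.
Qed.

Lemma wu_inv u : u != 0 -> Zu (ka / u) = Zu u /\ wu (ka / u) = wu u.
Proof.
move=> u0; have e1 := line_pt_inv u0.
have e0 : coord (line_pt (ka / u)) 0 = coord (line_pt u) 0 by rewrite /line_pt !coord_row5.
by rewrite /wu /Zu; case: ZW => -[-> ->]; rewrite e0 e1.
Qed.

Lemma chart_neq0 u : u != 0 -> z.[u] != 0 -> zp / Zu u != 0.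
Proof. by move=> u0 z0; have [] := line_slice_pt u0 z0. Qed.

Definition slice_trace : {poly K} :=
  (tp / k) *: \sum_(j < l.+1) cf j *: (chart_snd ^+ j * chart_fst ^+ (l - j)).
Definition slice_norm : {poly K} :=
  (tp ^+ 2 / k) *: \prod_i (chart_snd - a i *: chart_fst).

Lemma slice_traceE w : slice_trace.[w] = slice_sum w / k.
Proof.
rewrite /slice_trace /slice_sum hornerZ horner_sum mulrAC; congr (_ * _ / _).
by apply: eq_bigr => j _; rewrite hornerZ hornerM !horner_exp.
Qed.

Lemma slice_normE w : slice_norm.[w] = tp ^+ 2 * root_form a chart_fst.[w] chart_snd.[w] / k.
Proof.
rewrite /slice_norm /root_form hornerZ horner_prod mulrAC; congr (_ * _ / _).
by apply: eq_bigr => j _; rewrite hornerD hornerN hornerZ.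
Qed.

Lemma poly2_slice_pt j : poly2 (fun w s => slice_pt w s 0 j).
Proof.
apply: poly2_row5; try exact: poly2_fst; try exact: poly2_snd; try exact: poly2_const.
apply: poly2B; last by apply: poly2M; [exact: poly2_const|exact: poly2_snd].
apply: (poly2_ext (f := fun w _ => (k *: slice_trace).[w])); last exact: poly2_fst.
by move=> w s; rewrite hornerZ slice_traceE mulrC divfK.
Qed.

(** On the slice, the equation of [S] is a monic quadratic in [s] up to the
    factor [- k]. The involution [u -> ka / u] preserves the base point [wu u]
    and moves [su u], so that the two points are the two roots. *)
Lemma slice_division (E : {mpoly K[5]}) : (forall v, line v -> E.@[v 0] = 0) ->
  exists2 Q, poly2 Q & forall w s,
    E.@[slice_pt w s 0] = Q w s * (s ^+ 2 - slice_trace.[w] * s + slice_norm.[w]).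
Proof.
move=> Eline; apply: (@quadratic_division _ _ _ wu su (fun u => su (ka / u))).
- by apply: poly2_meval => j; exact: poly2_slice_pt.
- exact: wu_finite_fibres.
have good := cofinI (cofin_neq 0) (cofin_horner_neq0 z_neq0).
apply: cofinS (cofinI good y_moves) => u [[/eqP u0 zu] yu].
have ku0 : ka / u != 0 by rewrite mulf_neq0 ?invr_neq0.
have zku : z.[ka / u] != 0.
  have : z.[ka / u] * u ^+ 2 != 0 by rewrite z_inv ?mulf_neq0.
  by rewrite mulf_eq0 negb_or => /andP[].
have at_pt u1 : u1 != 0 -> z.[u1] != 0 ->
    su u1 ^+ 2 - slice_trace.[wu u1] * su u1 + slice_norm.[wu u1] = 0 /\
    E.@[slice_pt (wu u1) (su u1) 0] = 0.
  move=> u10 zu1; have [b0 sE] := line_slice_pt u10 zu1; split; last first.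
    by rewrite -sE; apply: Eline; exact: line_mem.
  have [_ _] := pts_torus5 b0 tp0 (pts_line_pt u10); rewrite sE /slice_pt !coord_row5 => xyt.
  by rewrite slice_traceE slice_normE -xyt; field.
have [ZE wE] := wu_inv u0.
have [M1 E1] := at_pt u u0 zu; have [M2 E2] := at_pt _ ku0 zku.
rewrite wE in M2 E2; split=> // sE; apply: yu; apply/esym.
move: sE; rewrite /su ZE => /mulfI; apply.
by rewrite mulf_neq0 ?expf_neq0 //; exact: chart_neq0.
Qed.

Let d0 q : K := coord q 4 * coord q Zi ^+ l.

(** A function that vanishes on the curve is the quotient of two polynomials.
    When [x], in the normalised coordinates, is replaced by the value that
    [line_eq = 0] prescribes, the numerator changes by a multiple of
    [line_eq]. By [slice_division] the result is divisible by the quadratic in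
    [y] that is the equation of [S] on the slice. On [S], this quadratic is
    also a multiple of [line_eq], namely by [y / k]. *)
Lemma line_generates h : ideal_at line p h ->
  in_ideal p (fun (_ : 'I_1) q => line_eq q / d0 q) h.
Proof.
move=> [[hs [G [H [Hp hE]]]] [H0 H0p h0]].
set u := fun (_ : 'I_1) q => line_eq q / d0 q.
have Zi01 : (Zi = 0 \/ Zi = 1)%N by case: ZW => -[-> _]; [left|right].
have d0S : section_form d0 by exact: section_form_t.
have d0p : d0 p != 0 by rewrite /d0 mulf_neq0 ?expf_neq0.
have line_u : in_ideal p u (fun q => line_eq q / d0 q) by exact: (in_ideal_gen p u ord0).
have bratio i : (i = 0 \/ i = 1)%N -> regular_at p (fun q => coord q i / coord q Zi).
  move=> iE; apply: regular_ratio => //; try exact: polyfun_coord.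
  move=> q q' _ _ [b [c [b0 c0 ->]]]; exists b => //.
  by case: iE => ->; case: Zi01 => ->; rewrite /torus5 !coord_row5.
have tratio : regular_at p (fun q => coord q 4 / coord q 4).
  apply: regular_ratio => //; try exact: polyfun_coord.
  by move=> q q' _ _ [b [c [b0 c0 ->]]]; exists c => //; rewrite /torus5 !coord_row5.
have sratio i : (i = 2 \/ i = 3)%N -> regular_at p (fun q => coord q i / d0 q).
  by move=> iE; apply: regular_section_ratio => //; exact: section_form_coord.
pose n0 q := zp * (coord q 0 / coord q Zi); pose n1 q := zp * (coord q 1 / coord q Zi).
pose n2 q := tp * zp ^+ l * (coord q 2 / d0 q); pose n3 q := tp * zp ^+ l * (coord q 3 / d0 q).
pose n4 q := tp * (coord q 4 / coord q 4).
have n0r : regular_at p n0.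
  by apply: regularM; [exact: regular_const|apply: bratio; left].
have n1r : regular_at p n1.
  by apply: regularM; [exact: regular_const|apply: bratio; right].
have n2r : regular_at p n2.
  by apply: regularM; [exact: regular_const|apply: sratio; left].
have n3r : regular_at p n3.
  by apply: regularM; [exact: regular_const|apply: sratio; right].
have n4r : regular_at p n4 by apply: regularM; [exact: regular_const|].
(* The value of [x] that [line_eq = 0] prescribes. *)
pose x1 q := n4 q * (\sum_(j < l.+1) cf j * (n1 q ^+ j * n0 q ^+ (l - j))) - k * n3 q.
have x1r : regular_at p x1.
  apply: regularB; apply: regularM => //; try exact: regular_const.
  apply: regular_sum => j; apply: regularM; first exact: regular_const.
  by apply: regularM; exact: regularX.
pose nq q : coords S := row5 (n0 q) (n1 q) (n2 q) (n3 q) (n4 q).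
pose mq q : coords S := row5 (n0 q) (n1 q) (x1 q) (n3 q) (n4 q).
have near_p : locally p (fun q => coord q Zi != 0 /\ coord q 4 != 0).
  by apply: locallyI; apply: locally_neq0 => //; exact: polyfun_coord.
have nqE q : coord q Zi != 0 -> coord q 4 != 0 ->
    nq q = torus5 l (zp / coord q Zi) (tp / coord q 4) q.
  move=> Zq tq; rewrite /nq /torus5 /n0 /n1 /n2 /n3 /n4 /d0 expr_div_n.
  have Zl : coord q Zi ^+ l != 0 by rewrite expf_neq0.
  by apply: row5_eq; rewrite !coord_row5; field; rewrite ?Zq ?tq ?Zl.
have nqp : nq p = p.
  by rewrite nqE // !divff //; apply: row5_eq; rewrite /torus5 !coord_row5 ?expr1n !mul1r.
(* The factors [H] and [H0] make the numerator vanish on the whole curve,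
   and not only near [p]. *)
pose E : {mpoly K[5]} := G * H * H0.
have Eline v : line v -> E.@[v 0] = 0.
  move=> Lv; have [Sv _] := Lv; rewrite /E !mevalM.
  have [->|Hv] := eqVneq H.@[v 0] 0; first by rewrite mulr0 mul0r.
  have [->|H0v] := eqVneq H0.@[v 0] 0; first by rewrite mulr0.
  have := h0 v Sv H0v Lv; rewrite hE // => /eqP; rewrite mulf_eq0 invr_eq0 (negPf Hv) orbF.
  by move=> /eqP ->; rewrite !mul0r.
have [Q QP QE] := slice_division Eline.
pose nw q := if Zi == 0%N then n1 q else n0 q.
have nwr : regular_at p nw by rewrite /nw; case: (Zi == 0%N).
have near_eq q : pts q -> coord q Zi != 0 -> coord q 4 != 0 ->
    [/\ n2 q - x1 q = tp * zp ^+ l * (line_eq q / d0 q), mq q = slice_pt (nw q) (n3 q) &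
        n2 q * n3 q = tp ^+ 2 * root_form a chart_fst.[nw q] chart_snd.[nw q]].
  move=> Sq Zq tq; have Zl : coord q Zi ^+ l != 0 by rewrite expf_neq0.
  have n4E : n4 q = tp by rewrite /n4 divff // mulr1.
  have f0 : chart_fst.[nw q] = n0 q.
    rewrite /chart_fst /nw; case: eqP => [Zi0|_]; last by rewrite hornerX.
    by rewrite hornerC /n0; move: Zq; rewrite Zi0 => Zq; rewrite divff // mulr1.
  have f1 : chart_snd.[nw q] = n1 q.
    rewrite /chart_snd /nw; case: eqP => [_|Zi0]; first by rewrite hornerX.
    rewrite hornerC /n1; have Zi1 : Zi = 1%N by case: Zi01.
    by move: Zq; rewrite Zi1 => Zq; rewrite divff // mulr1.
  have nq0 : coord (nq q) 0 = n0 q by rewrite /nq coord_row5.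
  split.
  - have [_ lw] := section_form_line.
    transitivity (line_eq (nq q)); last first.
      by rewrite nqE // lw /d0 expr_div_n; field; rewrite Zl tq.
    by rewrite /line_eq /nq !coord_row5 /x1; ring.
  - by rewrite /mq /slice_pt /slice_sum f0 f1 -n4E.
  have : pts (nq q) by rewrite nqE //; apply: pts_torus5; rewrite // mulf_neq0 ?invr_neq0.
  by move=> [_ _]; rewrite /nq !coord_row5 f0 f1 n4E.
have x1I : in_ideal p u (fun q => n2 q - x1 q).
  apply: in_ideal_local (in_idealM (regular_const p (tp * zp ^+ l)) line_u).
  by apply: locallyS near_p => q Sq [Zq tq]; have [-> _ _] := near_eq q Sq Zq tq.
have EmI : in_ideal p u (fun q => E.@[mq q 0]).
  apply: in_ideal_local (in_idealM (regularM (regularM (regular_poly2 QP nwr n3r) n3r)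
    (regular_const p k^-1)) x1I).
  apply: locallyS near_p => q Sq [Zq tq]; have [_ mE nxyE] := near_eq q Sq Zq tq.
  have x1E : x1 q = slice_sum (nw q) - k * n3 q.
    by have := congr1 (fun v => coord v 2) mE; rewrite /mq /slice_pt !coord_row5.
  rewrite mE QE slice_traceE slice_normE -nxyE x1E.
  by field.
have nr := regular_row5 n0r n1r n2r n3r n4r.
have mr := regular_row5 n0r n1r x1r n3r n4r.
have EnI : in_ideal p u (fun q => E.@[nq q 0]).
  have dI : in_ideal p u (fun q => E.@[fun j => nq q 0 j] - E.@[fun j => mq q 0 j]).
    apply: in_ideal_meval; [exact: nr|exact: mr|].
    case=> -[|[|[|[|[|//]]]]] jlt.
    - by apply: in_ideal_ext (in_ideal0 p u) => q; rewrite !mxE subrr.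
    - by apply: in_ideal_ext (in_ideal0 p u) => q; rewrite !mxE subrr.
    - by apply: in_ideal_ext x1I => q; rewrite !mxE.
    - by apply: in_ideal_ext (in_ideal0 p u) => q; rewrite !mxE subrr.
    - by apply: in_ideal_ext (in_ideal0 p u) => q; rewrite !mxE subrr.
  by apply: in_ideal_ext (in_idealD dI EmI) => q; rewrite subrK.
have Hr : regular_at p (fun q => H.@[nq q 0]) by exact: (regular_meval H nr).
have H0r : regular_at p (fun q => H0.@[nq q 0]) by exact: (regular_meval H0 nr).
pose den q := H.@[nq q 0] ^+ 2 * H0.@[nq q 0].
have denr : regular_at p den by apply: regularM => //; exact: regularX.
have denp : den p != 0 by rewrite /den nqp mulf_neq0 ?expf_neq0.
apply: in_ideal_local (in_idealM (regularV Sp denr denp) EnI).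
apply: locallyS (locallyI near_p (regular_locally_neq0 Sp denr denp)) => q Sq [[Zq tq] denq].
have b0 : zp / coord q Zi != 0 by rewrite mulf_neq0 ?invr_neq0.
have c0 : tp / coord q 4 != 0 by rewrite mulf_neq0 ?invr_neq0.
have Sn : pts (nq q) by rewrite nqE //; exact: pts_torus5.
have hq : h q = h (nq q) by apply: hs => //; rewrite nqE //; exact: same_torus5.
move: denq; rewrite /den mulf_eq0 sqrf_eq0 negb_or => /andP[Hq H0q].
by rewrite hq hE // /E !mevalM; field; rewrite Hq H0q.
Qed.

End Chart.

(** [line_generates] applies where [t != 0]. Points with [t = 0] do not lie on
    the curve, and [line_eq] does not vanish there, since exactly one of [x]
    and [y] vanishes at such a point. *)
Lemma section_divisor_line : section_divisor (curve_divisor line).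
Proof.
exists line_eq; split; first exact: section_form_line.
  exists (row5 1 0 1 0 0); first by apply: pts_row5; rewrite ?oner_neq0 // mulr0 expr0n mul0r.
  by rewrite /line_eq !coord_row5 mulr0 mul0r addr0 subr0 oner_neq0.
move=> p Sp; have [z_neq0 nz pE] := Sp.
have [t0|t0] := eqVneq (coord p 4) 0; last first.
  have [Zi [Wi [ZW Zp]]] : exists Zi Wi, ((Zi, Wi) = (0, 1)%N \/ (Zi, Wi) = (1, 0)%N) /\ coord p Zi != 0.
    by case/orP: z_neq0 => Zp; [exists 0%N, 1%N; split=> //; left|exists 1%N, 0%N; split=> //; right].
  have dS : section_form (fun q => coord q 4 * coord q Zi ^+ l).
    by apply: section_form_t; case: ZW => -[-> _]; [left|right].
  have dp : coord p 4 * coord p Zi ^+ l != 0 by rewrite mulf_neq0 ?expf_neq0.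
  exists (fun q => line_eq q / (coord q 4 * coord q Zi ^+ l)); split.
    split; first exact: (ideal_at_line dS dp).
    move=> h' /(line_generates ZW Sp Zp t0)[c cr cE]; exists (c ord0) => //.
    by apply: locallyS cE => q _ ->; rewrite big_ord1.
  exists (fun q => coord q 4 * coord q Zi ^+ l); split=> //.
  by apply: locallyS (locally_neq0 (proj1 dS) dp) => q _ dq; rewrite divfK.
have [i iE ip] : exists2 i, (i = 2 \/ i = 3)%N & coord p i != 0.
  by case/or3P: nz => ip; [exists 2%N => //; left|exists 3%N => //; right|rewrite t0 eqxx in ip].
have dS := section_form_coord iE.
have line_p : line_eq p != 0.
  rewrite /line_eq t0 mul0r subr0; move/eqP: pE; rewrite t0 expr0n mul0r mulf_eq0.
  case/orP => /eqP c0; rewrite c0 ?add0r ?mulr0 ?addr0.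
    by rewrite mulf_neq0 //; case: iE ip => ->; rewrite ?c0 ?eqxx.
  by case: iE ip => ->; rewrite ?c0 ?eqxx.
exists (fun q => line_eq q / coord q i); split.
  have hI := ideal_at_line dS ip; split=> // h' [h'r _].
  have hp : line_eq p / coord p i != 0 by rewrite mulf_neq0 ?invr_neq0.
  have hr := proj1 hI.
  exists (fun q => h' q * (line_eq q / coord q i)^-1); first by apply: regularM => //; exact: (regularV Sp hr hp).
  by apply: locallyS (regular_locally_neq0 Sp hr hp) => q _ hq; rewrite divfK.
exists (fun q => coord q i); split=> //.
by apply: locallyS (locally_neq0 (proj1 dS) ip) => q _ dq; rewrite divfK.
Qed.

End Line.

End Surface.

End Sections.

(** * Pullbacks of hyperplane sections of T *)

Section Hyperplanes.

Variable K : numClosedFieldType.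

Lemma linear_formZ n (b : K) (c v : 'rV[K]_n) : linear_form c (b *: v) = b * linear_form c v.
Proof. by rewrite /linear_form mulr_sumr; apply: eq_bigr => i _; rewrite mxE mulrCA. Qed.

Lemma linear_form_neq0 n (v : 'rV[K]_n) : v != 0 -> exists c, linear_form c v != 0.
Proof.
move=> /rV0Pn[i vi]; exists (delta_mx 0 i); rewrite /linear_form (bigD1 i) //=.
rewrite mxE !eqxx mul1r big1 ?addr0 // => j ji.
by rewrite mxE (negPf ji) andbF mul0r.
Qed.

Section Hyperplane.
Variables (g : nat) (a : 'I_(2 * g.+1) -> K) (q : {mpoly K[g.+2]}).
Local Notation l := g.+1.
Local Notation S := (conic_surface a).
Local Notation T := (hyperelliptic_surface q).
Variable f : coords S -> coords T.
Variables (A B C D c1 c2 c3 : K) (X Y : nat).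
Hypotheses (det0 : A * D - B * C != 0) (c10 : c1 != 0) (c20 : c2 != 0) (c30 : c3 != 0).
Hypothesis XY : (X, Y) = (2, 3)%N \/ (X, Y) = (3, 2)%N.
Hypothesis f_mor : morphism f.
Hypothesis f_coords : forall p : coords S, pts p ->
  image_coords f A B C D p (c1 * coord p 4) (c2 * coord p X) (c3 * coord p Y).
Implicit Types (p v : coords S).

(** A polynomial representative of [f] on all of [S]. *)
Definition monomial_map p : 'rV[K]_g.+4 :=
  conic_point g A B C D (c1 * coord p 4) (coord p 0) (coord p 1) (c2 * coord p X) (c3 * coord p Y).

Lemma monomial_map_torus5 b c p :
  monomial_map (torus5 l b c p) = (c * b ^+ l) *: monomial_map p.
Proof.
rewrite /monomial_map conic_pointZ /conic_point.
have -> : coord (torus5 l b c p) 4 = c * coord p 4 by rewrite /torus5 coord_row5.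
have -> : coord (torus5 l b c p) 0 = b * coord p 0 by rewrite /torus5 coord_row5.
have -> : coord (torus5 l b c p) 1 = b * coord p 1 by rewrite /torus5 coord_row5.
have -> : coord (torus5 l b c p) X = c * b ^+ l * coord p X.
  by case: XY => -[-> _]; rewrite /torus5 coord_row5.
have -> : coord (torus5 l b c p) Y = c * b ^+ l * coord p Y.
  by case: XY => -[_ ->]; rewrite /torus5 coord_row5.
have -> : m0 A B (b * coord p 0) (b * coord p 1) = b * m0 A B (coord p 0) (coord p 1).
  by rewrite /m0; ring.
have -> : m1 C D (b * coord p 0) (b * coord p 1) = b * m1 C D (coord p 0) (coord p 1).
  by rewrite /m1; ring.
by rewrite Tpoint_scale; congr Tpoint; ring.
Qed.

Lemma polyfun_monomial_map j : polyfun (fun p : 'rV[K]_5 => monomial_map p 0 j).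
Proof.
have cP b k : polyfun (fun p : 'rV[K]_5 => b * coord p k).
  by apply: polyfunM; [exact: polyfun_const|exact: polyfun_coord].
have mP b d : polyfun (fun p : 'rV[K]_5 => b * coord p 0 + d * coord p 1).
  by apply: polyfunD; exact: cP.
rewrite /monomial_map /conic_point /Tpoint; case: (boolP (j < g.+2)%N) => jg.
  apply: (polyfun_ext (f := fun p => (c1 * coord p 4) *
    (m0 A B (coord p 0) (coord p 1) ^+ (g.+1 - j) * m1 C D (coord p 0) (coord p 1) ^+ j))).
    by move=> p; rewrite mxE jg.
  by apply: polyfunM; [exact: cP|apply: polyfunM; apply: polyfunX; exact: mP].
have [jE|jE] := eqVneq (j : nat) g.+2.
  apply: (polyfun_ext (f := fun p => (c2 * coord p X - c3 * coord p Y) * (2 * 'i)^-1)).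
    by move=> p; rewrite mxE (negPf jg) jE eqxx.
  by apply: polyfunM; [apply: polyfunB; exact: cP|exact: polyfun_const].
apply: (polyfun_ext (f := fun p => (c2 * coord p X + c3 * coord p Y) * 2^-1)).
  by move=> p; rewrite mxE (negPf jg) (negPf jE).
by apply: polyfunM; [apply: polyfunD; exact: cP|exact: polyfun_const].
Qed.

Lemma section_form_hyperplane c :
  section_form (a := a) (fun p => linear_form c (monomial_map p)).
Proof.
split=> [|b d p]; last by rewrite monomial_map_torus5 linear_formZ.
apply: (polyfun_sum (index_enum _) (f := fun j (p : 'rV[K]_5) => c 0 j * monomial_map p 0 j)).
by move=> j; apply: polyfunM; [exact: polyfun_const|exact: polyfun_monomial_map].
Qed.

Lemma linear_form_conic_point (c : 'rV[K]_g.+4) t z0 z1 xi eta :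
  linear_form c (conic_point g A B C D t z0 z1 xi eta) =
  t * (\sum_(i < g.+2) coord c i * (m0 A B z0 z1 ^+ (g.+1 - i) * m1 C D z0 z1 ^+ i)) +
  coord c g.+2 * ((xi - eta) / (2 * 'i)) + coord c g.+3 * ((xi + eta) / 2).
Proof.
rewrite /linear_form -(coord_Tpoint_W g t (m0 A B z0 z1) (m1 C D z0 z1)).
rewrite -(coord_Tpoint_Y g t (m0 A B z0 z1) (m1 C D z0 z1)) -/(conic_point _ _ _ _ _ _ _ _ _ _).
under eq_bigr do rewrite -!coordE.
rewrite big_ord_recr /= big_ord_recr /= mulr_sumr; congr (_ + _ + _).
by apply: eq_bigr => i _; rewrite coord_Tpoint // mulrCA.
Qed.

(** [T] spans its projective space: the two points of [S] with [t = x = 0] or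
    [t = y = 0] over one base point show that the coefficients of [W] and [Y]
    vanish, and the others are the coefficients of a polynomial that vanishes
    on the base. *)
Lemma hyperplane_nonzero c : c != 0 ->
  exists2 p : coords S, pts p & linear_form c (monomial_map p) != 0.
Proof.
move=> c_neq0; apply: contrapT => none.
have vanish p : pts p -> linear_form c (monomial_map p) = 0.
  by move=> Sp; apply/eqP/negPn/negP => E; apply: none; exists p.
have i0 : 'i != 0 :> K := neq0Ci _.
have E1 : coord c g.+2 * (c2 / (2 * 'i)) + coord c g.+3 * (c2 / 2) = 0.
  pose p : coords S := if X == 2%N then row5 1 0 1 0 0 else row5 1 0 0 1 0.
  have Sp : pts p.
    rewrite /p; case: ifP => _; apply: pts_row5; rewrite ?oner_neq0 ?orbT //.
      by rewrite mulr0 expr0n mul0r.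
    by rewrite mul0r expr0n mul0r.
  rewrite -[RHS](vanish p Sp) /monomial_map linear_form_conic_point /p.
  by case: XY => -[-> ->]; rewrite /= !coord_row5 !mulr0 mul0r mulr1 subr0 addr0 add0r.
have E2 : coord c g.+2 * (- c3 / (2 * 'i)) + coord c g.+3 * (c3 / 2) = 0.
  pose p : coords S := if X == 2%N then row5 1 0 0 1 0 else row5 1 0 1 0 0.
  have Sp : pts p.
    rewrite /p; case: ifP => _; apply: pts_row5; rewrite ?oner_neq0 ?orbT //.
      by rewrite mul0r expr0n mul0r.
    by rewrite mulr0 expr0n mul0r.
  rewrite -[RHS](vanish p Sp) /monomial_map linear_form_conic_point /p.
  by case: XY => -[-> ->]; rewrite /= !coord_row5 !mulr0 mul0r mulr1 sub0r !add0r.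
have cY : coord c g.+3 = 0.
  apply: (mulfI (mulf_neq0 c20 c30)); rewrite mulr0.
  transitivity (c3 * (coord c g.+2 * (c2 / (2 * 'i)) + coord c g.+3 * (c2 / 2)) +
    c2 * (coord c g.+2 * (- c3 / (2 * 'i)) + coord c g.+3 * (c3 / 2))); first by field.
  by rewrite E1 E2 !mulr0 addr0.
have cW : coord c g.+2 = 0.
  have c2i : c2 / (2 * 'i) != 0 by apply: mulf_neq0 => //; rewrite invr_eq0; apply: mulf_neq0; rewrite ?pnatr_eq0.
  by apply: (mulIf c2i); move: E1; rewrite cY !mul0r addr0.
pose P := \poly_(i < g.+2) coord c i.
pose N0 : {poly K} := A%:P + B *: 'X; pose N1 : {poly K} := C%:P + D *: 'X.
have N0E w : m0 A B 1 w = N0.[w] by rewrite /m0 !(hornerD, hornerZ, hornerX, hornerC) mulr1.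
have N1E w : m1 C D 1 w = N1.[w] by rewrite /m1 !(hornerD, hornerZ, hornerX, hornerC) mulr1.
have AB : (A != 0) || (B != 0).
  apply: contraTT det0; rewrite negb_or !negbK => /andP[/eqP-> /eqP->].
  by rewrite !mul0r subrr eqxx.
have N0_neq0 : cofin (fun w => N0.[w] != 0) := cofin_horner_neq0 (lin_neq0 AB).
have fin b : cofin (fun w => N1.[w] / N0.[w] <> b).
  have nz : (C - b * A != 0) || (D - b * B != 0).
    apply: contraTT det0; rewrite negb_or !negbK !subr_eq0 => /andP[/eqP -> /eqP ->].
    by apply/eqP; ring.
  apply: cofinS (cofinI N0_neq0 (cofin_horner_neq0 (lin_neq0 nz))) => w [n0 /eqP n1] E.
  apply: n1; have : N1.[w] = b * N0.[w] by rewrite -E divfK.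
  rewrite /N0 /N1 !(hornerD, hornerZ, hornerX, hornerC) => E'.
  transitivity ((C + D * w) - b * (A + B * w)); first by ring.
  by rewrite E' subrr.
have P0 : P = 0.
  apply/eqP/negPn/negP => /cofin_horner_neq0/(cofin_comp fin)/(cofinI N0_neq0)/cofin_ex[w [n0 /eqP]].
  apply; apply: (mulfI (expf_neq0 g.+1 n0)); rewrite mulr0 horner_poly.
  pose p : coords S := row5 1 w 1 (root_form a 1 w) 1.
  have Sp : pts p by apply: pts_row5; rewrite ?oner_neq0 // mul1r expr1n mul1r.
  have := vanish p Sp; rewrite /monomial_map linear_form_conic_point cY cW !mul0r !addr0.
  rewrite /p !coord_row5 mulr1 => /eqP; rewrite mulf_eq0 (negPf c10) /= => /eqP E.
  rewrite -[RHS]E mulr_sumr; apply: eq_bigr => i _; rewrite N0E N1E expr_div_n mulrCA.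
  congr (_ * _); rewrite -[X in N0.[w] ^+ X](subnK (leq_ord i)) exprD -mulrA; congr (_ * _).
  by rewrite mulrCA divff ?mulr1 // expf_neq0.
move/eqP: c_neq0; apply; apply/rowP => j; rewrite [RHS]mxE -coordE.
case: (ltnP j g.+2) => [jg|gj].
  by have := congr1 (fun F : {poly K} => F`_j) P0; rewrite coef_poly jg coef0.
have [->|jg] := eqVneq (nat_of_ord j) g.+2; first exact: cW.
suff -> : nat_of_ord j = g.+3 by exact: cY.
by apply/eqP; rewrite eqn_leq -ltnS ltn_ord ltn_neqAle eq_sym jg gj.
Qed.

(** The pullback has the local equations [c / c0] for linear forms [c0], and
    the pullback of [c0] is again a section. *)
Lemma section_divisor_pullback c : c != 0 ->
  section_divisor (@pullback_divisor _ S T f c).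
Proof.
move=> c_neq0; exists (fun p => linear_form c (monomial_map p)); split.
- exact: section_form_hyperplane.
- exact: hyperplane_nonzero.
move=> p Sp; have [fS _ _] := f_mor; have [fp0 _] := fS p Sp.
have [c0 c0p] := linear_form_neq0 fp0.
exists (fun q => linear_form c (f q) / linear_form c0 (f q)); split; first by exists c0.
have dP := section_form_hyperplane c0.
have dp : linear_form c0 (monomial_map p) != 0.
  by have [b b0 E] := f_coords Sp; rewrite /monomial_map E linear_formZ mulf_neq0.
exists (fun q => linear_form c0 (monomial_map q)); split=> //.
apply: locallyS (locally_neq0 (proj1 dP) dp) => v Sv.
have [b b0 E] := f_coords Sv; rewrite /monomial_map E !linear_formZ mulf_eq0 (negPf b0) /= => cq.
by rewrite mulrCA divfK.
Qed.

End Hyperplane.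

End Hyperplanes.

(** * Comparison of the two kinds of minitwistor lines *)

Section Conclusion.

Variable K : numClosedFieldType.

(** The explicit form of [f] given by [morphism_classification] makes linear
    forms on [T] sections on [S], in either of the two cases. *)
Lemma section_divisor_hyperplane g (a : 'I_(2 * g.+1) -> K) (J : finType) (r : J -> K)
    (q : {mpoly K[g.+2]}) n (B : set 'rV[K]_n)
    (mu : coords (proj B) -> coords (hyperelliptic_surface q))
    (phi : coords (conic_surface a) -> coords (proj B))
    (m : coords (P1 K) -> coords (P1 K)) (c : 'rV[K]_g.+4) :
  injective a -> #|J| = g.+1.*2 -> injective r -> q \is 2.-homog ->
  (forall z, q.@[fun i : 'I_g.+2 => z ^+ i] = - \prod_j (z - r j)) ->
  resolution mu -> isomorphism phi -> isomorphism m ->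
  (forall (p : coords (conic_surface a)) (e : coords (P1 K)), pts p -> pts e ->
     conicT (mu (phi p)) e -> @same _ (P1 K) (m (conicS p)) e) ->
  c != 0 ->
  section_divisor (@pullback_divisor _ (conic_surface a) (hyperelliptic_surface q)
    (fun p => mu (phi p)) c).
Proof.
move=> a_inj cardJ rinj qhom qE mu_res phi_iso /automorphism_P1[A [B' [C [D [det0 mE]]]]] f_conic c0.
have [Bproj _ mu_mor _] := mu_res; have [phi_mor _] := phi_iso.
have f_mor := morphism_comp Bproj mu_mor phi_mor.
have f_onto := resolution_onto mu_res phi_iso.
have f_inj := resolution_injective (@S_sym _ _ a) (@S_trans _ _ a) mu_res phi_iso.
have [c1 [c2 [c3 [c10 c20 c30 E]]]] :=
  morphism_classification cardJ rinj qhom qE f_mor f_onto f_inj det0 mE f_conic a_inj.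
case: E => E.
  apply: (section_divisor_pullback det0 c10 c20 c30 (or_introl erefl) f_mor E c0).
apply: (section_divisor_pullback det0 c10 c20 c30 (or_intror erefl) f_mor E c0).
Qed.

Lemma section_divisor_twistor_line l (a : 'I_(2 * l) -> K) (x y z : {poly K}) :
    (0 < l)%N -> (size x <= (2 * l).+1)%N -> (size y <= (2 * l).+1)%N -> (size z <= 3)%N ->
    x * y = \prod_i (z - a i *: 'X) ->
    (forall u : K, u != 0 -> x.[- (u^* )^-1] = (y.[u])^* / u^* ^+ (2 * l) /\
       z.[- (u^* )^-1] = - (z.[u])^* / u^* ^+ 2) ->
    z`_2 != 0 -> (forall g : K, root x g -> 0 < z`_2 * g) ->
  section_divisor (curve_divisor (line (a := a) x y z)).
Proof.
move=> l0 sx sy sz xyE real z2 xpos.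
have [ka [k [p [ka0 k0 zinv xy_sum y_moves]]]] :=
  twistor_equation l0 sx sy sz xyE real z2 xpos.
have sz3 : size z = 3%N.
  apply/eqP; rewrite eqn_leq sz /= ltnNge; apply/negP => sz2.
  by move/eqP: z2; apply; rewrite nth_default.
exact: section_divisor_line xyE ka0 k0 sz3 zinv xy_sum y_moves.
Qed.

End Conclusion.

Theorem proposition6p2
  (R : realType) (l : nat) (hl : (3 <= l)%N)
  (a : 'I_(2 * l) -> R)
  (ha : forall i j : 'I_(2 * l), (i < j)%N -> a i < a j)
  (lam lam' : 'I_l.-1.+1 -> R) (hlam : interlaced lam lam')
  (q : {mpoly R[i][l.-1.+2]}) (hq : hyperelliptic_form lam lam' q)
  (n : nat) (B : set 'rV[R[i]]_n)
  (mu : coords (proj B) -> coords (surfaceT q)) (hmu : minimal_resolution mu)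
  (phi : coords (surfaceS a) -> coords (proj B)) (hphi : isomorphism phi)
  (hreal : @real_compatible R l a l.-1 q (fun p => mu (phi p)))
  (hconic : @conic_compatible R l a l.-1 q (fun p => mu (phi p))) :
  let minitwistor (D : effdiv (surfaceS a)) :=
    (exists2 C, minitwistor_lineS C & D = curve_divisor C) \/
    (exists2 c, minitwistor_hyperplane q c &
       D = @pullback_divisor _ (surfaceS a) (surfaceT q)
             (fun p => mu (phi p)) c) in
  forall D D' : effdiv (surfaceS a),
    minitwistor D -> minitwistor D' -> linearly_equivalent D D'.
Proof.
case: l hl a ha lam lam' hlam q hq mu hmu phi hphi hreal hconic => // g _ a ha lam lam' hlam q hq mu hmu phi hphi _ [m m_iso f_conic] minitwistor.
pose aK i : R[i] := real_complex R (a i).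
change g.+1.-1 with g in *.
pose J : finType := ('I_g.+1 + 'I_g.+1)%type.
pose r (j : J) : R[i] := real_complex R (match j with inl i => lam i | inr i => lam' i end).
have cinj : injective (real_complex R) by exact: fmorph_inj.
have a_inj : injective aK.
  move=> i j /cinj E; apply: val_inj; case: (ltngtP i j) => // /ha; by rewrite E ltxx.
have cardJ : #|J| = g.+1.*2 by rewrite card_sum !card_ord addnn.
have [lamlam' lam'lam] := hlam.
have r_inj : injective r.
  have lt (i j : 'I_g.+1) : (i < j)%N -> lam i < lam j by move=> ij; apply: lt_trans (lamlam' i) (lam'lam _ _ ij).
  have lt' (i j : 'I_g.+1) : (i < j)%N -> lam' i < lam' j by move=> ij; apply: lt_trans (lam'lam _ _ ij) (lamlam' j).
  have ne i j : lam i <> lam' j.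
    case: (ltngtP j i) => [ji|ij|/val_inj ->] E.
    - by have := lam'lam _ _ ji; rewrite E ltxx.
    - by have := lt_trans (lt _ _ ij) (lamlam' j); rewrite E ltxx.
    - by have := lamlam' i; rewrite E ltxx.
  move=> [i|i] [j|j] /cinj E.
  - by congr inl; apply: val_inj; case: (ltngtP i j) => // /lt; rewrite E ltxx.
  - by case: (ne i j).
  - by case: (ne j i).
  - by congr inr; apply: val_inj; case: (ltngtP i j) => // /lt'; rewrite E ltxx.
have [qhom qE] := hq.
have qE' z : q.@[fun i : 'I_g.+2 => z ^+ i] = - \prod_j (z - r j).
  by rewrite qE big_sumType /= -big_split.
suff section D : minitwistor D -> @section_divisor _ _ aK D.
  by move=> D D' /section DS /section; apply: section_divisors_equivalent.
move=> [[C [x [y [z [[[sx sy sz] xyE real xpos] z2 ->]]]] ->]|[c [c0 _] ->]].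
  apply: (@section_divisor_twistor_line _ _ aK x y z) => //.
  - by move=> u /real[].
  - by move: xpos; rewrite (negPf z2).
apply: (@section_divisor_hyperplane _ _ aK J r q n B mu phi m c) => //.
by case: hmu.
Qed.
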